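(* Let $n\ge1$, and let $(E,\eta,g,\Phi)$ be a tt*-structure of rank $n+1$ over $\mathbb{C}^*$ with non-vanishing $\Phi$. Suppose $(E,\eta,g,\Phi)$ is a representative of a $\mathbb{Z}_{n+1}$-fixed point, and that for all $z\in\sqrt{-1}\,\mathbb{R}$ there exists an isomorphism of tt*-structures $$\mathcal{T}_z:(\rho_z^*E,\rho_z^*\eta,\rho_z^*g,e^{-z}\rho_z^*\Phi)\stackrel{\sim}{\longrightarrow}(E,\eta,g,\Phi)$$ such that $\mathcal{T}_z(a)$ is continuous in $z$ for all $a\in E$. Then the tt*-equation of $(E,\eta,g,\Phi)$ is equivalent to the tt*-Toda equation with the radial condition $w_j(t,\bar t)=w_j(|t|)$.
   Context: A tt*-structure $(E,\eta,g,\Phi)$ over $\mathbb{C}^*$ is a holomorphic vector bundle $E\to\mathbb{C}^*$ with holomorphic structure $\bar\partial_E$, a holomorphic nondegenerate symmetric bilinear form $\eta$, a Hermitian metric $g$ and a holomorphic $\mathrm{End}(E)$-valued 1-form $\Phi$ such that: (a) $\Phi$ is self-adjoint with respect to $\eta$; (b) the map $\kappa$ defined by $g(a,b)=\eta(\kappa(a),b)$ is a complex conjugate-linear involution, i.e. $\kappa^2=\mathrm{Id}_E$ and $\kappa(\mu a)=\bar\mu\,\kappa(a)$; (c) for every $\lambda\in S^1$ the connection $\nabla^\lambda=D+\lambda^{-1}\Phi+\lambda\Phi^{\dagger_g}$ is flat, where $D=\partial_E^g+\bar\partial_E$ is the Chern connection of $g$ and $\Phi^{\dagger_g}$ is the $g$-adjoint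 of $\Phi$. The flatness condition $[\partial_E^g,\bar\partial_E]=-[\Phi,\Phi^{\dagger_g}]$ is called the tt*-equation. An isomorphism $T:(E_1,\eta_1,g_1,\Phi_1)\to(E_2,\eta_2,g_2,\Phi_2)$ is a bundle map of holomorphic bundles with $\eta_1(a,b)=\eta_2(Ta,Tb)$, $g_1(a,b)=g_2(Ta,Tb)$, $T((\Phi_1)_X(a))=(\Phi_2)_X(T(a))$ for all sections $a,b$ and tangent vector fields $X$ of $\mathbb{C}^*$; the tt*-equations of isomorphic tt*-structures are called equivalent. A $\mathbb{Z}_{n+1}$-fixed point is an isomorphism class of tt*-structures with $(E,\eta,g,\Phi)\cong(E,\eta,g,\omega\Phi)$, $\omega=e^{2\pi\sqrt{-1}/(n+1)}$. For $z\in\mathbb{C}$ let $\rho_z:\mathbb{C}^*\to\mathbb{C}^*$, $\rho_z(t)=e^zt$. With $\pi:E\to\mathbb{C}^*$ the projection, $\rho_z^*E=\{(t,a)\in\mathbb{C}^*\times E\mid\rho_z(t)=\pi(a)\}$, $(\rho_z^*\eta)_t((t,a),(t,b))=\eta_{\rho_z(t)}(a,b)$, $(\rho_z^*g)_t((t,a),(t,b))=g_{\rho_z(t)}(a,b)$, $(\rho_z^*\Phi)_X(t,a)=(t,\Phi_{(d\rho_z)_t(X)}(a))$ for $X\in T_t\mathbb{C}^*$. For $a\in E$, $\mathcal{T}_z(a)$ means $\mathcal{T}_z$ applied to the point $(\rho_z^{-1}(\pi(a)),a)$ of $\rho_z^*E$. The tt*-Toda equation is $(w_j)_{t\bar t}=e^{w_j-w_{j-1}}-e^{w_{j+1}-w_j}$,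 $w_j:\mathbb{C}^*\to\mathbb{R}$, with $w_j=w_{j+n+1}$ and $w_j+w_{l-j-1}=0$ for some $l\in\mathbb{Z}$. It is the tt*-equation, with respect to the frame $e_0,\dots,e_n$, of the tt*-structure with $\eta(e_i,e_j)=\delta_{i,l-1-j}$ if $0\le i\le l-1$ and $\delta_{i,n+l-j}$ if $l\le i\le n$ ($l\in\{0,\dots,n\}$), $\Phi(e_j)=e_{j+1}dt$ ($0\le j\le n-1$), $\Phi(e_n)=e_0\,dt$, $g(e_i,e_j)=e^{w_j}\delta_{ij}$, where $t$ is the coordinate of $\mathbb{C}^*$.
   Formalization: ''Equivalent to tt*-Toda'' is mended: the structure is isomorphic to the Toda one after a coordinate change t → e^ζ t and possibly a twist by the flat line bundle of monodromy −1 (none if T_{2πi}=T_0), since strict isomorphism fails for cΦ and for η=t·Id, g=|t|·Id, Φ=diag(1,−1)dt. *)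

(* Defs.v *)
From HB Require Import structures.
From mathcomp Require Import all_boot all_order all_algebra.
From mathcomp Require Import complex.
From mathcomp Require Import all_classical all_reals all_analysis.

Set Implicit Arguments.
Unset Strict Implicit.
Unset Printing Implicit Defensive.

Import Order.TTheory GRing.Theory Num.Theory.
Import numFieldNormedType.Exports.

Local Open Scope classical_set_scope.
Local Open Scope ring_scope.
Local Open Scope complex_scope.

Section Calculus.
Variable R : realType.
Local Notation C := R[i].

Definition cexp (z : C) : C :=
  (expR (complex.Re z))%:C * (cos (complex.Im z) +i* sin (complex.Im z)).

Lemma cexpNK (z t : C) : t = cexp z * (cexp (- z) * t).
Proof.
suff -> : cexp z * (cexp (- z) * t) = (cexp z * cexp (- z)) * t.
  suff -> : cexp z * cexp (- z) = 1 by rewrite mul1r.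
  case: z => x y; rewrite /cexp /= mulrACA -rmorphM expRxMexpNx_1 mul1r.
  apply/eqP; rewrite eq_complex /= cosN sinN; apply/andP; split; apply/eqP.
    by rewrite mulrN opprK -!expr2 cos2Dsin2.
  by rewrite mulrN mulrC addrC subrr.
by rewrite mulrA.
Qed.

Definition Cstar : set C := [set t | t != 0].

(* The real directional derivative of f along v: v = 1 and v = 0 +i* 1 give
   the partial derivatives in x and y, where t = x + iy. *)
Definition pderivable (v : C) (f : C -> C) (t : C) : Prop :=
  derivable (fun h : R^o => complex.Re (f (t + h%:C * v)) : R^o) 0 1 /\
  derivable (fun h : R^o => complex.Im (f (t + h%:C * v)) : R^o) 0 1.

Definition pderive (v : C) (f : C -> C) (t : C) : C :=
  derive1 (fun h : R => complex.Re (f (t + h%:C * v)) : R^o) 0 +i*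
  derive1 (fun h : R => complex.Im (f (t + h%:C * v)) : R^o) 0.

Definition d_t (f : C -> C) (t : C) : C :=
  (pderive 1 f t - (0 +i* 1) * pderive (0 +i* 1) f t) / 2%:R.

Definition d_tbar (f : C -> C) (t : C) : C :=
  (pderive 1 f t + (0 +i* 1) * pderive (0 +i* 1) f t) / 2%:R.

(* Real differentiability of class C^k on the open set U. *)
Fixpoint smooth_upto (k : nat) (U : set C) (f : C -> C) : Prop :=
  match k with
  | 0 => forall t : C, U t -> {for t, continuous (f : C^o -> C^o)}
  | k'.+1 => [/\ forall t, U t -> pderivable 1 f t /\ pderivable (0 +i* 1) f t,
                 smooth_upto k' U (pderive 1 f) &
                 smooth_upto k' U (pderive (0 +i* 1) f)]
  end.

Definition smooth (U : set C) (f : C -> C) : Prop :=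
  forall k, smooth_upto k U f.

(* C^infty and in the kernel of the operator d/dtbar. *)
Definition holomorphic (U : set C) (f : C -> C) : Prop :=
  smooth U f /\ forall t, U t -> d_tbar f t = 0.

Definition dmx_t r (A : C -> 'M[C]_r) (t : C) : 'M[C]_r :=
  \matrix_(k, l) d_t (fun s => A s k l) t.

Definition dmx_tbar r (A : C -> 'M[C]_r) (t : C) : 'M[C]_r :=
  \matrix_(k, l) d_tbar (fun s => A s k l) t.

End Calculus.

Arguments Cstar {R}.

Section Bundles.
Variable R : realType.
Local Notation C := R[i].

(* Objects over C^* are given by families indexed by all t : C; what happens
   over t = 0 is irrelevant, since every condition is imposed on C^* only.
   A bundle is given by its fibres and an atlas of local trivialisations:
   over the domain of the chart i, [loc i t] maps C^r onto the fibre at t and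
   [crd i t] is its inverse.  [holo_bundle] is the condition that these data
   form a holomorphic vector bundle over C^*. *)
Record bundle (r : nat) : Type := Bundle {
  fib : C -> lmodType C;
  chart : Type;
  dom : chart -> set C;
  loc : forall (i : chart) (t : C), 'cV[C]_r -> fib t;
  crd : forall (i : chart) (t : C), fib t -> 'cV[C]_r }.

Arguments crd {r b} i t _.

Definition frame r (B : bundle r) (i : chart B) (t : C) (l : 'I_r) : fib B t :=
  loc i t (delta_mx l 0).

Record holo_bundle r (B : bundle r) : Prop := HoloBundle {
  hb_open : forall i : chart B, open (dom i : set C^o);
  hb_sub : forall i : chart B, dom i `<=` Cstar;
  hb_cover : forall t, Cstar t -> exists i : chart B, dom i t;
  hb_lin : forall (i : chart B) t, dom i t -> linear (loc i t);
  hb_locK : forall (i : chart B) t, dom i t -> cancel (loc i t) (crd i t);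
  hb_crdK : forall (i : chart B) t, dom i t -> cancel (crd i t) (loc i t);
  hb_trans : forall (i j : chart B) k l,
    holomorphic (dom i `&` dom j) (fun t => crd j t (frame i t l) k 0) }.

(* The total space, and continuity of a curve in it. *)
Definition total_space r (B : bundle r) : Type := {t : C & fib B t}.

Definition continuous_curve r (B : bundle r) (c : R -> total_space B) : Prop :=
  forall y : R,
    {for y, continuous ((fun x => projT1 (c x)) : R -> C^o)} /\
    forall i : chart B, dom i (projT1 (c y)) -> forall k,
      {for y, continuous
        ((fun x => crd i (projT1 (c x)) (projT2 (c x)) k 0) : R -> C^o)}.

(* The (1,0)-form Phi takes a tangent vector X in T_t C^* = C (the coefficient
   of d/dt) and gives an endomorphism of the fibre at t. *)
Record ttdata (r : nat) : Type := TTData {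
  bun :> bundle r;
  tt_eta : forall t : C, fib bun t -> fib bun t -> C;
  tt_met : forall t : C, fib bun t -> fib bun t -> C;
  tt_Phi : forall t : C, C -> fib bun t -> fib bun t }.

Section LocalExpressions.
Variables (r : nat) (D : ttdata r) (i : chart D).

Definition eta_mx (t : C) : 'M[C]_r :=
  \matrix_(k, l) tt_eta (frame i t k) (frame i t l).

(* The metric is conjugate-linear in its first argument, so that g(a, b) is
   a^* H b in coordinates, with H the Gram matrix [met_mx]. *)
Definition met_mx (t : C) : 'M[C]_r :=
  \matrix_(k, l) tt_met (frame i t k) (frame i t l).

(* Phi = phi dt *)
Definition Phi_mx (t : C) : 'M[C]_r :=
  \matrix_(k, l) crd i t (tt_Phi 1 (frame i t l)) k 0.

(* The g-adjoint is phi^dag dtbar with g(phi a, b) = g(a, phi^dag b). *)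
Definition Phi_adj_mx (t : C) : 'M[C]_r :=
  invmx (met_mx t) *m (map_mx (@conjc R) (Phi_mx t))^T *m met_mx t.

(* In a holomorphic frame the Chern connection is d + A dt, and the condition
   d_t g(e_k, e_l) = g(e_k, D_t e_l) reads d_t H = H A. *)
Definition chern_mx (t : C) : 'M[C]_r :=
  invmx (met_mx t) *m dmx_t met_mx t.

(* nabla^lambda = d + P dt + Q dtbar *)
Definition nabla_t_mx (lambda t : C) : 'M[C]_r :=
  chern_mx t + lambda^-1 *: Phi_mx t.

Definition nabla_tbar_mx (lambda t : C) : 'M[C]_r :=
  lambda *: Phi_adj_mx t.

(* The coefficient of dt /\ dtbar in the curvature. *)
Definition curvature_mx (lambda t : C) : 'M[C]_r :=
  let P := nabla_t_mx lambda in
  let Q := nabla_tbar_mx lambda in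
  dmx_t Q t - dmx_tbar P t + P t *m Q t - Q t *m P t.

End LocalExpressions.

Record is_ttstar r (D : ttdata r) : Prop := IsTTStar {
  tt_bundle : holo_bundle D;
  eta_scalar : forall t, Cstar t -> forall a : fib D t, scalar (tt_eta a);
  eta_sym : forall t, Cstar t -> forall a b : fib D t, tt_eta a b = tt_eta b a;
  eta_nondeg : forall t, Cstar t -> forall a : fib D t,
    (forall b, tt_eta a b = 0) -> a = 0;
  eta_holo : forall (i : chart D) k l,
    holomorphic (dom i) (fun t => eta_mx i t k l);
  met_scalar : forall t, Cstar t -> forall a : fib D t, scalar (tt_met a);
  met_herm : forall t, Cstar t -> forall a b : fib D t,
    tt_met b a = conjc (tt_met a b);
  met_pos : forall t, Cstar t -> forall a : fib D t, a != 0 -> 0 < tt_met a a;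
  met_smooth : forall (i : chart D) k l,
    smooth (dom i) (fun t => met_mx i t k l);
  Phi_form : forall t, Cstar t -> forall X (a : fib D t),
    tt_Phi X a = X *: tt_Phi 1 a;
  Phi_linear : forall t, Cstar t -> forall X,
    linear (tt_Phi X : fib D t -> fib D t);
  Phi_holo : forall (i : chart D) k l,
    holomorphic (dom i) (fun t => Phi_mx i t k l);
  Phi_selfadj : forall t, Cstar t -> forall X (a b : fib D t),
    tt_eta (tt_Phi X a) b = tt_eta a (tt_Phi X b);
  tt_real : forall t, Cstar t -> exists kappa : fib D t -> fib D t,
    [/\ forall a b, tt_met a b = tt_eta (kappa a) b,
        involutive kappa,
        forall a b, kappa (a + b) = kappa a + kappa b &
        forall (mu : C) a, kappa (mu *: a) = conjc mu *: kappa a];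
  tt_flat : forall lambda : C, `|lambda| = 1 -> forall (i : chart D) t,
    dom i t -> curvature_mx i lambda t = 0 }.

Record is_iso r (D1 D2 : ttdata r) (T : forall t, fib D1 t -> fib D2 t) :
    Prop := IsIso {
  iso_linear : forall t, Cstar t -> linear (T t);
  iso_bij : forall t, Cstar t -> bijective (T t);
  iso_holo : forall (i : chart D1) (j : chart D2) k l,
    holomorphic (dom i `&` dom j) (fun t => crd j t (T t (frame i t l)) k 0);
  iso_eta : forall t, Cstar t -> forall a b, tt_eta (T t a) (T t b) = tt_eta a b;
  iso_met : forall t, Cstar t -> forall a b, tt_met (T t a) (T t b) = tt_met a b;
  iso_Phi : forall t, Cstar t -> forall X a, T t (tt_Phi X a) = tt_Phi X (T t a) }.

Definition isomorphic r (D1 D2 : ttdata r) : Prop :=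
  exists T : forall t, fib D1 t -> fib D2 t, is_iso T.

Definition scale_Phi (c : C) r (D : ttdata r) : ttdata r :=
  @TTData r D (@tt_eta r D) (@tt_met r D) (fun t X a => c *: tt_Phi X a).

(* Pull-back along rho_z : t |-> e^z t, whose differential is X |-> e^z X. *)
Definition pullback_bundle (z : C) r (B : bundle r) : bundle r :=
  @Bundle r (fun t => fib B (cexp z * t)) (chart B)
    (fun i => [set t | dom i (cexp z * t)])
    (fun i t => loc i (cexp z * t)) (fun i t => crd i (cexp z * t)).

Definition pullback (z : C) r (D : ttdata r) : ttdata r :=
  @TTData r (pullback_bundle z D)
    (fun t => @tt_eta r D (cexp z * t)) (fun t => @tt_met r D (cexp z * t))
    (fun t X => @tt_Phi r D (cexp z * t) (cexp z * X)).

(* Value of a bundle map T : rho_z^* E -> E at (rho_z^-1 (t), a), for a in the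
   fibre of E over t, as a point of the total space of E. *)
Definition map_at r (B : bundle r) (z : C)
    (T : forall t, fib B (cexp z * t) -> fib B t)
    (t : C) (a : fib B t) : total_space B :=
  existT (fun s => fib B s : Type) (cexp (- z) * t)
    (T (cexp (- z) * t) (eq_rect t (fun s => fib B s : Type) a _ (cexpNK z t))).

(* For b = true, the tensor product of D with the flat line bundle of
   monodromy -1 having sqrt t as a (two-valued) flat frame of unit length: its
   square is a global frame, in which eta and g become t eta and |t| g.  Since
   log |t| is harmonic, D and [sign_twist true D] have the same tt*-equation. *)
Definition sign_twist (b : bool) r (D : ttdata r) : ttdata r :=
  @TTData r D (fun t x y => t ^+ b * tt_eta x y)
    (fun t x y => `|t| ^+ b * tt_met x y) (@tt_Phi r D).

Definition trivial_bundle (r : nat) : bundle r :=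
  @Bundle r (fun=> 'cV[C]_r) unit (fun=> Cstar) (fun _ _ v => v) (fun _ _ v => v).

Definition toda_eta (n l : nat) (i j : nat) : C :=
  (if (i < l)%N then i + j + 1 == l else i + j == n + l)%N%:R.

(* The tt*-structure of the tt*-Toda equation; e_j is the j-th basis vector. *)
Definition toda (n l : nat) (w : int -> C -> R) : ttdata n.+1 :=
  @TTData n.+1 (trivial_bundle n.+1)
    (fun t a b => \sum_(i < n.+1) \sum_(j < n.+1)
                    a i 0 * toda_eta n l i j * b j 0)
    (fun t a b => \sum_(j < n.+1)
                    conjc (a j 0) * (expR (w (Posz j) t))%:C * b j 0)
    (fun t X a => X *: \sum_(j < n.+1) a j 0 *: delta_mx (ordS j) 0).

Record toda_solution (n l : nat) (w : int -> C -> R) : Prop := TodaSolution {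
  toda_smooth : forall j, smooth Cstar (fun t => (w j t)%:C);
  toda_period : forall j t, Cstar t -> w (j + n.+1%:Z) t = w j t;
  toda_antisym : forall j t, Cstar t -> w j t + w (l%:Z - j - 1) t = 0;
  toda_eqn : forall j t, Cstar t ->
    d_t (d_tbar (fun s => (w j s)%:C)) t =
    (expR (w j t - w (j - 1) t) - expR (w (j + 1) t - w j t))%:C }.

Definition radial (w : int -> C -> R) : Prop :=
  forall j t, Cstar t -> w j t = w j `|t|.

End Bundles.

(* Main.v *)
(* Write Phi = phi dt and N = n + 1.  The automorphism S of the fixed point condition
   satisfies S phi = w phi S, so phi^N = c is scalar; c is holomorphic and invariant
   under rotations, hence constant.  It is non-zero: otherwise phi is nilpotent, and
   f = tr (phi phi^dag) > 0 is a radial function with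
   f dd^bar f - |df|^2 >= f^3 / K, by flatness, which forces blow-up of the function
   f(e^s) e^2s in finite time.  So c = mu^N, and phi has a line of mu-eigenvectors in
   each fibre, spanned by vectors A with eta(A, A) = 1 / N, unique up to sign.  The
   continuous family T_y transports a choice of sign around the circles, which gives a
   global holomorphic section V = A or V = sqrt(t) A, according to the monodromy b.
   S^N V = +- V, and the vectors e_j = sum_k (s w^j)^-k S^k V, with s^N = +- 1, form a
   frame in which phi / mu is the cyclic shift and S is diagonal.  As S preserves eta
   and g, g is diagonal and eta antidiagonal in this frame.  Finally T_y commutes with
   S up to a sign independent of y, so g(e_j, e_j) is radial; the substitution
   t -> mu t removes mu. *)

Require Import Defs.
From HB Require Import structures.
From mathcomp Require Import all_boot all_order all_algebra.
From mathcomp Require Import complex.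
From mathcomp Require Import all_classical all_reals all_analysis.
From mathcomp Require Import ring lra zify.
Import ComplexField.Normc.
Set Implicit Arguments.
Unset Strict Implicit.
Unset Printing Implicit Defensive.
Import Order.TTheory GRing.Theory Num.Theory.
Import numFieldNormedType.Exports.
Local Open Scope classical_set_scope.
Local Open Scope ring_scope.
Local Open Scope complex_scope.

Arguments crd {R r b} i t _.

(** * Wirtinger calculus *)

Section ComplexLimits.
Variable R : realType.
Local Notation C := R[i].
Local Notation Re := complex.Re.
Local Notation Im := complex.Im.

(** The family T_y is continuous in y on each single vector only, obeys no group law, and T_0 need
    not be the identity. Signs are therefore compared locally, either in y at a fixed vector or in t
    at a fixed y, where T_y is holomorphic, and are lifted through the coordinates of log t; the
    monodromy of the eigenline is T_2pi measured against T_0. The contradiction in the nilpotent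
    case is of Ahlfors-Schwarz type: f |dt|^2 would be a conformal metric on C^* of curvature
    bounded above by a negative constant, whereas log t makes C^* a flat cylinder, infinite at both
    ends. Holomorphic eigenvectors come from a projection that is a polynomial in phi, and
    normalised ones from continuous functions with holomorphic square. The value eta(A, A) = 1 / N
    is chosen because a non-zero eta(e_i, e_j) is a sum of N terms, each equal to eta(V, V), so that
    it becomes 1, or t when b is true. The sign in S^N V = +- V decides l: the plus sign gives l = 1
    and the minus sign l = 0. *)

Lemma ReD (x y : C) : Re (x + y) = Re x + Re y. Proof. by case: x y => ? ? []. Qed.
Lemma ImD (x y : C) : Im (x + y) = Im x + Im y. Proof. by case: x y => ? ? []. Qed.
Lemma ReN (x : C) : Re (- x) = - Re x. Proof. by case: x. Qed.
Lemma ImN (x : C) : Im (- x) = - Im x. Proof. by case: x. Qed.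
Lemma ReM (x y : C) : Re (x * y) = Re x * Re y - Im x * Im y.
Proof. by case: x y => ? ? []. Qed.
Lemma ImM (x y : C) : Im (x * y) = Re x * Im y + Im x * Re y.
Proof. by case: x y => ? ? [? ?] /=; rewrite addrC. Qed.
Lemma ReJ (x : C) : Re (conjc x) = Re x. Proof. by case: x. Qed.
Lemma ImJ (x : C) : Im (conjc x) = - Im x. Proof. by case: x. Qed.
Lemma eqC (x y : C) : Re x = Re y -> Im x = Im y -> x = y.
Proof. by case: x y => ? ? [? ?] /= -> ->. Qed.
Definition reE := (ReD, ImD, ReN, ImN, ReM, ImM, ReJ, ImJ).

Lemma normCE (z : C) : `|z| = (normc z)%:C. Proof. by []. Qed.

Lemma normc_Re (z : C) : `|Re z| <= normc z.
Proof. by rewrite -lecR -normCE normc_ge_Re. Qed.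

Lemma normc_Im (z : C) : `|Im z| <= normc z.
Proof.
case: z => a b /=; rewrite -sqrtr_sqr ler_sqrt ?addr_ge0 ?sqr_ge0 //.
by rewrite lerDr sqr_ge0.
Qed.

Lemma normc_le (z : C) : normc z <= `|Re z| + `|Im z|.
Proof.
have -> : z = (Re z)%:C + 'i * (Im z)%:C by rewrite -complexE.
apply: le_trans (le_normcD _ _) _; rewrite normcM.
rewrite !reE /= !(mul0r, mulr0, mul1r, subr0, addr0, add0r).
by rewrite !expr0n /= !(addr0, add0r, expr1n, sqrtr1, mul1r) !sqrtr_sqr.
Qed.

(** Balls of [C^o] have their radii in [C], where 0 < e forces e to be real; neighbourhoods thus
    reduce to discs of real radius. *)
Lemma nbhsCP (t : C^o) (P : C -> Prop) :
  nbhs t P <-> exists2 d : R, 0 < d & forall s : C, normc (s - t) < d -> P s.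
Proof.
split.
- rewrite -nbhs_ballE => -[e /= e0 eP].
  move: e0; rewrite ltcE /= => /andP[/eqP ie re].
  exists (Re e) => // s st; apply: eP; rewrite /ball /= distrC normCE.
  by rewrite ltcE /= ie eqxx.
- case=> d d0 H; rewrite -nbhs_ballE; exists (d%:C); first by rewrite /= ltcR.
  by move=> s; rewrite /ball /= distrC normCE ltcR => /H.
Qed.

Lemma cvgCP {T} (F : set_system T) {FF : Filter F} (f : T -> C) (l : C) :
  (f @ F --> (l : C^o)) <->
  ((fun x => Re (f x)) @ F --> (Re l : R^o)) /\
  ((fun x => Im (f x)) @ F --> (Im l : R^o)).
Proof.
split.
- move=> H; split; apply/cvgrPdist_lt => e e0.
  + have /nbhsCP : exists2 d : R, 0 < d & forall s : C, normc (s - l) < d ->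
      `|Re l - Re s| < e.
      exists e => // s; apply: le_lt_trans; rewrite distrC -ReN -ReD.
      exact: normc_Re.
    by move=> /H.
  + have /nbhsCP : exists2 d : R, 0 < d & forall s : C, normc (s - l) < d ->
      `|Im l - Im s| < e.
      exists e => // s; apply: le_lt_trans; rewrite distrC -ImN -ImD.
      exact: normc_Im.
    by move=> /H.
- case=> H1 H2 P /nbhsCP[d d0 dP].
  move/cvgrPdist_lt : H1 => /(_ (d / 2) (divr_gt0 d0 (ltr0Sn _ 1))) H1.
  move/cvgrPdist_lt : H2 => /(_ (d / 2) (divr_gt0 d0 (ltr0Sn _ 1))) H2.
  near=> x; apply: dP; apply: le_lt_trans (normc_le _) _.
  rewrite (splitr d) !reE ltrD //.
    by rewrite distrC; near: x.
  by rewrite distrC; near: x.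
Unshelve. all: by end_near. Qed.

Lemma openCP (U : set C) : open (U : set C^o) <->
  forall t, U t -> exists2 d : R, 0 < d & forall s : C, normc (s - t) < d -> U s.
Proof.
by rewrite openE; split => H t Ut; [apply/nbhsCP; exact: H|apply/nbhsCP; exact: H].
Qed.

Lemma cvgcD {T} (F : set_system T) {FF : Filter F} (f g : T -> C) (a b : C) :
  f @ F --> (a : C^o) -> g @ F --> (b : C^o) -> (fun x => f x + g x) @ F --> (a + b : C^o).
Proof. exact: (@cvgD _ C^o T F FF f g a b). Qed.

Lemma normc_gt0 (z : C) : z != 0 -> 0 < normc z.
Proof. by move=> z0; rewrite -ltcR -normCE normr_gt0. Qed.

Lemma cvgc_neq0 {T} (F : set_system T) {FF : Filter F} (f : T -> C) (a : C) :
  a != 0 -> f @ F --> (a : C^o) -> \forall x \near F, f x != 0.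
Proof.
move=> a0 H; apply: (H [set z : C | z != 0]); apply/nbhsCP; exists (normc a); first exact: normc_gt0.
by move=> s; apply: contraTneq => ->; rewrite sub0r normcN ltxx.
Qed.

Lemma cvgcN {T} (F : set_system T) {FF : Filter F} (f : T -> C) (a : C) :
  f @ F --> (a : C^o) -> (fun x => - f x) @ F --> (- a : C^o).
Proof. exact: (@cvgN _ C^o T F FF f a). Qed.

Lemma cvgcM {T} (F : set_system T) {FF : Filter F} (f g : T -> C) (a b : C) :
  f @ F --> (a : C^o) -> g @ F --> (b : C^o) -> (fun x => f x * g x) @ F --> (a * b : C^o).
Proof. exact: (@cvgM _ T F FF f g a b). Qed.

Lemma cvgcV {T} (F : set_system T) {FF : Filter F} (f : T -> C) (a : C) :
  a != 0 -> f @ F --> (a : C^o) -> (fun x => (f x)^-1) @ F --> (a^-1 : C^o).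
Proof. exact: (@cvgV _ T F FF f a). Qed.

(** A relation instead of an operator, so that existence and value of the derivative travel
    together. *)
Definition cder (g : R -> C) (x : R) (d : C) : Prop :=
  is_derive (x : R^o) (1 : R^o) (fun h => Re (g h) : R^o) (Re d) /\
  is_derive (x : R^o) (1 : R^o) (fun h => Im (g h) : R^o) (Im d).

Lemma is_deriveP (f : R -> R) (x d : R) :
  is_derive (x : R^o) (1 : R^o) (f : R^o -> R^o) d <->
  (fun h => h^-1 * (f (x + h) - f x)) @ 0^' --> (d : R^o).
Proof.
have E : (fun h : R => h^-1 * (f (x + h) - f x)) =
         (fun h => h^-1 *: (((f : R^o -> R^o) \o shift (x:R^o)) (h *: (1:R^o)) - (f : R^o -> R^o) (x:R^o))).
  by apply/funext => h /=; rewrite [_ *: 1]mulr1 [h + x]addrC.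
split.
- by case=> D <-; rewrite E; exact: D.
- rewrite E => H; split; first by apply/cvg_ex; exists d.
  exact: (cvg_lim (@norm_hausdorff _ _) H).
Qed.

Lemma cderP (g : R -> C) x d : cder g x d <->
  ((fun h => (h^-1)%:C * (g (x + h) - g x)) @ 0^' --> (d : C^o)).
Proof.
rewrite /cder cvgCP !is_deriveP.
have -> : (fun h : R => Re ((h^-1)%:C * (g (x + h) - g x))) =
   (fun h => h^-1 * (Re (g (x + h)) - Re (g x))).
  by apply/funext => h; rewrite !reE /= mul0r subr0.
have -> : (fun h : R => Im ((h^-1)%:C * (g (x + h) - g x))) =
   (fun h => h^-1 * (Im (g (x + h)) - Im (g x))).
  by apply/funext => h; rewrite !reE /= mul0r addr0.
by [].
Qed.

Lemma cder_cont (g : R -> C) x d : cder g x d ->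
  g @ (x : R^o) --> (g x : C^o).
Proof.
case=> [[D1 _] [D2 _]]; apply/cvgCP; split.
  by move/derivable1_diffP/differentiable_continuous : D1.
by move/derivable1_diffP/differentiable_continuous : D2.
Qed.

Lemma cder_eq (g : R -> C) x d d' : cder g x d -> d = d' -> cder g x d'.
Proof. by move=> H <-. Qed.

Lemma cder_near (f g : R -> C) (x : R) d :
  (\forall h \near (x : R^o), f h = g h) -> cder f x d -> cder g x d.
Proof.
move=> fg; rewrite /cder => -[D1 D2]; split.
  by apply: near_eq_is_derive D1; near=> y; rewrite (near fg y).
by apply: near_eq_is_derive D2; near=> y; rewrite (near fg y).
Unshelve. all: by end_near. Qed.

Lemma cder_unique (g : R -> C) x d d' : cder g x d -> cder g x d' -> d = d'.
Proof.
case=> [[_ A1] [_ A2]] [[_ B1] [_ B2]].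
by apply: eqC; [rewrite -A1 -B1|rewrite -A2 -B2].
Qed.

Lemma cder_cst (c : C) x : cder (fun=> c) x 0.
Proof. by split; exact: is_derive_cst. Qed.

Lemma cderD f g x a b : cder f x a -> cder g x b ->
  cder (fun h => f h + g h) x (a + b).
Proof.
case=> A1 A2 [B1 B2]; split.
  by rewrite ReD; under eq_fun do rewrite ReD; exact: is_deriveD.
by rewrite ImD; under eq_fun do rewrite ImD; exact: is_deriveD.
Qed.

Lemma cderJ f x a : cder f x a -> cder (fun h => conjc (f h)) x (conjc a).
Proof.
case=> A1 A2; split.
  by rewrite ReJ; under eq_fun do rewrite ReJ.
by rewrite ImJ; under eq_fun do rewrite ImJ; exact: is_deriveN.
Qed.

Lemma shift_cvg0 (T : topologicalType) (g : R -> T) (x : R) :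
  g @ (x : R^o) --> g x -> (fun h => g (x + h)) @ (0 : R)^' --> g x.
Proof.
move=> cg.
apply: (@cvg_comp _ _ _ (fun h : R => x + h) g _ (nbhs (x : R^o))) => //.
apply: cvg_within_filter.
rewrite -{2}[x]addr0.
exact: (@cvgD _ R^o _ _ _ (fun=> x) id x 0 (cvg_cst _) cvg_id).
Qed.

Lemma shift_cvgc (g : R -> C) (x : R) :
  g @ (x : R^o) --> (g x : C^o) -> (fun h => g (x + h)) @ (0 : R)^' --> (g x : C^o).
Proof. exact: (@shift_cvg0 C^o). Qed.

Lemma cvgc_cst {T} (F : set_system T) {FF : Filter F} (a : C) :
  (fun _ : T => a) @ F --> (a : C^o).
Proof. exact: (@cvg_cst C^o). Qed.

Arguments cvgc_cst {T F FF}.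
Arguments cvgcD {T F FF f g a b}.
Arguments cvgcM {T F FF f g a b}.
Arguments cvgcN {T F FF f a}.
Arguments cvgcV {T F FF f a}.

Lemma cderM f g x a b : cder f x a -> cder g x b ->
  cder (fun h => f h * g h) x (a * g x + f x * b).
Proof.
move=> A B; apply/cderP.
have -> : (fun h : R => (h^-1)%:C * (f (x + h) * g (x + h) - f x * g x)) =
  (fun h : R => (h^-1)%:C * (f (x + h) - f x) * g (x + h) +
     f x * ((h^-1)%:C * (g (x + h) - g x))) by apply/funext => h; ring.
have cg := cder_cont B.
move/cderP : A => A; move/cderP : B => B.
exact (cvgcD (cvgcM A (shift_cvgc cg)) (cvgcM (cvgc_cst (f x)) B)).
Qed.
End ComplexLimits.
Arguments cvgc_cst {R T F FF}.
Arguments cvgcD {R T F FF f g a b}.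
Arguments cvgcM {R T F FF f g a b}.
Arguments cvgcN {R T F FF f a}.
Arguments cvgcV {R T F FF f a}.

Section ComplexDerivatives.
Variable R : realType.
Local Notation C := R[i].
Local Notation Re := complex.Re.
Local Notation Im := complex.Im.

(** The difference quotient of g is that of f times k. With k = - 1 / (f (x + h) f x) this
    differentiates 1 / f, and with k = 1 / (f (x + h) + f x) it differentiates a continuous root
    from its square. *)
Lemma cder_factor (f g k : R -> C) x a (k0 : C) : cder f x a ->
  (\forall h \near (0 : R)^', g (x + h) - g x = (f (x + h) - f x) * k h) ->
  k @ (0 : R)^' --> (k0 : C^o) -> cder g x (a * k0).
Proof.
move=> /cderP A E K; apply/cderP.
have : (fun h : R => (h^-1)%:C * (f (x + h) - f x) * k h) @ 0^' --> (a * k0 : C^o).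
  exact: cvgcM A K.
apply: cvg_trans; apply: near_eq_cvg; near=> h.
by rewrite -mulrA -(near E h).
Unshelve. all: by end_near. Qed.

Lemma cderV (f : R -> C) x a : f x != 0 -> cder f x a ->
  cder (fun h => (f h)^-1) x (a * (- (f x ^+ 2)^-1)).
Proof.
move=> fx0 A; have cf := cder_cont A.
have cf' := shift_cvgc cf.
apply: (cder_factor (k := fun h => - (f (x + h) * f x)^-1) A).
- have : \forall h \near (0 : R)^', f (x + h) != 0.
    exact (cvgc_neq0 fx0 cf').
  apply: filterS => h fh0; field.
  by rewrite fh0 fx0.
- rewrite expr2; apply: cvgcN; apply: cvgcV; first by rewrite mulf_neq0.
  by apply: cvgcM; [exact: cf'|exact: cvgc_cst].
Qed.

Lemma cder_sqrt (f : R -> C) x a : f x != 0 -> f @ (x : R^o) --> (f x : C^o) ->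
  cder (fun h => f h * f h) x a -> cder f x (a * (2%:R * f x)^-1).
Proof.
move=> fx0 cf A; have cf' := shift_cvgc cf.
have c2 : (fun h => f (x + h) + f x) @ (0 : R)^' --> (2%:R * f x : C^o).
  have -> : 2%:R * f x = f x + f x by ring.
  by apply: cvgcD; [exact: cf'|exact: cvgc_cst].
have n0 : 2%:R * f x != 0 by rewrite mulf_neq0 // pnatr_eq0.
apply: (cder_factor (k := fun h => (f (x + h) + f x)^-1) A).
- have : \forall h \near (0 : R)^', f (x + h) + f x != 0.
    exact (cvgc_neq0 n0 c2).
  by apply: filterS => h fh0; field.
- by apply: cvgcV.
Qed.

Lemma cder_comp (g : R -> C) (u : R -> R) (x du : R) d :
  is_derive (x : R^o) (1 : R^o) (u : R^o -> R^o) du -> cder g (u x) d ->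
  cder (fun h => g (u h)) x (d * du%:C).
Proof.
move=> U [A B]; split.
  rewrite !reE /= mulr0 subr0.
  exact (@is_derive1_comp _ (fun h => Re (g h)) u x (Re d) du A U).
rewrite !reE /= mulr0 add0r.
exact (@is_derive1_comp _ (fun h => Im (g h)) u x (Im d) du B U).
Qed.

Lemma cder_real (u : R -> R) (x du : R) :
  is_derive (x : R^o) (1 : R^o) (u : R^o -> R^o) du ->
  cder (fun h => (u h)%:C) x du%:C.
Proof. by move=> U; split => //=; exact: is_derive_cst. Qed.

Lemma cder_ln (f : R -> C) x a : (\forall h \near (x : R^o), 0 < f h) ->
  cder f x a -> cder (fun h => (ln (Re (f h)))%:C) x (a * (f x)^-1).
Proof.
move=> f0 A; have fx0 := nbhs_singleton f0.
have Ia : Im a = 0.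
  case: (A) => _ [_ <-].
  rewrite -(derive_cst (0 : R^o) (x : R^o) (1 : R^o)).
  apply: near_eq_derive; near=> h.
  have : 0 < f h by near: h.
  by rewrite ltcE => /andP[/eqP].
have [I0 R0] : Im (f x) = 0 /\ 0 < Re (f x).
  by move: fx0; rewrite ltcE => /andP[/eqP].
have -> : a * (f x)^-1 = (Re a * (Re (f x))^-1)%:C.
  rewrite rmorphM fmorphV; congr (_ * _^-1); first by apply: eqC.
  by apply: eqC.
apply: cder_real; rewrite mulrC.
apply: (@is_derive1_comp _ (@ln R) (fun h => Re (f h)) x _ (Re a)); last by case: A.
exact: is_derive1_ln.
Unshelve. all: by end_near. Qed.

Lemma cder_affine (t v : C) (x : R) : cder (fun h => t + h%:C * v) x v.
Proof.
rewrite -[X in cder _ _ X]add0r; apply: cderD; first exact: cder_cst.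
have H := cderM (cder_real (is_derive_id (x : R^o) (1 : R^o))) (cder_cst v x).
by apply: cder_eq H _; rewrite mulr0 addr0; exact: mul1r.
Qed.

Lemma line_cvg (t v : C) : (fun h : R => t + h%:C * v) @ (0 : R^o) --> (t : C^o).
Proof.
have := cder_cont (cder_affine t v 0).
by rewrite [0%:C]/= mul0r addr0.
Qed.

Arguments line_cvg : clear implicits.

Definition pder (v : C) (f : C -> C) (t d : C) := cder (fun h => f (t + h%:C * v)) 0 d.

Lemma line0 (t v : C) : t + (0 : R)%:C * v = t. Proof. by rewrite mul0r addr0. Qed.

Lemma pder_pderivable v f t d : pder v f t d -> pderivable v f t.
Proof. by case=> [[A _] [B _]]; split. Qed.

Lemma pder_pderive v f t d : pder v f t d -> pderive v f t = d.
Proof.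
by case=> [[_ A] [_ B]]; apply: eqC; rewrite /pderive /= derive1E.
Qed.

Lemma pderivable_pder v f t : pderivable v f t -> pder v f t (pderive v f t).
Proof.
by case=> A B; split; rewrite /pderive /= derive1E; split.
Qed.

Lemma pder_near v (f g : C -> C) (t : C) d : (\forall s \near (t : C^o), f s = g s) ->
  pder v f t d -> pder v g t d.
Proof.
move=> E; apply: cder_near.
exact (line_cvg t v _ E).
Qed.

Definition ccont (f : C -> C) (t : C) := {for t, continuous (f : C^o -> C^o)}.

Lemma ccont_near (f g : C -> C) (t : C) : (\forall s \near (t : C^o), f s = g s) ->
  ccont f t -> ccont g t.
Proof.
move=> E H; change (g @ (t : C^o) --> (g t : C^o)).
have /= <- := nbhs_singleton E.
move=> P /H HP; change (nbhs (t : C^o) (fun s : C^o => P (g s))).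
exact (@filterS2 _ _ (nbhs_filter (t : C^o)) _ _ _ (fun s e (h : P (f s)) => eq_ind _ P h _ e) E HP).
Qed.

Lemma pder_ext v f t d d' : pder v f t d -> d = d' -> pder v f t d'.
Proof. by move=> H <-. Qed.

Lemma pder_cst v c t : pder v (fun=> c) t 0. Proof. exact: cder_cst. Qed.
Lemma pder_id v t : pder v id t v. Proof. exact: cder_affine. Qed.
Lemma pderD v f g t a b : pder v f t a -> pder v g t b ->
  pder v (fun s => f s + g s) t (a + b).
Proof. exact: cderD. Qed.
Lemma pderM v f g t a b : pder v f t a -> pder v g t b ->
  pder v (fun s => f s * g s) t (a * g t + f t * b).
Proof. by move=> A B; have := cderM A B; rewrite !line0. Qed.
Lemma pderJ v f t a : pder v f t a -> pder v (fun s => conjc (f s)) t (conjc a).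
Proof. exact: cderJ. Qed.
Lemma pderV v f t a : f t != 0 -> pder v f t a ->
  pder v (fun s => (f s)^-1) t (a * (- (f t ^+ 2)^-1)).
Proof. by move=> A B; have := @cderV _ _ _ _ B; rewrite !line0; apply. Qed.
Lemma pder_sqrt v f t a : f t != 0 -> ccont f t ->
  pder v (fun s => f s * f s) t a -> pder v f t (a * (2%:R * f t)^-1).
Proof.
move=> A cf B; have := @cder_sqrt _ _ _ _ _ B; rewrite !line0; apply => //.
by apply: (cvg_comp _ _ (line_cvg t v)).
Qed.
Lemma pder_ln v (f : C -> C) (t : C) a : (\forall s \near (t : C^o), 0 < f s) -> pder v f t a ->
  pder v (fun s => (ln (Re (f s)))%:C) t (a * (f t)^-1).
Proof.
move=> A B; have := @cder_ln _ _ _ _ B; rewrite !line0; apply.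
exact (line_cvg t v _ A).
Qed.
Lemma pder_scale v f (c : R) t a : pder v f (c%:C * t) a ->
  pder v (fun s => f (c%:C * s)) t (a * c%:C).
Proof.
move=> A; rewrite /pder.
under eq_fun => h do rewrite mulrDr mulrA -rmorphM.
apply: (@cder_comp (fun h => f (c%:C * t + h%:C * v)) (fun h => c * h)).
  have H := @is_deriveZ R R^o R^o id c 0 1 1 (is_derive_id (0 : R^o) (1 : R^o)).
  by apply: is_derive_eq H _; exact: mulr1.
by rewrite mulr0.
Qed.

End ComplexDerivatives.

(** * Smooth and holomorphic functions *)

Section Smoothness.
Variable R : realType.
Local Notation C := R[i].
Local Notation Re := complex.Re.
Local Notation Im := complex.Im.

Lemma ccontE (f : C -> C) (t : C) : ccont f t = (f @ (t : C^o) --> (f t : C^o)).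
Proof. by []. Qed.

Lemma ccontD (f g : C -> C) (t : C) : ccont f t -> ccont g t -> ccont (fun s => f s + g s) t.
Proof. rewrite !ccontE => A B; exact (cvgcD A B). Qed.
Lemma ccontM (f g : C -> C) (t : C) : ccont f t -> ccont g t -> ccont (fun s => f s * g s) t.
Proof. rewrite !ccontE => A B; exact (cvgcM A B). Qed.
Lemma ccontV (f : C -> C) (t : C) : f t != 0 -> ccont f t -> ccont (fun s => (f s)^-1) t.
Proof. rewrite !ccontE => A B; exact (cvgcV A B). Qed.
Lemma ccont_cst (c : C) (t : C) : ccont (fun=> c) t.
Proof. rewrite ccontE; exact (@cvgc_cst R _ _ (nbhs_filter (t : C^o)) c). Qed.
Lemma ccont_id (t : C) : ccont id t.
Proof. rewrite ccontE; exact: cvg_id. Qed.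
Lemma ccontP (f : C -> C) (t : C) : ccont f t <->
  ((fun x => Re (f x)) @ (t : C^o) --> (Re (f t) : R^o)) /\
  ((fun x => Im (f x)) @ (t : C^o) --> (Im (f t) : R^o)).
Proof. exact (@cvgCP R _ (nbhs (t : C^o)) (nbhs_filter (t : C^o)) f (f t)). Qed.
Lemma ccontJ (f : C -> C) (t : C) : ccont f t -> ccont (fun s => conjc (f s)) t.
Proof.
rewrite !ccontP => -[A B]; split.
  by rewrite ReJ; under eq_fun do rewrite ReJ.
rewrite ImJ; under eq_fun do rewrite ImJ.
exact (@cvgN _ R^o _ _ _ _ _ B).
Qed.
Lemma ccont_ln (f : C -> C) (t : C) : 0 < f t -> ccont f t ->
  ccont (fun s => (ln (Re (f s)))%:C) t.
Proof.
rewrite !ccontP => f0 -[A B]; split => /=; last exact (@cvg_cst R^o 0 _ (nbhs (t : C^o)) (nbhs_filter (t : C^o))).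
have r0 : 0 < Re (f t) by move: f0; rewrite ltcE => /andP[].
exact (@cvg_comp _ _ _ (fun s => Re (f s)) (@ln R) (nbhs (t : C^o)) (nbhs (Re (f t) : R^o))
  (nbhs (ln (Re (f t)) : R^o)) A (continuous_ln r0)).
Qed.
Lemma ccont_comp (f g : C -> C) (t : C) : ccont g t -> ccont f (g t) ->
  ccont (fun s => f (g s)) t.
Proof.
rewrite !ccontE => A B.
exact (@cvg_comp _ _ _ g f (nbhs (t : C^o)) (nbhs (g t : C^o)) (nbhs (f (g t) : C^o)) A B).
Qed.
Lemma ccont_norm (f : C -> C) (t : C) : ccont f t -> ccont (fun s => `|f s|) t.
Proof.
rewrite !ccontE => A.
exact: (@cvg_norm _ C^o _ _ _ _ _ A).
Qed.

(* A class of functions containing the smooth ones, closed under the algebraic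
   operations and continuous square roots, and visibly stable under partial
   derivatives; hence all its members are smooth. *)
Inductive gen (U : set C) : (C -> C) -> Prop :=
| gen_smooth f : smooth U f -> gen U f
| gen_cst c : gen U (fun=> c)
| gen_id : gen U id
| gen_add f g : gen U f -> gen U g -> gen U (fun t => f t + g t)
| gen_mul f g : gen U f -> gen U g -> gen U (fun t => f t * g t)
| gen_inv f : (forall t, U t -> f t != 0) -> gen U f -> gen U (fun t => (f t)^-1)
| gen_conj f : gen U f -> gen U (fun t => conjc (f t))
| gen_sqrt f : (forall t, U t -> f t != 0) -> (forall t, U t -> ccont f t) ->
    gen U (fun t => f t * f t) -> gen U f
| gen_ln f : (forall t, U t -> 0 < f t) -> gen U f -> gen U (fun t => (ln (Re (f t)))%:C)
| gen_scale f (c : R) : (forall t, U t -> U (c%:C * t)) -> gen U f ->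
    gen U (fun t => f (c%:C * t))
| gen_eq f g : (forall t, U t -> f t = g t) -> gen U f -> gen U g.

Lemma open_near (U : set C) (t : C) : open (U : set C^o) -> U t ->
  \forall s \near (t : C^o), U s.
Proof. by move=> oU Ut; exact: open_nbhs_nbhs. Qed.

Lemma open_near_eq (T : Type) (U : set C) (f g : C -> T) (t : C) : open (U : set C^o) ->
  (forall t, U t -> f t = g t) -> U t -> \forall s \near (t : C^o), f s = g s.
Proof.
move=> oU fg Ut; have H := open_near oU Ut.
exact: (filterS _ H).
Qed.

Lemma gen_spec (U : set C) f : open (U : set C^o) -> gen U f ->
  (forall t, U t -> ccont f t) /\
  forall v, v = 1 \/ v = (0 +i* 1) ->
    exists2 fv, gen U fv & forall t, U t -> pder v f t (fv t).
Proof.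
move=> oU; elim=> {f}.
- move=> f sf; split; first exact: (sf 0%N).
  move=> v [->|->].
  + exists (pderive 1 f); first by apply: gen_smooth => k; have [] := sf k.+1.
    by move=> t Ut; apply: pderivable_pder; have [/(_ t Ut)[]] := sf 1%N.
  + exists (pderive (0 +i* 1) f); first by apply: gen_smooth => k; have [] := sf k.+1.
    by move=> t Ut; apply: pderivable_pder; have [/(_ t Ut)[]] := sf 1%N.
- move=> c; split=> [t _|v _]; first exact: ccont_cst.
  by exists (fun=> 0); [exact: gen_cst|move=> t _; exact: pder_cst].
- split=> [t _|v _]; first exact: ccont_id.
  by exists (fun=> v); [exact: gen_cst|move=> t _; exact: pder_id].
- move=> f g gf [cf df] gg [cg dg]; split=> [t Ut|v /[dup] /df[fv gfv fvP] /dg[gv ggv gvP]].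
    by apply: ccontD; auto.
  exists (fun t => fv t + gv t); first exact: gen_add.
  by move=> t Ut; apply: pderD; auto.
- move=> f g gf [cf df] gg [cg dg]; split=> [t Ut|v /[dup] /df[fv gfv fvP] /dg[gv ggv gvP]].
    by apply: ccontM; auto.
  exists (fun t => fv t * g t + f t * gv t).
    by apply: gen_add; exact: gen_mul.
  by move=> t Ut; apply: pderM; auto.
- move=> f f0 gf [cf df]; split=> [t Ut|v /df[fv gfv fvP]].
    by apply: ccontV; auto.
  exists (fun t => fv t * (- 1 * (f t * f t)^-1)).
    apply: (gen_mul gfv (gen_mul (gen_cst U (-1)) (gen_inv _ (gen_mul gf gf)))) => t Ut.
    by rewrite mulf_neq0 ?f0.
  move=> t Ut; apply: pder_ext; first by apply: pderV; auto.
  by rewrite mulN1r expr2.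
- move=> f gf [cf df]; split=> [t Ut|v /df[fv gfv fvP]].
    by apply: ccontJ; auto.
  exists (fun t => conjc (fv t)); first exact: gen_conj.
  by move=> t Ut; apply: pderJ; auto.
- move=> f f0 cf gf [_ df]; split=> [//|v /df[fv gfv fvP]].
  (* The derivative (f f)' / (2 f) of a root contains f itself, which is again in the class; the
     induction hypothesis supplies only (f f)'. *)
  exists (fun t => fv t * (2%:R * f t)^-1).
    apply: (gen_mul gfv (gen_inv _ (gen_mul (gen_cst U 2%:R) (gen_sqrt f0 cf gf)))) => t Ut.
    by rewrite mulf_neq0 ?f0 // pnatr_eq0.
  by move=> t Ut; apply: pder_sqrt; auto.
- move=> f f0 gf [cf df]; split=> [t Ut|v /df[fv gfv fvP]].
    by apply: ccont_ln; auto.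
  exists (fun t => fv t * (f t)^-1).
    by apply: (gen_mul gfv (gen_inv _ gf)) => t Ut; rewrite gt_eqF ?f0.
  move=> t Ut; apply: pder_ln; last by auto.
  by have := open_near oU Ut; apply: filterS => s /f0.
- move=> f c Uc gf [cf df]; split=> [t Ut|v /df[fv gfv fvP]].
    apply: (ccont_comp (g := fun t => c%:C * t)); last by apply: cf; auto.
    by apply: ccontM; [exact: ccont_cst|exact: ccont_id].
  exists (fun t => fv (c%:C * t) * c%:C).
    by apply: gen_mul; [apply: gen_scale|exact: gen_cst].
  by move=> t Ut; apply: pder_scale; auto.
- move=> f g fg gf [cf df]; split=> [t Ut|v /df[fv gfv fvP]].
    by apply: (ccont_near (open_near_eq oU fg Ut)); auto.
  exists fv => // t Ut.
  by apply: (pder_near (open_near_eq oU fg Ut)); auto.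
Qed.

Lemma gen_is_smooth (U : set C) f : open (U : set C^o) -> gen U f -> smooth U f.
Proof.
move=> oU gf k; elim: k f gf => [|k IH] f gf /=; first exact: (gen_spec oU gf).1.
have [_ H] := gen_spec oU gf.
have [f1 g1 P1] := H 1 (or_introl erefl).
have [f2 g2 P2] := H (0 +i* 1) (or_intror erefl).
split.
- by move=> t Ut; split; apply: pder_pderivable; auto.
- apply: IH; apply: (gen_eq _ g1) => t Ut.
  by rewrite (pder_pderive (P1 t Ut)).
- apply: IH; apply: (gen_eq _ g2) => t Ut.
  by rewrite (pder_pderive (P2 t Ut)).
Qed.

Lemma smooth_upto_local k (U : set C) (f : C -> C) :
  (forall t, U t -> exists2 V : set C, V t & smooth_upto k V f) -> smooth_upto k U f.
Proof.
elim: k U f => [|k IH] U f H /=.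
  by move=> t /H[V Vt]; apply.
split.
- by move=> t /H[V Vt [+ _ _]]; apply.
- by apply: IH => t /H[V Vt [_ + _]]; exists V.
- by apply: IH => t /H[V Vt [_ _ +]]; exists V.
Qed.

Lemma smooth_local (U : set C) (f : C -> C) :
  (forall t, U t -> exists2 V : set C, V t & smooth V f) -> smooth U f.
Proof.
by move=> H k; apply: smooth_upto_local => t /H[V Vt sV]; exists V.
Qed.

Lemma smooth_sub (U V : set C) (f : C -> C) : V `<=` U -> smooth U f -> smooth V f.
Proof. by move=> VU sf; apply: smooth_local => t /VU Ut; exists U. Qed.

(* [isW f t p q]: f has Wirtinger derivatives p = d_t f and q = d_tbar f at t. *)
Definition isW (f : C -> C) (t p q : C) :=
  pder 1 f t (p + q) /\ pder (0 +i* 1) f t ((0 +i* 1) * (p - q)).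

Lemma i2 : (0 +i* 1) * (0 +i* 1) = -1 :> C.
Proof. by apply: eqC; rewrite !reE /= !(mul0r, mulr0, mul1r) ?addr0 ?sub0r ?oppr0. Qed.

Lemma isW_dt f t p q : isW f t p q -> d_t f t = p.
Proof.
case=> /pder_pderive A /pder_pderive B; rewrite /d_t A B.
by rewrite mulrA i2 mulN1r opprK; field; rewrite ?pnatr_eq0.
Qed.

Lemma isW_dtb f t p q : isW f t p q -> d_tbar f t = q.
Proof.
case=> /pder_pderive A /pder_pderive B; rewrite /d_tbar A B.
by rewrite mulrA i2; field; rewrite ?pnatr_eq0.
Qed.

Lemma pders_isW f t a b : pder 1 f t a -> pder (0 +i* 1) f t b ->
  isW f t (d_t f t) (d_tbar f t).
Proof.
move=> /[dup] /pder_pderive Ea A /[dup] /pder_pderive Eb B.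
rewrite /isW /d_t /d_tbar Ea Eb; split.
  by apply: pder_ext A _; field; rewrite ?pnatr_eq0.
apply: pder_ext B _.
have -> : (0 +i* 1) * ((a - (0 +i* 1) * b) / 2%:R - (a + (0 +i* 1) * b) / 2%:R)
  = - ((0 +i* 1) * (0 +i* 1)) * b by field; rewrite ?pnatr_eq0.
by rewrite i2 opprK mul1r.
Qed.

Lemma smooth_isW (U : set C) f t : smooth U f -> U t -> isW f t (d_t f t) (d_tbar f t).
Proof.
move=> sf Ut; have [/(_ t Ut)[A B] _ _] := sf 1%N.
exact: pders_isW (pderivable_pder A) (pderivable_pder B).
Qed.

Lemma isW_eq f t p q p' q' : isW f t p q -> p = p' -> q = q' -> isW f t p' q'.
Proof. by move=> H <- <-. Qed.

Lemma isW_unique f t p q p' q' : isW f t p q -> isW f t p' q' -> p = p' /\ q = q'.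
Proof.
by move=> A B; rewrite -(isW_dt A) -(isW_dtb A) -(isW_dt B) -(isW_dtb B).
Qed.

Lemma isW_near (f g : C -> C) (t : C) p q : (\forall s \near (t : C^o), f s = g s) ->
  isW f t p q -> isW g t p q.
Proof. by move=> E [A B]; split; [apply: pder_near A|apply: pder_near B]. Qed.

Lemma isW_cst c t : isW (fun=> c) t 0 0.
Proof. by split; [rewrite addr0|rewrite subr0 mulr0]; exact: pder_cst. Qed.
Lemma isW_id t : isW id t 1 0.
Proof. by split; [rewrite addr0|rewrite subr0 mulr1]; exact: pder_id. Qed.
Lemma isWD f g t p q p' q' : isW f t p q -> isW g t p' q' ->
  isW (fun s => f s + g s) t (p + p') (q + q').
Proof.
move=> [A B] [A' B']; split.
  by apply: pder_ext; [apply: pderD A A'|ring].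
by apply: pder_ext; [apply: pderD B B'|ring].
Qed.
Lemma isWM f g t p q p' q' : isW f t p q -> isW g t p' q' ->
  isW (fun s => f s * g s) t (p * g t + f t * p') (q * g t + f t * q').
Proof.
move=> [A B] [A' B']; split.
  by apply: pder_ext; [apply: pderM A A'|ring].
by apply: pder_ext; [apply: pderM B B'|ring].
Qed.
Lemma isWJ f t p q : isW f t p q -> isW (fun s => conjc (f s)) t (conjc q) (conjc p).
Proof.
move=> [A B]; split.
  by apply: pder_ext; [apply: pderJ A|rewrite rmorphD addrC].
apply: pder_ext; [apply: pderJ B|].
by apply: eqC; rewrite !reE /=; ring.
Qed.
Lemma isWV f t p q : f t != 0 -> isW f t p q ->
  isW (fun s => (f s)^-1) t (p * - (f t ^+ 2)^-1) (q * - (f t ^+ 2)^-1).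
Proof.
move=> f0 [A B]; split.
  by apply: pder_ext; [apply: pderV f0 A|ring].
by apply: pder_ext; [apply: pderV f0 B|ring].
Qed.
Lemma isW_sqrt f t p q : f t != 0 -> ccont f t -> isW (fun s => f s * f s) t p q ->
  isW f t (p * (2%:R * f t)^-1) (q * (2%:R * f t)^-1).
Proof.
move=> f0 cf [A B]; split.
  by apply: pder_ext; [apply: pder_sqrt f0 cf A|ring].
by apply: pder_ext; [apply: pder_sqrt f0 cf B|ring].
Qed.
Lemma isW_ln (f : C -> C) (t : C) p q : (\forall s \near (t : C^o), 0 < f s) -> isW f t p q ->
  isW (fun s => (ln (Re (f s)))%:C) t (p * (f t)^-1) (q * (f t)^-1).
Proof.
move=> f0 [A B]; split.
  by apply: pder_ext; [apply: pder_ln f0 A|ring].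
by apply: pder_ext; [apply: pder_ln f0 B|ring].
Qed.
Lemma isW_scale f (c : R) t p q : isW f (c%:C * t) p q ->
  isW (fun s => f (c%:C * s)) t (p * c%:C) (q * c%:C).
Proof.
move=> [A B]; split.
  by apply: pder_ext; [apply: pder_scale A|ring].
by apply: pder_ext; [apply: pder_scale B|ring].
Qed.

Lemma holoP (U : set C) f : holomorphic U f <->
  smooth U f /\ forall t, U t -> exists p, isW f t p 0.
Proof.
split=> -[sf H]; split=> // t Ut.
  by exists (d_t f t); rewrite -(H t Ut); exact: (smooth_isW sf).
by have [p /isW_dtb] := H t Ut.
Qed.

Section Open.
Variables (U : set C) (oU : open (U : set C^o)).

Lemma holo_cst c : holomorphic U (fun=> c).
Proof.
apply/holoP; split; first by apply: gen_is_smooth => //; exact: gen_cst.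
by move=> t _; exists 0; exact: isW_cst.
Qed.

Lemma holo_id : holomorphic U id.
Proof.
apply/holoP; split; first by apply: gen_is_smooth => //; exact: gen_id.
by move=> t _; exists 1; exact: isW_id.
Qed.

Lemma holoD f g : holomorphic U f -> holomorphic U g -> holomorphic U (fun t => f t + g t).
Proof.
move=> /holoP[sf hf] /holoP[sg hg]; apply/holoP; split.
  by apply: gen_is_smooth => //; apply: gen_add; exact: gen_smooth.
move=> t Ut; have [p P] := hf t Ut; have [q Q] := hg t Ut.
by eexists; apply: isW_eq (isWD P Q) erefl _; rewrite addr0.
Qed.

Lemma holoM f g : holomorphic U f -> holomorphic U g -> holomorphic U (fun t => f t * g t).
Proof.
move=> /holoP[sf hf] /holoP[sg hg]; apply/holoP; split.
  by apply: gen_is_smooth => //; apply: gen_mul; exact: gen_smooth.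
move=> t Ut; have [p P] := hf t Ut; have [q Q] := hg t Ut.
by eexists; apply: isW_eq (isWM P Q) erefl _; rewrite mul0r mulr0 addr0.
Qed.

Lemma holoV f : (forall t, U t -> f t != 0) -> holomorphic U f ->
  holomorphic U (fun t => (f t)^-1).
Proof.
move=> f0 /holoP[sf hf]; apply/holoP; split.
  by apply: gen_is_smooth => //; apply: gen_inv => //; exact: gen_smooth.
move=> t Ut; have [p P] := hf t Ut.
by eexists; apply: isW_eq (isWV (f0 t Ut) P) erefl _; rewrite mul0r.
Qed.

Lemma holo_sqrt f : (forall t, U t -> f t != 0) -> (forall t, U t -> ccont f t) ->
  holomorphic U (fun t => f t * f t) -> holomorphic U f.
Proof.
move=> f0 cf /holoP[sf hf]; apply/holoP; split.
  by apply: gen_is_smooth => //; apply: gen_sqrt => //; exact: gen_smooth.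
move=> t Ut; have [p P] := hf t Ut.
by eexists; apply: isW_eq (isW_sqrt (f0 t Ut) (cf t Ut) P) erefl _; rewrite mul0r.
Qed.

Lemma holo_eq f g : (forall t, U t -> f t = g t) -> holomorphic U f -> holomorphic U g.
Proof.
move=> fg /holoP[sf hf]; apply/holoP; split.
  by apply: gen_is_smooth => //; apply: gen_eq fg _; exact: gen_smooth.
move=> t Ut; have [p P] := hf t Ut; exists p.
exact: isW_near (open_near_eq oU fg Ut) P.
Qed.

Lemma holo_sum (I : Type) (r : seq I) (P : pred I) (F : I -> C -> C) :
  (forall i, P i -> holomorphic U (F i)) -> holomorphic U (fun t => \sum_(i <- r | P i) F i t).
Proof.
move=> H; elim: r => [|i r IH].
  by apply: (holo_eq _ (holo_cst 0)) => t _; rewrite big_nil.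
case Pi: (P i); last first.
  by apply: (holo_eq _ IH) => t _; rewrite big_cons Pi.
by apply: (holo_eq _ (holoD (H i Pi) IH)) => t _; rewrite big_cons Pi.
Qed.

Lemma holo_cont f t : holomorphic U f -> U t -> ccont f t.
Proof. by move=> [sf _] Ut; exact: (sf 0%N). Qed.

End Open.

Lemma holo_sub (U V : set C) (f : C -> C) : V `<=` U -> holomorphic U f -> holomorphic V f.
Proof. by move=> VU [sf hf]; split; [exact: smooth_sub sf|move=> t /VU /hf]. Qed.

Lemma holo_local (U : set C) (f : C -> C) :
  (forall t, U t -> exists2 V : set C, V t & holomorphic V f) -> holomorphic U f.
Proof.
move=> H; split; first by apply: smooth_local => t /H[V Vt []]; exists V.
by move=> t /H[V Vt [_]]; apply.
Qed.

Lemma open_Cstar : open (Cstar : set C^o).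
Proof.
apply/openCP => t t0; exists (normc t); first exact: normc_gt0.
by move=> s; rewrite /Cstar /=; apply: contraTneq => ->; rewrite sub0r normcN ltxx.
Qed.

End Smoothness.

(** * Symmetry of mixed partial derivatives *)

Section Clairaut.
Variable R : realType.
Local Notation C := R[i].
Local Notation Re := complex.Re.
Local Notation Im := complex.Im.

Lemma mvt (f df : R -> R) (a b : R) : a < b ->
  (forall x, a <= x <= b -> is_derive (x : R^o) (1 : R^o) (f : R^o -> R^o) (df x)) ->
  exists2 c, a < c < b & f b - f a = df c * (b - a).
Proof.
move=> ab H.
have [x|| c cab E] := @MVT R f df a b ab.
- by rewrite in_itv /= => /andP[? ?]; apply: H; rewrite !ltW.
- apply: derivable_within_continuous => x; rewrite in_itv /= => /H.
  by case.
- by exists c => //; move: cab; rewrite in_itv.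
Qed.

(** The second difference of F over a square of side h, evaluated by the mean value theorem in the
    two possible orders, is h^2 times a value of Fxy and also h^2 times a value of Fyx; continuity
    at the origin concludes. *)
Lemma mixed_partials (F Fx Fy Fxy Fyx : R -> R -> R) (d : R) : 0 < d ->
  (forall x y, `|x| < d -> `|y| < d ->
    [/\ is_derive (x : R^o) (1 : R^o) (F^~ y : R^o -> R^o) (Fx x y),
        is_derive (y : R^o) (1 : R^o) (F x : R^o -> R^o) (Fy x y),
        is_derive (y : R^o) (1 : R^o) (Fx x : R^o -> R^o) (Fxy x y) &
        is_derive (x : R^o) (1 : R^o) (Fy^~ y : R^o -> R^o) (Fyx x y)]) ->
  (forall e, 0 < e -> exists2 d', 0 < d' & forall x y, `|x| < d' -> `|y| < d' ->
     `|Fxy x y - Fxy 0 0| < e /\ `|Fyx x y - Fyx 0 0| < e) ->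
  Fxy 0 0 = Fyx 0 0.
Proof.
move=> d0 HF cF; apply/eqP; rewrite -subr_eq0 -normr_le0; apply/ler_addgt0Pl => e e0.
have e20 : 0 < e / 2 by rewrite divr_gt0.
have [d' d'0 cd'] := cF _ e20.
(* Half of the minimum, so that the closed square of side h lies inside the open boxes of [HF] and
   [cd']. *)
pose h := Num.min d d' / 2.
have m0 : 0 < Num.min d d' by rewrite lt_min d0 d'0.
have h0 : 0 < h by rewrite /h divr_gt0.
have hm : h < Num.min d d' by rewrite /h ltr_pdivrMr // mulr2n mulrDr mulr1 ltrDl.
have hd x : 0 <= x <= h -> `|x| < d /\ `|x| < d'.
  case/andP=> x0 xh; rewrite ger0_norm //.
  by have := le_lt_trans xh hm; rewrite lt_min => /andP[].
have hh : 0 <= h <= h by rewrite lexx ltW.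
have h00 : 0 <= (0 : R) <= h by rewrite lexx ltW.
have [c c0h E1] : exists2 c, 0 < c < h &
    (F h h - F h 0) - (F 0 h - F 0 0) = (Fx c h - Fx c 0) * (h - 0).
  apply: (@mvt (fun x => F x h - F x 0) (fun x => Fx x h - Fx x 0)) => // x x0h.
  have [A _ _ _] := HF x h (hd _ x0h).1 (hd _ hh).1.
  have [B _ _ _] := HF x 0 (hd _ x0h).1 (hd _ h00).1.
  exact: (@is_deriveB R R^o R^o (F^~ h) (F^~ 0)).
have c0h' : 0 <= c <= h by case/andP: c0h => *; rewrite !ltW.
have [k k0h E2] : exists2 k, 0 < k < h & Fx c h - Fx c 0 = Fxy c k * (h - 0).
  apply: (@mvt (Fx c) (Fxy c)) => // x x0h.
  by have [_ _ A _] := HF c x (hd _ c0h').1 (hd _ x0h).1.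
have [k' k'0h E3] : exists2 k, 0 < k < h &
    (F h h - F 0 h) - (F h 0 - F 0 0) = (Fy h k - Fy 0 k) * (h - 0).
  apply: (@mvt (fun x => F h x - F 0 x) (fun x => Fy h x - Fy 0 x)) => // x x0h.
  have [_ A _ _] := HF h x (hd _ hh).1 (hd _ x0h).1.
  have [_ B _ _] := HF 0 x (hd _ h00).1 (hd _ x0h).1.
  exact: (@is_deriveB R R^o R^o (F h) (F 0)).
have k'0h' : 0 <= k' <= h by case/andP: k'0h => *; rewrite !ltW.
have [c' c'0h E4] : exists2 c, 0 < c < h & Fy h k' - Fy 0 k' = Fyx c k' * (h - 0).
  apply: (@mvt (Fy^~ k') (Fyx^~ k')) => // x x0h.
  by have [_ _ _ A] := HF x k' (hd _ x0h).1 (hd _ k'0h').1.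
have c'0h' : 0 <= c' <= h by case/andP: c'0h => *; rewrite !ltW.
have k0h' : 0 <= k <= h by case/andP: k0h => *; rewrite !ltW.
have E : Fxy c k = Fyx c' k'.
  apply: (mulIf (lt0r_neq0 (mulr_gt0 h0 h0))).
  have : Fxy c k * (h - 0) * (h - 0) = Fyx c' k' * (h - 0) * (h - 0).
    by rewrite -E2 -E4 -E1 -E3; ring.
  by rewrite subr0 !mulrA.
have [A _] := cd' c k (hd _ c0h').2 (hd _ k0h').2.
have [_ B] := cd' c' k' (hd _ c'0h').2 (hd _ k'0h').2.
have -> : Fxy 0 0 - Fyx 0 0 = (Fyx c' k' - Fyx 0 0) - (Fxy c k - Fxy 0 0).
  by rewrite E; ring.
apply: le_trans (ler_normB _ _) _; rewrite addr0 (splitr e).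
by rewrite lerD // ltW.
Qed.

Lemma cder_shift (g : R -> C) (x : R) d :
  cder (fun h => g (x + h)) 0 d -> cder g x d.
Proof.
move=> /cderP H; apply/cderP.
by move: H; under eq_fun do rewrite add0r addr0.
Qed.

Lemma ccont_box (f : C -> C) (t : C) (e : R) : ccont f t -> 0 < e ->
  exists2 d, 0 < d & forall x y : R, `|x| < d -> `|y| < d ->
    `|Re (f (t + x%:C + y%:C * (0 +i* 1))) - Re (f t)| < e /\
    `|Im (f (t + x%:C + y%:C * (0 +i* 1))) - Im (f t)| < e.
Proof.
move=> cf e0.
have /cf/nbhsCP[d d0 H] : nbhs (f t : C^o) (fun z : C => normc (z - f t) < e).
  by apply/nbhsCP; exists e.
exists (d / 2); first by rewrite divr_gt0.
move=> x y xd yd.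
have : normc (f (t + x%:C + y%:C * (0 +i* 1)) - f t) < e.
  apply: H; apply: le_lt_trans (normc_le _) _.
  rewrite !reE /= !(mul0r, mulr0, mulr1, subr0, addr0, add0r, oppr0).
  by rewrite (addrC _ x) addrK (addrC _ y) addrK (splitr d) ltrD.
move=> H'; rewrite -!ReN -!ImN -!ReD -!ImD.
by rewrite (le_lt_trans (normc_Re _) H') (le_lt_trans (normc_Im _) H').
Qed.

Lemma ball_box (U : set C) (t : C) : open (U : set C^o) -> U t ->
  exists2 d, 0 < d & forall x y : R, `|x| < d -> `|y| < d ->
    U (t + x%:C + y%:C * (0 +i* 1)).
Proof.
move=> /openCP oU /oU[d d0 H].
exists (d / 2); first by rewrite divr_gt0.
move=> x y xd yd; apply: H; apply: le_lt_trans (normc_le _) _.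
rewrite !reE /= !(mul0r, mulr0, mulr1, subr0, addr0, add0r, oppr0).
by rewrite (addrC _ x) addrK (addrC _ y) addrK (splitr d) ltrD.
Qed.

(** [smooth] asks for every iterated partial derivative separately and does not relate the two
    orders. The symmetry is what makes d_t preserve holomorphy and makes 4 d_t d_tbar the
    Laplacian. *)
Lemma pderive_swap (U : set C) (f : C -> C) (t : C) : open (U : set C^o) ->
  smooth U f -> U t ->
  pderive (0 +i* 1) (pderive 1 f) t = pderive 1 (pderive (0 +i* 1) f) t.
Proof.
move=> oU sf Ut.
have [d d0 dU] := ball_box oU Ut.
pose p (x y : R) := t + x%:C + y%:C * (0 +i* 1).
have p00 : p 0 0 = t by rewrite /p mul0r !addr0.
have Hx (g : C -> C) x y : smooth U g -> U (p x y) -> cder (fun h => g (p h y)) x (pderive 1 g (p x y)).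
  move=> sg Up; apply: cder_shift.
  have [/(_ _ Up)[/pderivable_pder A _] _ _] := sg 1%N.
  move: A; rewrite /pder; under eq_fun => h.
    have -> : p x y + h%:C * 1 = p (x + h) y.
      by apply: eqC; rewrite !reE /=; ring.
  over.
  by [].
have Hy (g : C -> C) x y : smooth U g -> U (p x y) -> cder (fun h => g (p x h)) y (pderive (0 +i* 1) g (p x y)).
  move=> sg Up; apply: cder_shift.
  have [/(_ _ Up)[_ /pderivable_pder A] _ _] := sg 1%N.
  move: A; rewrite /pder; under eq_fun => h.
    have -> : p x y + h%:C * (0 +i* 1) = p x (y + h).
      by apply: eqC; rewrite !reE /=; ring.
  over.
  by [].
have s1 : smooth U (pderive 1 f) by move=> k; have [_ H _] := sf k.+1; exact: H.
have s2 : smooth U (pderive (0 +i* 1) f) by move=> k; have [_ _ H] := sf k.+1; exact: H.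
have s12 : smooth U (pderive (0 +i* 1) (pderive 1 f)) by move=> k; have [_ _ H] := s1 k.+1; exact: H.
have s21 : smooth U (pderive 1 (pderive (0 +i* 1) f)) by move=> k; have [_ H _] := s2 k.+1; exact: H.
have c12 := s12 0%N t Ut; have c21 := s21 0%N t Ut.
apply: eqC.
- have := @mixed_partials (fun x y => Re (f (p x y))) (fun x y => Re (pderive 1 f (p x y)))
    (fun x y => Re (pderive (0 +i* 1) f (p x y)))
    (fun x y => Re (pderive (0 +i* 1) (pderive 1 f) (p x y)))
    (fun x y => Re (pderive 1 (pderive (0 +i* 1) f) (p x y))) d d0.
  rewrite p00; apply.
  + move=> x y xd yd; have Up := dU x y xd yd.
    by split; [exact: (Hx f x y sf Up).1|exact: (Hy f x y sf Up).1|
      exact: (Hy _ x y s1 Up).1|exact: (Hx _ x y s2 Up).1].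
  + move=> e e0; have [d1 d10 H1] := ccont_box c12 e0; have [d2 d20 H2] := ccont_box c21 e0.
    exists (Num.min d1 d2); first by rewrite lt_min d10.
    move=> x y; rewrite !lt_min => /andP[x1 x2] /andP[y1 y2].
    by split; [exact: (H1 x y x1 y1).1|exact: (H2 x y x2 y2).1].
- have := @mixed_partials (fun x y => Im (f (p x y))) (fun x y => Im (pderive 1 f (p x y)))
    (fun x y => Im (pderive (0 +i* 1) f (p x y)))
    (fun x y => Im (pderive (0 +i* 1) (pderive 1 f) (p x y)))
    (fun x y => Im (pderive 1 (pderive (0 +i* 1) f) (p x y))) d d0.
  rewrite p00; apply.
  + move=> x y xd yd; have Up := dU x y xd yd.
    by split; [exact: (Hx f x y sf Up).2|exact: (Hy f x y sf Up).2|
      exact: (Hy _ x y s1 Up).2|exact: (Hx _ x y s2 Up).2].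
  + move=> e e0; have [d1 d10 H1] := ccont_box c12 e0; have [d2 d20 H2] := ccont_box c21 e0.
    exists (Num.min d1 d2); first by rewrite lt_min d10.
    move=> x y; rewrite !lt_min => /andP[x1 x2] /andP[y1 y2].
    by split; [exact: (H1 x y x1 y1).2|exact: (H2 x y x2 y2).2].
Qed.

(** For holomorphic f one has d_t f = f_x and f_y = i f_x; swapping derivatives gives (f_x)_y = i
    f_xx, the Cauchy-Riemann equation for f_x. *)
Lemma holo_dt (U : set C) (f : C -> C) : open (U : set C^o) ->
  holomorphic U f -> holomorphic U (d_t f).
Proof.
move=> oU [sf hf].
have E1 t : U t -> pderive 1 f t = d_t f t.
  by move=> Ut; have [/pder_pderive -> _] := smooth_isW sf Ut; rewrite (hf t Ut) addr0.
have E2 t : U t -> pderive (0 +i* 1) f t = (0 +i* 1) * pderive 1 f t.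
  move=> Ut; rewrite E1 //; have [_ /pder_pderive ->] := smooth_isW sf Ut.
  by rewrite (hf t Ut) subr0.
apply: (holo_eq oU E1).
have s1 : smooth U (pderive 1 f) by move=> k; have [_ H _] := sf k.+1; exact: H.
have s2 : smooth U (pderive (0 +i* 1) f) by move=> k; have [_ _ H] := sf k.+1; exact: H.
split=> // t Ut; rewrite /d_tbar (pderive_swap oU sf Ut).
have [/(_ t Ut)[/pderivable_pder A _] _ _] := s1 1%N.
have [/(_ t Ut)[/pderivable_pder B _] _ _] := s2 1%N.
have := pderM (pder_cst 1 (0 +i* 1) t) A.
rewrite mul0r add0r => A'.
have -> : pderive 1 (pderive (0 +i* 1) f) t = (0 +i* 1) * pderive 1 (pderive 1 f) t.
  exact (cder_unique (pder_near (open_near_eq oU E2 Ut) B) A').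
by rewrite mulrA i2 mulN1r subrr mul0r.
Qed.

End Clairaut.

(** * A one-dimensional blow-up argument and connectedness of intervals *)

Section BlowUp.
Variable R : realType.

(* Since (log P)'' >= k P, the maximum of P(s) (r^2 - s^2)^2 on [-r, r] bounds
   P(0) by a constant times r^-2. *)
Lemma blow_up (P P1 P2 : R -> R) (k : R) : 0 < k ->
  (forall s, is_derive (s : R^o) (1 : R^o) (P : R^o -> R^o) (P1 s)) ->
  (forall s, is_derive (s : R^o) (1 : R^o) (P1 : R^o -> R^o) (P2 s)) ->
  (forall s, 0 < P s) ->
  (forall s, k * P s ^+ 3 <= P s * P2 s - P1 s ^+ 2) -> False.
Proof.
move=> k0 D1 D2 P0 H.
(* This is the half-width r. It satisfies L > 1 and k P(0) L > 8, hence k P(0) L^2 > 8, which is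
   incompatible with an interior maximum of [m] below. *)
pose L := 1 + 8 / (k * P 0).
have kP0 : 0 < k * P 0 by rewrite mulr_gt0.
have e0 : 0 < 8 / (k * P 0) by rewrite divr_gt0.
have L1 : 1 < L by rewrite /L ltrDl.
have L0 : 0 < L by rewrite (lt_trans ltr01).
have HL : 8 < k * P 0 * L ^+ 2.
  have : 8 < k * P 0 * L.
    rewrite /L mulrDr mulr1 mulrCA divff ?gt_eqF // mulr1.
    by rewrite ltrDr.
  move=> /lt_trans; apply; rewrite expr2 mulrA ltr_pMr //.
  by rewrite mulr_gt0.
pose q s := L ^+ 2 - s ^+ 2.
pose m s := P s * q s ^+ 2.
(* The derivative of [m] is q a, so inside the interval, where q > 0, its sign is that of [a]. The
   second-order test at the maximum becomes a first-order statement on [a]. *)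
pose a s := P1 s * q s - 4 * s * P s.
have dq (s : R) : is_derive (s : R^o) (1 : R^o) (q : R^o -> R^o) (- 2 * s).
  have A := @is_deriveB R R^o R^o (cst (L ^+ 2)) (fun s => s ^+ 2) s 1 0 _
     (is_derive_cst _ _ _) (@is_deriveX R R^o id 2 s 1 1 (is_derive_id _ _)).
  apply: is_derive_eq A _.
  by rewrite sub0r /= expr1 -[_ *: _]/(_ * _) mulr1 mulNr.
have dm (s : R) : is_derive (s : R^o) (1 : R^o) (m : R^o -> R^o) (q s * a s).
  have A := @is_deriveM R R^o P (fun s => q s ^+ 2) s 1 _ _ (D1 s) (@is_deriveX R R^o q 2 s 1 _ (dq s)).
  apply: is_derive_eq A _.
  rewrite /a /= expr1 -![_ *: _]/(_ * _); ring.
have da (s : R) : is_derive (s : R^o) (1 : R^o) (a : R^o -> R^o) (P2 s * q s - 6 * s * P1 s - 4 * P s).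
  have B1 := @is_deriveM R R^o P1 q s 1 _ _ (D2 s) (dq s).
  have B2 := @is_deriveM R R^o (fun s => 4 * s) P s 1 _ _ (@is_deriveZ R R^o R^o id 4 s 1 1 (is_derive_id _ _)) (D1 s).
  have A := @is_deriveB R R^o R^o _ _ s 1 _ _ B1 B2.
  apply: is_derive_eq A _.
  rewrite /= -![_ *: _]/(_ * _); ring.
have cm : {within `[- L, L], continuous m}.
  by apply: derivable_within_continuous => s _; case: (dm s).
have LL : - L <= L by rewrite ge0_cp // ltW.
have [c cL mc] := EVT_max LL cm.
have mc0 : m 0 <= m c by apply: mc; rewrite in_itv /= oppr_le0 ltW //= ltW.
have m00 : 0 < m 0 by rewrite /m /q expr0n /= subr0 mulr_gt0 // !exprn_gt0.
have {cL} [cL1 cL2] : - L < c /\ c < L.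
  have cn x : x ^+ 2 = L ^+ 2 -> c != x.
    move=> xL; apply: contraTneq (lt_le_trans m00 mc0) => ->.
    by rewrite /m /q xL subrr expr0n /= mulr0 ltxx.
  move: cL; rewrite in_itv /= => /andP[cL1 cL2].
  by rewrite !lt_neqAle cL1 cL2 cn // eq_sym cn // sqrrN.
have qc0 : 0 < q c.
  rewrite /q subr_gt0 -real_normK ?num_real // ltr_pXn2r ?nnegrE ?normr_ge0 ?ltW //.
  by rewrite ltr_norml cL1.
have ac : a c = 0.
  have A := @derive1_at_max R m (- L) L c (ltW (lt_trans cL1 cL2)) _ _ _.
  have /A [||_ B] : forall t, t \in `]- L, L[ -> derivable (m : R^o -> R^o) t 1.
  - by move=> t _; case: (dm t).
  - by rewrite in_itv /= cL1.
  - move=> t; rewrite in_itv /= => /andP[t1 t2]; apply: mc.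
    by rewrite in_itv /= !ltW.
  case: (dm c) => _; rewrite B => /esym/eqP.
  by rewrite mulf_eq0 gt_eqF //= => /eqP.
(* Here a(c) = 0 eliminates P1, and the differential inequality bounds P q a' from below by P^2 (k P
   q^2 - 4 c^2 - 4 L^2). This is positive because maximality gives k P q^2 >= k P(0) L^4 > 8 L^2. So
   [m] increases to the right of c. *)
have a'c : 0 < P2 c * q c - 6 * c * P1 c - 4 * P c.
  have Pc := P0 c.
  have E : P1 c * q c = 4 * c * P c by apply/eqP; rewrite -subr_eq0 -/(a c) ac.
  have kPq : 8 * L ^+ 2 < k * (P c * q c ^+ 2).
    apply: lt_le_trans (_ : k * m 0 <= _); last by rewrite ler_pM2l.
    have -> : k * m 0 = k * P 0 * L ^+ 2 * L ^+ 2 by rewrite /m /q expr0n /= subr0; ring.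
    by rewrite ltr_pM2r // exprn_gt0.
  have cL : c ^+ 2 < L ^+ 2 by rewrite -subr_gt0.
  rewrite -(pmulr_rgt0 _ qc0) -(pmulr_rgt0 _ Pc).
  have -> : P c * (q c * (P2 c * q c - 6 * c * P1 c - 4 * P c)) =
     (P c * P2 c) * q c ^+ 2 - 6 * c * P c * (P1 c * q c) - 4 * P c ^+ 2 * q c by ring.
  rewrite E.
  apply: (@lt_le_trans _ _ ((k * P c ^+ 3 + P1 c ^+ 2) * q c ^+ 2 - 6 * c * P c * (4 * c * P c) - 4 * P c ^+ 2 * q c)); last first.
    rewrite lerD2r lerD2r ler_pM2r ?exprn_gt0 //.
    by rewrite -lerBrDr.
  have -> : (k * P c ^+ 3 + P1 c ^+ 2) * q c ^+ 2 - 6 * c * P c * (4 * c * P c) - 4 * P c ^+ 2 * q c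
   = P c ^+ 2 * (k * (P c * q c ^+ 2)) + (P1 c * q c) ^+ 2 - 24 * c ^+ 2 * P c ^+ 2 - 4 * P c ^+ 2 * q c by ring.
  rewrite E.
  have -> : P c ^+ 2 * (k * (P c * q c ^+ 2)) + (4 * c * P c) ^+ 2 - 24 * c ^+ 2 * P c ^+ 2 - 4 * P c ^+ 2 * q c
   = P c ^+ 2 * (k * (P c * q c ^+ 2) - 4 * c ^+ 2 - 4 * L ^+ 2) by rewrite /q; ring.
  rewrite mulr_gt0 ?exprn_gt0 //; lra.
have /is_deriveP lim := da c.
have : \forall h \near (0 : R)^', 0 < h^-1 * (a (c + h) - a c).
  exact (lim [set x : R | 0 < x] (lt_nbhsr a'c)).
rewrite ac => /nbhs_ballP[/= d d0 Hd].
pose h := Num.min d (L - c) / 2.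
have m0 : 0 < Num.min d (L - c) by rewrite lt_min d0 subr_gt0.
have h0 : 0 < h by rewrite /h divr_gt0.
have hm : h < Num.min d (L - c) by rewrite /h ltr_pdivrMr // mulr2n mulrDr mulr1 ltrDl.
have [hd hL] : h < d /\ h < L - c by move: hm; rewrite lt_min => /andP.
have cch : c < c + h by rewrite ltrDl.
have [x /andP[cx xh] E] := @mvt R m (fun s => q s * a s) c (c + h) cch (fun s _ => dm s).
have ax : 0 < a x.
  have := Hd (x - c); rewrite /= /ball /= sub0r normrN subrKC.
  rewrite gtr0_norm ?subr_gt0 // subr0 => Hx.
  have := Hx (_ : x - c < d) (_ : x - c != 0); rewrite pmulr_rgt0 ?invr_gt0 ?subr_gt0 //; apply.
    by rewrite ltrBlDl (lt_trans xh) // ltrD2l.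
  by rewrite gt_eqF // subr_gt0.
have qx : 0 < q x.
  have xL : x < L by rewrite (lt_trans xh) // -ltrBrDl.
  have xL' : - L < x by rewrite (lt_trans cL1).
  rewrite /q subr_gt0 -real_normK ?num_real // ltr_pXn2r ?nnegrE ?normr_ge0 ?ltW //.
  by rewrite ltr_norml xL'.
have : m (c + h) <= m c.
  apply: mc; rewrite in_itv /=; apply/andP; split.
    by rewrite ltW // (lt_trans cL1) // ltrDl.
  by rewrite ltW // -ltrBrDl.
rewrite -subr_le0 E addrAC subrr add0r; apply/negP; rewrite -ltNge.
by rewrite !mulr_gt0.
Qed.

(** The supremum of the points up to which F keeps its initial value is attained and, unless it is
    the right end, can be passed. *)
Lemma locally_constant (T : Type) (F : R -> T) (I : interval R) :
  (forall x, x \in I -> exists2 d, 0 < d & forall y, y \in I -> `|y - x| < d -> F y = F x) ->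
  forall x y, x \in I -> y \in I -> F x = F y.
Proof.
move=> H.
suff W x y : x \in I -> y \in I -> x <= y -> F x = F y.
  move=> x y xI yI; case: (leP x y) => [|/ltW] xy; first exact: W.
  by apply/esym; exact: W.
move=> xI yI xy.
have sub z : x <= z <= y -> z \in I := @interval_is_interval R I x y xI yI z.
have H' z : exists2 d, 0 < d & forall w, x <= z <= y -> x <= w <= y -> `|w - z| < d -> F w = F z.
  case: (boolP (x <= z <= y)) => [zz|_]; last by exists 1.
  have [d d0 Hd] := H z (sub _ zz); exists d => // w _ ww; exact: Hd (sub _ ww).
pose S := [set z | x <= z <= y /\ forall w, x <= w <= z -> F w = F x].
have Sx : S x by split; [rewrite lexx|move=> w /le_anti ->].
have Sub : ubound S y by move=> z [/andP[]].
have hs : has_sup S by split; [exists x|exists y].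
have xs : x <= sup S by exact: ub_le_sup hs.2 _ Sx.
have sy : sup S <= y by exact: ge_sup hs.1 Sub.
have [d d0 Hd] := H' (sup S).
have sxy : x <= sup S <= y by rewrite xs.
have [z [zxy zP] zs] := sup_adherent d0 hs.
have zle : z <= sup S by apply: ub_le_sup hs.2 _ _; split.
have FsupS : F (sup S) = F x.
  rewrite -(zP z); last by rewrite lexx andbT; case/andP: zxy.
  apply/esym; apply: Hd => //.
  by rewrite ler0_norm ?subr_le0 // opprB ltrBlDr -ltrBlDl.
case: (leP y (sup S)) => [ys|sy'].
  by have -> : y = sup S by apply/le_anti; rewrite ys sy.
pose u := Num.min y (sup S + d / 2).
have su : sup S < u by rewrite lt_min sy' ltrDl divr_gt0.
suff /(ub_le_sup hs.2) : S u by rewrite leNgt su.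
split; first by rewrite ge_min lexx /= andbT (le_trans xs) // ltW.
move=> w /andP[xw wu].
case: (leP w z) => [wz|zw]; first by apply: zP; rewrite xw.
rewrite -FsupS; apply: Hd => //.
  by rewrite xw (le_trans wu) // ge_min lexx.
rewrite ltr_norml; apply/andP; split.
  by rewrite ltrBrDl; apply: le_lt_trans zw; apply: ltW.
rewrite ltrBlDl; apply: le_lt_trans wu _.
apply: le_lt_trans (_ : sup S + d / 2 < _); first by rewrite ge_min lexx orbT.
by rewrite ltrD2l ltr_pdivrMr // mulr2n mulrDr mulr1 ltrDl.
Qed.

End BlowUp.

(** * Signs on the punctured plane *)

Section Polar.
Variable R : realType.
Local Notation C := R[i].
Local Notation Re := complex.Re.
Local Notation Im := complex.Im.

Lemma locally_constant_near (T : Type) (F : R -> T) (I : interval R) :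
  (forall x, x \in I -> \forall y \near (x : R), y \in I -> F y = F x) ->
  forall x y, x \in I -> y \in I -> F x = F y.
Proof.
move=> H; apply: locally_constant => x xI.
have /nbhs_ballP[/= d d0 Hd] := H x xI; exists d => // y yI xy.
by apply: Hd => //; rewrite /ball /= distrC.
Qed.

Lemma addb_link (a b c a' b' c' : bool) :
  a (+) b = a' (+) b' -> b (+) c = b' (+) c' -> a (+) c = a' (+) c'.
Proof. by case: a a' b b' c c' => [] [] [] [] [] []. Qed.

(** Signs are booleans multiplied by [addb]; near x the two sign functions differ by a constant
    sign. *)
Definition same_germ (tau : R -> bool) (x : R) (sig : R -> bool) :=
  \forall y \near (x : R), tau y (+) sig y = tau x (+) sig x.

Lemma same_germC tau x sig : same_germ tau x sig -> same_germ sig x tau.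
Proof. by apply: filterS => y; rewrite addbC => ->; rewrite addbC. Qed.

Lemma same_germ_trans a b c x : same_germ a x b -> same_germ b x c -> same_germ a x c.
Proof. by apply: filterS2 => y; exact: addb_link. Qed.

Lemma same_germ_near a b c x : (\forall y \near (x : R), a y = b y) ->
  same_germ a x c -> same_germ b x c.
Proof.
move=> E; have /= E0 := nbhs_singleton E.
by move: E; apply: filterS2 => y <-; rewrite -E0.
Qed.

Lemma same_germ_addb a x c : same_germ (fun y => a y (+) c) x a.
Proof. by near=> y; rewrite addbAC addbb addbAC addbb. Unshelve. all: by end_near. Qed.

Section Ray.
Variable sig : R -> R -> bool.
Hypothesis sigP : forall x, exists2 d, 0 < d &
  forall z, `|z - x| < d -> same_germ (sig x) z (sig z).

(** The family [sig] encodes a double cover of the line: [sig x] is a local section around x,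
    meaningful up to a constant sign, and a good [tau] follows one section of the cover near x. *)
Let good (tau : R -> bool) x := same_germ tau x (sig x).

Let good_on a x := exists tau, forall z, a <= z <= x -> good tau z.

Lemma good_ext (a x y z d : R) : `|y - x| < d -> `|z - x| < d ->
  (forall z, `|z - x| < d -> same_germ (sig x) z (sig z)) ->
  y < z -> good_on a y -> good_on a z.
Proof.
move=> yd zd H yz [tau Ht].
have between w : y <= w <= z -> `|w - x| < d.
  case/andP=> yw wz; rewrite ltr_norml; apply/andP; split.
    by move: yd; rewrite ltr_norml => /andP[/lt_le_trans + _]; apply; rewrite lerD2r.
  by move: zd; rewrite ltr_norml => /andP[_]; apply: le_lt_trans; rewrite lerD2r.
case: (ltP y a) => [ya|ay].
  exists (sig x) => w /andP[aw wz]; apply/H/between.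
  by rewrite wz (le_trans (ltW ya)).
(* The sign by which the two sections differ at y; correcting [sig x] by it makes the pasted
   function agree with both germs at y. *)
pose c := tau y (+) sig x y.
pose tau' w := if w <= y then tau w else sig x w (+) c.
exists tau' => w /andP[aw wz].
have gx v : same_germ (fun v => sig x v (+) c) v (sig x) by exact: same_germ_addb.
case: (ltgtP w y) => [wy|yw|wy].
- apply: (@same_germ_near tau); last by apply: Ht; rewrite aw ltW.
  have := lt_nbhsl wy; apply: filterS => v vy.
  by rewrite /tau' ltW.
- apply: (@same_germ_near (fun v => sig x v (+) c)).
    have := lt_nbhsr yw; apply: filterS => v vy.
    by rewrite /tau' leNgt vy.
  by apply: same_germ_trans (gx w) _; apply/H/between; rewrite (ltW yw).
- rewrite wy.
  have gy : same_germ tau y (sig y) by apply: Ht; rewrite ay lexx.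
  have hy : same_germ (sig x) y (sig y) by apply/H/between; rewrite lexx ltW.
  have gx' : same_germ tau y (sig x) by apply: same_germ_trans gy (same_germC hy).
  apply: (@same_germ_near tau) => //.
  move: gx'; apply: filterS => v; rewrite /tau' => E.
  by case: (v <= y) => //; rewrite /c -E addbC -addbA addbb addbF.
Qed.

(** Existence of a section over [a, x] is locally constant in x: [good_ext] extends sections to the
    right, and restriction gives the converse. *)
Lemma good_on_all a x : good_on a x.
Proof.
suff E y : `[< good_on a y >] = `[< good_on a a >].
  apply/asboolP; rewrite E; apply/asboolP.
  exists (sig a) => z /le_anti <-.
  by rewrite /good /same_germ; near=> y; rewrite !addbb.
apply: (@locally_constant R _ (fun y => `[< good_on a y >]) `]-oo, +oo[) => //= z _.
have [d d0 H] := sigP z; exists d => // w _ wz.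
have zz : `|z - z| < d by rewrite subrr normr0.
have sub u v : u <= v -> good_on a v -> good_on a u.
  by move=> uv [t Ht]; exists t => s /andP[as_ su]; apply: Ht; rewrite as_ (le_trans su).
apply/asbool_equiv_eq; case: (ltgtP w z) => [wz'|wz'|->] //; split.
- exact: (good_ext wz zz H wz').
- exact: (sub _ _ (ltW wz')).
- exact: (sub _ _ (ltW wz')).
- exact: (good_ext zz wz H wz').
Unshelve. all: by end_near. Qed.

(* H^1(R, Z/2) = 0 *)
Lemma ray_lift : exists tau, forall x, same_germ tau x (sig x).
Proof.
(* Sections over the intervals [-x, x] are normalised at 0, so that any two of them agree wherever
   both are defined. *)
have /choice[t Ht] : forall x, exists tau : R -> bool,
    tau 0 = false /\ forall z, - x <= z <= x -> good tau z.
  move=> x; have [tau Ht] := good_on_all (- x) x.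
  exists (fun y => tau y (+) tau 0); split; first by rewrite addbb.
  by move=> z /Ht; apply: same_germ_trans; exact: same_germ_addb.
have U x y z : `|z| <= x -> `|z| <= y -> t x z = t y z.
  move=> zx zy.
  suff : t x z (+) t y z = false by case: (t x z); case: (t y z).
  transitivity (t x 0 (+) t y 0); last by rewrite !(Ht _).1.
  have I w : w \in `[- `|z|, `|z|] -> (- x <= w <= x) && (- y <= w <= y).
    by rewrite in_itv /= -!ler_norml => wz; rewrite !(le_trans wz).
  apply: (@locally_constant_near _ (fun w => t x w (+) t y w) `[- `|z|, `|z|]).
  - move=> w /I /andP[wx wy].
    have := same_germ_trans ((Ht x).2 _ wx) (same_germC ((Ht y).2 _ wy)).
    by apply: filterS => v ->.
  - by rewrite in_itv /= -ler_norml.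
  - by rewrite in_itv /= -ler_norml normr0.
(* Near x all these values are those of the one section over the interval of half-width |x| + 2. *)
exists (fun y => t (`|y| + 1) y) => x.
apply: (@same_germ_near (t (`|x| + 2))); last first.
  by apply: (Ht _).2; rewrite -ler_norml lerDl.
near=> y; apply: U; last by rewrite lerDl.
have -> : y = x + (y - x) by rewrite addrC subrK.
apply: le_trans (ler_normD _ _) _; rewrite lerD2l.
near: y; apply/nbhs_ballP; exists 1 => //= y; rewrite /ball /= distrC => H.
by rewrite ltW // (lt_trans H) // ltr1n.
Unshelve. all: by end_near. Qed.

End Ray.
End Polar.

(** * Polar coordinates on the punctured plane *)

Section PolarCoordinates.
Variable R : realType.
Local Notation C := R[i].
Local Notation Re := complex.Re.
Local Notation Im := complex.Im.

Lemma realC_eq0 (x : R) : (x%:C == 0) = (x == 0).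
Proof. by apply/eqP/eqP => [[]|->]. Qed.

(** The rotation e^(-iy), because T_y carries the fibre over t to the fibre over e^(-iy) t.
    Accordingly [pt s y] is e^(s - iy), and y is minus the usual argument. *)
Definition cis (y : R) : C := cexp (- (0 +i* y)).
Definition pt (s y : R) : C := cis y * (expR s)%:C.

Lemma cisE y : cis y = cos y +i* - sin y.
Proof.
rewrite /cis /cexp ReN ImN /= oppr0 expR0 mul1r cosN sinN.
by [].
Qed.

Lemma cisD x y : cis (x + y) = cis x * cis y.
Proof. by rewrite !cisE cosD sinD; apply: eqC; rewrite !reE /=; ring. Qed.

Lemma cis0 : cis 0 = 1. Proof. by rewrite cisE cos0 sin0 oppr0. Qed.

Lemma normc_cis y : normc (cis y) = 1.
Proof. by rewrite cisE /= sqrrN cos2Dsin2 sqrtr1. Qed.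

Lemma normc_real (x : R) : 0 <= x -> normc x%:C = x.
Proof. by move=> x0 /=; rewrite expr0n addr0 sqrtr_sqr ger0_norm. Qed.

Lemma normc_pt s y : normc (pt s y) = expR s.
Proof. by rewrite normcM normc_cis mul1r normc_real // expR_ge0. Qed.

Lemma normc_neq0 (z : C) : (0 < normc z) = (z != 0).
Proof.
apply/idP/idP; last exact: normc_gt0.
by apply: contraTneq => ->; rewrite normc0 ltxx.
Qed.

Lemma pt_neq0 s y : pt s y != 0.
Proof. by rewrite -normc_neq0 normc_pt expR_gt0. Qed.

Lemma cis_neq0 y : cis y != 0.
Proof. by rewrite -normc_neq0 normc_cis. Qed.

Lemma cis_conj y : conjc (cis y) * cis y = 1.
Proof.
rewrite cisE; apply: eqC; rewrite !reE /=; last by ring.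
by rewrite -(cos2Dsin2 y); ring.
Qed.

Lemma ptD s y s' y' : pt (s + s') (y + y') = pt s y * pt s' y'.
Proof. by rewrite /pt cisD expRD rmorphM; ring. Qed.

Lemma cis2pi : cis (2%:R * pi) = 1.
Proof. by rewrite mulr_natl cisE cos2pi sin2pi oppr0. Qed.

Lemma pt_period s y : pt s (y + 2%:R * pi) = pt s y.
Proof. by rewrite /pt cisD cis2pi mulr1. Qed.

Lemma cis_surj (z : C) : normc z = 1 -> exists y, z = cis y.
Proof.
case: z => a b /= ab.
have ab1 : a ^+ 2 + b ^+ 2 = 1.
  by rewrite -[LHS]sqr_sqrtr ?addr_ge0 ?sqr_ge0 // ab expr1n.
have a1 : -1 <= a <= 1.
  rewrite -ler_norml -(@expr_le1 _ 2) // real_normK ?num_real // -ab1 lerDl.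
  exact: sqr_ge0.
have sb : sin (acos a) = `|b|.
  by rewrite sin_acos // -ab1 addrC addKr sqrtr_sqr.
have ca : cos (acos a) = a by rewrite acosK // in_itv.
case: (lerP 0 b) => b0.
  exists (- acos a); rewrite cisE cosN sinN opprK sb ca ger0_norm //.
by exists (acos a); rewrite cisE sb ca ltr0_norm // opprK.
Qed.

Lemma pt_surj (t : C) : t != 0 -> exists s y, t = pt s y.
Proof.
move=> t0; have n0 := normc_gt0 t0.
have [|y E] := @cis_surj (t / (normc t)%:C).
  by rewrite normcM normcV normc_real ?divff ?gt_eqF // ltW.
exists (ln (normc t)), y; rewrite /pt lnK // -E divfK //.
by rewrite realC_eq0 gt_eqF.
Qed.

Lemma cos_eq1 (x : R) : 0 <= x -> cos x = 1 -> exists k : nat, x = (2%:R * pi) *+ k.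
Proof.
move=> x0 cx.
have p0 : 0 < 2%:R * pi :> R by rewrite mulr_gt0 // pi_gt0.
pose k := Num.trunc (x / (2%:R * pi)).
have /andP[k1 k2] : k%:R <= x / (2%:R * pi) < k.+1%:R.
  by apply: truncn_itv; rewrite divr_ge0 // ltW.
exists k; pose r := x - (2%:R * pi) *+ k.
have r0 : 0 <= r.
  by rewrite subr_ge0 -[leLHS]mulr_natl -ler_pdivlMr.
have r2 : r < 2%:R * pi.
  by rewrite ltrBlDr -mulrS -[ltRHS]mulr_natl -ltr_pdivrMr.
have cr : cos r = 1.
  rewrite -cx (_ : x = r + (pi *+ 2) *+ k) ?(periodicn (@cosD2pi R)) //.
  by rewrite /r -(mulr_natl pi 2) subrK.
suff : r = 0 by move/eqP; rewrite subr_eq0 => /eqP.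
have inj (z : R) : 0 <= z <= pi -> cos z = 1 -> z = 0.
  move=> zp cz; have z0 : z \in `[0, pi] by rewrite in_itv.
  have o0 : 0 \in `[0, (pi : R)] by rewrite in_itv /= lexx pi_ge0.
  exact (@cos_inj R z 0 z0 o0 (etrans cz (esym (@cos0 R)))).
case: (leP r pi) => rp; first by apply: inj => //; rewrite r0.
have : 2%:R * pi - r = 0.
  apply: inj; last by rewrite cosB mulr_natl cos2pi sin2pi cr; ring.
  by apply/andP; split; lra.
by move/eqP; rewrite subr_eq0 => /eqP E; rewrite E ltxx in r2.
Qed.

Lemma pt_inj s y s' y' : pt s y = pt s' y' -> y <= y' ->
  s = s' /\ exists k : nat, y' = y + (2%:R * pi) *+ k.
Proof.
move=> E yy'.
have ss' : s = s' by apply: expR_inj; rewrite -(normc_pt s y) E normc_pt.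
split=> //; rewrite -ss' in E.
have Ecis : cis y = cis y'.
  apply: (@mulIf _ (expR s)%:C) => //.
  by rewrite realC_eq0 gt_eqF // expR_gt0.
have c1 : cos (y' - y) = 1.
  move: Ecis; rewrite !cisE => -[ec /oppr_inj es].
  by rewrite cosB -ec -es -!expr2 cos2Dsin2.
have y0 : 0 <= y' - y by rewrite subr_ge0.
by have [k Ek] := cos_eq1 y0 c1; exists k; rewrite -Ek addrC subrK.
Qed.

Lemma pt_cont s0 y0 (P : C -> Prop) : nbhs (pt s0 y0 : C^o) P ->
  exists2 e, 0 < e & forall s y, `|s - s0| < e -> `|y - y0| < e -> P (pt s y).
Proof.
move=> HP.
have H : (fun p : R * R => pt p.1 p.2) @ (s0, y0) --> (pt s0 y0 : C^o).
  have -> : (fun p : R * R => pt p.1 p.2) =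
     (fun p => (cos p.2 +i* - sin p.2) * (expR p.1 +i* 0)).
    by apply/funext => p; rewrite /pt cisE.
  rewrite /pt cisE; apply: cvgcM; apply/cvgCP; split => /=.
  - apply: (cvg_comp snd (@cos R)) (@continuous_cos R y0); exact: cvg_snd.
  - apply: (@cvgN _ R^o).
    apply: (cvg_comp snd (@sin R)) (@continuous_sin R y0); exact: cvg_snd.
  - apply: (cvg_comp fst (@expR R)) (@continuous_expR R s0); exact: cvg_fst.
  - exact: (@cvg_cst R^o).
have /nbhs_ballP[e /= e0 He] := H _ HP.
exists e => // s y se ye; apply: (He (s, y)).
by split; rewrite /ball /= distrC.
Qed.

(** Nearby points have nearby polar coordinates. Around 1 these are ln |z| and - asin (Im z / |z|),
    correct as long as Re z > 0; multiplication by [pt s0 y0] transports them to any other point. *)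
Lemma pt_open (s0 y0 e : R) : 0 < e -> exists2 d, 0 < d & forall t : C, normc (t - pt s0 y0) < d ->
  exists s y, [/\ `|s - s0| < e, `|y - y0| < e & t = pt s y].
Proof.
move=> e0.
have c1 : ccont (fun z : C => `|z|) 1 by apply: ccont_norm; exact: ccont_id.
have n1 : normc (1 : C) = 1 by rewrite normc1.
pose a (z : C) := Im z / normc z.
have cn : (fun z : C => normc z) @ (1 : C^o) --> (1 : R^o).
  by have /ccontP[+ _] := c1; rewrite [Re `|1|]n1.
have ci : (fun z : C => Im z) @ (1 : C^o) --> (0 : R^o).
  by have /ccontP[_] := @ccont_id R 1.
have cr : (fun z : C => Re z) @ (1 : C^o) --> (1 : R^o).
  by have /ccontP[+ _] := @ccont_id R 1.
have cl : (fun z : C => ln (normc z)) @ (1 : C^o) --> (0 : R^o).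
  rewrite -ln1; exact: (cvg_comp (fun z : C => normc z) (@ln R) cn (continuous_ln (@ltr01 R))).
have ca : a @ (1 : C^o) --> (0 : R^o).
  rewrite -[0](mul0r (1 : R)^-1).
  have cv := @cvgV R _ (nbhs (1 : C^o)) (nbhs_filter _) _ _ (oner_neq0 _) cn.
  exact: (@cvgM R _ (nbhs (1 : C^o)) (nbhs_filter _) _ _ _ _ ci cv).
have cs : (fun z => asin (a z)) @ (1 : C^o) --> (0 : R^o).
  have a0 : -1 < (0 : R) < 1 by rewrite ltrN10 ltr01.
  have as0 : asin (0 : R) = 0.
    by rewrite -{1}(sin0 R) sinK // in_itv /= oppr_le0 divr_ge0 ?pi_ge0.
  rewrite -as0; exact (cvg_comp a (@asin R) ca (continuous_asin a0)).
have : nbhs (1 : C^o) (fun z : C => [/\ `|ln (normc z)| < e, `|asin (a z)| < e & 0 < Re z]).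
  have A1 : nbhs (1 : C^o) (fun z : C => `|ln (normc z)| < e).
    by move/cvgrPdist_lt : cl => /(_ e e0); apply: filterS => z; rewrite sub0r normrN.
  have A2 : nbhs (1 : C^o) (fun z : C => `|asin (a z)| < e).
    by move/cvgrPdist_lt : cs => /(_ e e0); apply: filterS => z; rewrite sub0r normrN.
  have A3 : nbhs (1 : C^o) (fun z : C => 0 < Re z).
    exact: (cr _ (lt_nbhsr (@ltr01 R))).
  by apply: filterS3 A1 A2 A3.
move/nbhsCP => [d d0 Hd].
have p0 : 0 < normc (pt s0 y0) by rewrite normc_pt expR_gt0.
exists (d * normc (pt s0 y0)); first by rewrite mulr_gt0.
move=> t td; have [z tE] : exists z, t = pt s0 y0 * z.
  by exists (t / pt s0 y0); rewrite mulrC divfK ?pt_neq0.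
have [|z1 z2 z3] := Hd z.
  rewrite -(ltr_pM2r p0) -normcM mulrBl mul1r [z * _]mulrC -tE //.
exists (s0 + ln (normc z)), (y0 - asin (a z)).
split; [by rewrite addrC addKr|by rewrite addrC addKr normrN|].
rewrite ptD [LHS]tE; congr (_ * _).
have nz : 0 < normc z.
  rewrite normc_neq0; apply: contraTneq z3 => ->.
  by rewrite ltxx.
have n2 : normc z ^+ 2 = Re z ^+ 2 + Im z ^+ 2.
  by case: (z) => x y /=; rewrite sqr_sqrtr // addr_ge0 ?sqr_ge0.
have az : -1 <= a z <= 1.
  rewrite -ler_norml /a normrM normfV (gtr0_norm nz) ler_pdivrMr // mul1r.
  exact: normc_Im.
have ca' : cos (asin (a z)) = Re z / normc z.
  rewrite cos_asin //.
  have -> : 1 - a z ^+ 2 = (Re z / normc z) ^+ 2.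
    rewrite /a !expr_div_n n2; field.
    by rewrite -n2 gt_eqF // exprn_gt0.
  by rewrite sqrtr_sqr gtr0_norm // divr_gt0.
rewrite /pt cisE cosN sinN opprK ca' asinK ?in_itv // lnK //.
rewrite /a; move: (normc z) nz => m m0.
by apply: eqC; rewrite !reE /=; field; rewrite gt_eqF.
Qed.

End PolarCoordinates.

(** * Lifting signs to the universal cover *)

Section SignLift.
Variable R : realType.
Local Notation C := R[i].

Lemma pt_near_s s0 y (P : C -> Prop) : nbhs (pt s0 y : C^o) P ->
  \forall s \near (s0 : R), P (pt s y).
Proof.
move=> /pt_cont[e e0 H]; apply/nbhs_ballP; exists e => // s.
by rewrite /ball /= distrC => ?; apply: H => //; rewrite subrr normr0.
Qed.

Lemma pt_near_y s y0 (P : C -> Prop) : nbhs (pt s y0 : C^o) P ->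
  \forall y \near (y0 : R), P (pt s y).
Proof.
move=> /pt_cont[e e0 H]; apply/nbhs_ballP; exists e => // y.
by rewrite /ball /= distrC => ?; apply: H => //; rewrite subrr normr0.
Qed.

Lemma expR_pt s : (expR s)%:C = pt s 0 :> C.
Proof. by rewrite /pt cis0 mul1r. Qed.

(** Against a fixed choice of vectors, [sig t0 t] is to be the sign of a continuous local section
    around t0, and [rho y t] the sign of the rotated choice. H2 compares two local sections, H3
    expresses continuity in the angle at a fixed point, and H4 continuity in the point at a fixed
    angle. *)
Variables (sig : C -> C -> bool) (rho : R -> C -> bool).
Hypothesis H2 : forall t0, t0 != 0 -> exists2 d, 0 < d &
  forall t1, normc (t1 - t0) < d -> t1 != 0 ->
  \forall t \near (t1 : C^o), sig t0 t (+) sig t1 t = sig t0 t1 (+) sig t1 t1.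
Hypothesis H3 : forall y t, t != 0 ->
  same_germ (rho^~ t) y (fun y' => sig (cis y * t) (cis y' * t)).
Hypothesis H4 : forall y t, t != 0 -> \forall t' \near (t : C^o),
  rho y t' (+) sig t t' (+) sig (cis y * t) (cis y * t') =
  rho y t (+) sig t t (+) sig (cis y * t) (cis y * t).

(* The sign mu s y is carried from 1 to e^s along the positive real axis, by tau,
   and then from e^s to pt s y by the rotation, i.e. by rho. *)
Lemma sign_lift : exists mu : R -> R -> bool,
  (forall s0 y0, exists2 e, 0 < e & forall s y, `|s - s0| < e -> `|y - y0| < e ->
    mu s y (+) sig (pt s0 y0) (pt s y) = mu s0 y0 (+) sig (pt s0 y0) (pt s0 y0)) /\
  (forall s y, mu s (y + 2%:R * pi) = mu s y (+) (rho (2%:R * pi) 1 (+) rho 0 1)).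
Proof.
have [x|tau Htau] := @ray_lift R (fun x s => sig (expR x)%:C (expR s)%:C).
  have x0 : (expR x)%:C != 0 :> C by rewrite expR_pt pt_neq0.
  have [d d0 Hd] := H2 x0.
  have /pt_cont[e e0 He] : nbhs (pt x 0 : C^o) (fun t : C => normc (t - (expR x)%:C) < d).
    by apply/nbhsCP; exists d => //; rewrite -expR_pt.
  exists e => // z zx.
  have zd : normc ((expR z)%:C - (expR x)%:C) < d.
    by rewrite (expR_pt z); apply: He => //; rewrite subrr normr0.
  have z0 : (expR z)%:C != 0 :> C by rewrite expR_pt pt_neq0.
  have := Hd _ zd z0; rewrite {1}(expR_pt z) => /pt_near_s.
  by apply: filterS => s; rewrite -expR_pt.
pose mu s y := tau s (+) rho y (expR s)%:C.
have C1 s0 y0 : exists2 e, 0 < e & forall s y, `|s - s0| < e -> `|y - y0| < e ->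
    mu s y (+) sig (pt s0 y0) (pt s y) = mu s0 y0 (+) sig (pt s0 y0) (pt s0 y0).
  have [d d0 Hd] := H2 (pt_neq0 s0 y0).
  have /pt_cont[e e0 He] : nbhs (pt s0 y0 : C^o) (fun t : C => normc (t - pt s0 y0) < d).
    by apply/nbhsCP; exists d.
  exists e => // s y se ye.
  have Es (x : R) : (expR x)%:C != 0 :> C by rewrite expR_pt pt_neq0.
  have in_s x : (x \in `]s0 - e, s0 + e[) = (`|x - s0| < e) by rewrite in_itv /= -ltr_distl.
  have in_y x : (x \in `]y0 - e, y0 + e[) = (`|x - y0| < e) by rewrite in_itv /= -ltr_distl.
  have s00 : `|s0 - s0| < e by rewrite subrr normr0.
  have y00 : `|y0 - y0| < e by rewrite subrr normr0.
  (* The box is crossed along two sides: the angle moves at fixed s by H3, then s moves at the fixed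
     angle y0 by H4 and the choice of [tau]. *)
  transitivity (mu s y0 (+) sig (pt s0 y0) (pt s y0)).
    apply: (@locally_constant_near _ _ (fun y => mu s y (+) sig (pt s0 y0) (pt s y)) `]y0 - e, y0 + e[); rewrite ?in_y //.
    move=> x; rewrite in_y => xy.
    have A := H3 x (Es s).
    have /pt_near_y B := Hd _ (He _ _ se xy) (pt_neq0 s x).
    near=> z => _; rewrite /mu -!addbA; congr (_ (+) _).
    apply: (@addb_link _ (sig (pt s x) (pt s z)) _ _ (sig (pt s x) (pt s x))); first by near: z.
    rewrite addbC [RHS]addbC; by near: z.
  apply: (@locally_constant_near _ _ (fun s => mu s y0 (+) sig (pt s0 y0) (pt s y0)) `]s0 - e, s0 + e[); rewrite ?in_s //.
  move=> x; rewrite in_s => xs.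
  have A := Htau x.
  have := H4 y0 (Es x); rewrite {1}expR_pt => /pt_near_s B.
  have /pt_near_s D := Hd _ (He _ _ xs y00) (pt_neq0 x y0).
  near=> z => _.
  have A' : tau z (+) sig (expR x)%:C (expR z)%:C = tau x (+) sig (expR x)%:C (expR x)%:C by near: z.
  have B' : rho y0 (expR z)%:C (+) sig (expR x)%:C (expR z)%:C (+) sig (pt x y0) (pt z y0) =
    rho y0 (expR x)%:C (+) sig (expR x)%:C (expR x)%:C (+) sig (pt x y0) (pt x y0).
    by near: z; apply: filterS B => s'; rewrite -expR_pt.
  have D' : sig (pt s0 y0) (pt z y0) (+) sig (pt x y0) (pt z y0) =
    sig (pt s0 y0) (pt x y0) (+) sig (pt x y0) (pt x y0) by near: z.
  move: A' B' D'; rewrite /mu.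
  move: (tau z) (tau x) (sig (expR x)%:C _) (sig (expR x)%:C _) (rho y0 _) (rho y0 _).
  move: (sig (pt s0 y0) _) (sig (pt s0 y0) _) (sig (pt x y0) _) (sig (pt x y0) _).
  by do 10 case.
exists mu; split=> // s y.
(* The monodromy at (s, y). As [pt] is periodic, both terms are compared with the same local signs,
   so N is locally constant on the plane and equals its value at the origin. *)
pose N s y := mu s (y + 2%:R * pi) (+) mu s y.
suff : N s y = N 0 0.
  rewrite /N /mu add0r expR0 => E.
  move: E; rewrite (_ : (1 : R)%:C = 1 :> C) //.
  move: (rho _ (expR s)%:C) (rho _ (expR s)%:C) (rho _ 1) (rho _ 1) (tau s) (tau 0).
  by do 6 case.
have loc s0 y0 : exists2 e, 0 < e & forall s y, `|s - s0| < e -> `|y - y0| < e -> N s y = N s0 y0.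
  have [e1 e10 E1] := C1 s0 y0; have [e2 e20 E2] := C1 s0 (y0 + 2%:R * pi).
  exists (Num.min e1 e2); first by rewrite lt_min e10.
  move=> s' y'; rewrite !lt_min => /andP[s1 s2] /andP[y1 y2].
  have := E1 s' y' s1 y1.
  have := E2 s' (y' + 2%:R * pi) s2; rewrite opprD addrACA subrr addr0 => /(_ y2).
  rewrite !pt_period /N.
  move: (mu s' _) (mu s' _) (mu s0 _) (mu s0 _) (sig _ _) (sig _ _).
  by do 6 case.
transitivity (N s 0).
  apply: (@locally_constant _ _ (N s) `]-oo, +oo[) => // x _.
  have [e e0 E] := loc s x; exists e => // z _ zx.
  by apply: E => //; rewrite subrr normr0.
apply: (@locally_constant _ _ (fun s => N s 0) `]-oo, +oo[) => // x _.
have [e e0 E] := loc x 0; exists e => // z _ zx.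
by apply: E => //; rewrite subrr normr0.
Unshelve. all: by end_near. Qed.

End SignLift.

(** * Hermitian matrices and flat metrics *)

Lemma mulmx_regroup (F : pzSemiRingType) n (A B X Y : 'M[F]_n) :
  A *m (X *m Y) *m B = A *m X *m (Y *m B).
Proof. by rewrite !mulmxA. Qed.

Section HermitianAlgebra.
Variable R : realType.
Local Notation C := R[i].
Local Notation Re := complex.Re.
Local Notation Im := complex.Im.

Lemma invmxM n (A B : 'M[C]_n) : A \in unitmx -> B \in unitmx ->
  invmx (A *m B) = invmx B *m invmx A.
Proof.
move=> Au Bu; have E : (A *m B) *m (invmx B *m invmx A) = 1%:M.
  by rewrite mulmxA mulmxK // mulmxV.
by rewrite -[LHS]mulmx1 -E mulKmx // unitmx_mul Au.
Qed.

Definition adj m n (A : 'M[C]_(m, n)) : 'M[C]_(n, m) := (map_mx (@conjc R) A)^T.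

Lemma adjM m n p (A : 'M[C]_(m, n)) (B : 'M[C]_(n, p)) : adj (A *m B) = adj B *m adj A.
Proof. by rewrite /adj map_mxM trmx_mul. Qed.
Lemma adjK m n (A : 'M[C]_(m, n)) : adj (adj A) = A.
Proof. by apply/matrixP => i j; rewrite !mxE conjcK. Qed.
Lemma adjD m n (A B : 'M[C]_(m, n)) : adj (A + B) = adj A + adj B.
Proof. by rewrite /adj map_mxD raddfD. Qed.
Lemma adjN m n (A : 'M[C]_(m, n)) : adj (- A) = - adj A.
Proof. by rewrite /adj map_mxN raddfN. Qed.
Lemma adjZ m n a (A : 'M[C]_(m, n)) : adj (a *: A) = conjc a *: adj A.
Proof. by apply/matrixP => i j; rewrite !mxE rmorphM. Qed.
Lemma adj_unit n (A : 'M[C]_n) : (adj A \in unitmx) = (A \in unitmx).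
Proof. by rewrite /adj unitmx_tr map_unitmx. Qed.
Lemma adj_inv n (A : 'M[C]_n) : adj (invmx A) = invmx (adj A).
Proof. by rewrite /adj map_invmx trmx_inv. Qed.
Lemma tr_adj n (A : 'M[C]_n) : \tr (adj A) = conjc (\tr A).
Proof. by rewrite /adj mxtrace_tr trace_map_mx. Qed.

Lemma adj_commutator n (Z : 'M[C]_n) :
  adj (Z *m adj Z - adj Z *m Z) = Z *m adj Z - adj Z *m Z.
Proof. by rewrite adjD adjN !adjM adjK. Qed.

Lemma mulcJ (x : C) : x * conjc x = (normc x ^+ 2)%:C.
Proof. by rewrite -sqr_normc rmorphXn. Qed.

Lemma tr_mul_adj n (A : 'M[C]_n) :
  \tr (A *m adj A) = (\sum_i \sum_j normc (A i j) ^+ 2)%:C.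
Proof.
rewrite /mxtrace rmorph_sum /=; apply: eq_bigr => i _.
rewrite !mxE rmorph_sum /=; apply: eq_bigr => j _.
by rewrite !mxE mulcJ.
Qed.

Lemma tr_mul_adj_ge0 n (A : 'M[C]_n) : 0 <= \tr (A *m adj A).
Proof.
rewrite tr_mul_adj ler0c; apply: sumr_ge0 => i _; apply: sumr_ge0 => j _.
exact: sqr_ge0.
Qed.

Definition posdef n (H : 'M[C]_n) :=
  adj H = H /\ forall v : 'cV[C]_n, v != 0 -> 0 < (adj v *m H *m v) 0 0.

(** W is the root of the spectral diagonal times the diagonalising unitary matrix. Conjugation by W
    turns the adjoint for H into the conjugate transpose, which reduces trace inequalities to the
    standard inner product. *)
Lemma posdef_factor n (H : 'M[C]_n) : posdef H ->
  exists2 W : 'M[C]_n, W \in unitmx & H = adj W *m W.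
Proof.
move=> [hH pH].
have nH : H \is normalmx.
  by apply/normalmxP; rewrite -map_trmx; change (H *m adj H = adj H *m H); rewrite hH.
have [P PU [d Hd]] : exists2 P : 'M[C]_n, P *m adj P = 1%:M & exists d, H = invmx P *m diag_mx d *m P.
  exists (spectralmx H).
    have /unitarymxP := spectral_unitarymx H.
    by rewrite -map_trmx.
  by exists (spectral_diag H); apply/orthomx_spectralP.
have Pu : P \in unitmx by have [] := mulmx1_unit PU.
have Pi : invmx P = adj P by rewrite -[RHS]mul1mx -(mulVmx Pu) -mulmxA PU mulmx1.
have dE : diag_mx d = P *m H *m adj P by rewrite Hd -Pi !mulmxA mulmxV // mul1mx mulmxK.
have d0 j : 0 < d 0 j.
  have -> : d 0 j = diag_mx d j j by rewrite mxE eqxx.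
  pose v := adj P *m delta_mx j (0 : 'I_1).
  have -> : diag_mx d j j = (adj v *m H *m v) 0 0.
    rewrite dE /v adjM adjK.
    have -> : adj (delta_mx j (0 : 'I_1)) = delta_mx 0 j :> 'M[C]_(1, n).
      by apply/matrixP => a b; rewrite !mxE conjc_nat andbC.
    transitivity (((delta_mx 0 j : 'rV[C]_n) *m (P *m H *m adj P) *m delta_mx j (0 : 'I_1)) 0 0).
      by rewrite -rowE -colE !mxE.
    by rewrite !mulmxA.
  apply: pH; apply/eqP => v0.
  have : P *m v = delta_mx j 0 by rewrite /v mulmxA PU mul1mx.
  rewrite v0 mulmx0 => /matrixP/(_ j 0)/eqP.
  by rewrite !mxE !eqxx eq_sym oner_eq0.
pose s : 'rV[C]_n := \row_j (Num.sqrt (Re (d 0 j)))%:C.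
have ds j : 0 < Re (d 0 j) /\ d 0 j = (Re (d 0 j))%:C.
  have := d0 j; rewrite ltcE => /andP[/eqP i0 r0]; split=> //.
  by apply: eqC.
have ss : diag_mx d = diag_mx s *m diag_mx s.
  apply/matrixP => a b; rewrite mul_diag_mx !mxE.
  case: eqP => [->|_]; last by rewrite !mulr0n mulr0.
  rewrite !mulr1n -rmorphM -expr2 sqr_sqrtr; first by have [] := ds b.
  by rewrite ltW //; have [] := ds b.
exists (diag_mx s *m P).
  rewrite unitmx_mul Pu andbT unitmxE det_diag unitfE; apply/prodf_neq0 => j _.
  rewrite mxE; apply/eqP => -[/eqP]; rewrite sqrtr_eq0 leNgt.
  by have [->] := ds j.
rewrite adjM.
have -> : adj (diag_mx s) = diag_mx s.
  apply/matrixP => a b; rewrite !mxE eq_sym; case: eqP => [->|_].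
    by rewrite !mulr1n conjc_real.
  by rewrite !mulr0n conjc0.
by rewrite Hd Pi ss; exact: mulmx_regroup.
Qed.

Lemma posdef_unit n (H : 'M[C]_n) : posdef H -> H \in unitmx.
Proof. by move=> /posdef_factor[W Wu ->]; rewrite unitmx_mul adj_unit Wu. Qed.

Section Dagger.
Variables (n : nat) (H : 'M[C]_n).
Hypothesis Hp : posdef H.

(** The adjoint of X for the Hermitian form with Gram matrix H. *)
Definition dag (X : 'M[C]_n) := invmx H *m adj X *m H.

Let Hu : H \in unitmx := posdef_unit Hp.

Lemma dag_factor W X : W \in unitmx -> H = adj W *m W ->
  W *m dag X *m invmx W = adj (W *m X *m invmx W).
Proof.
move=> Wu HW; rewrite !adjM /dag HW adj_inv invmxM ?adj_unit //.
move: (invmx (adj W)) (adj X) (adj W) => Y Z V.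
by rewrite !mulmxA (mulmxV Wu) mul1mx (mulmxK Wu).
Qed.

Lemma tr_conj W (X : 'M[C]_n) : W \in unitmx -> \tr (W *m X *m invmx W) = \tr X.
Proof. by move=> Wu; rewrite mxtrace_mulC mulmxA mulVmx // mul1mx. Qed.

Lemma conj_mul W (X Y : 'M[C]_n) : W \in unitmx ->
  W *m (X *m Y) *m invmx W = (W *m X *m invmx W) *m (W *m Y *m invmx W).
Proof. by move=> Wu; rewrite !mulmxA mulmxKV. Qed.

Lemma tr_dag_ge0 X : 0 <= \tr (X *m dag X).
Proof.
have [W Wu HW] := posdef_factor Hp.
by rewrite -(tr_conj _ Wu) conj_mul // dag_factor // tr_mul_adj_ge0.
Qed.

Lemma dagD X Y : dag (X + Y) = dag X + dag Y.
Proof. by rewrite /dag adjD mulmxDr mulmxDl. Qed.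
Lemma dagZ a X : dag (a *: X) = conjc a *: dag X.
Proof. by rewrite /dag adjZ -scalemxAr -scalemxAl. Qed.
Lemma dagK X : dag (dag X) = X.
Proof. by rewrite /dag !adjM adjK adj_inv Hp.1 !mulmxA mulVmx // mul1mx mulmxKV. Qed.
Lemma dagM X Y : dag (X *m Y) = dag Y *m dag X.
Proof. by rewrite /dag adjM !mulmxA mulmxK. Qed.
Lemma tr_dag X : \tr (dag X) = conjc (\tr X).
Proof. by rewrite /dag mxtrace_mulC mulmxA mulmxV // mul1mx tr_adj. Qed.
End Dagger.

(* In a unitary frame in which X is strictly lower triangular, the diagonal of
   D = [X, X^*] satisfies \sum_i i D_ii = \sum_(j < i) (i - j) |X_ij|^2. *)
Lemma strict_trig_commutator n (X : 'M[C]_n.+1) : (0 < n)%N ->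
  (forall i j : 'I_n.+1, (i <= j)%N -> X i j = 0) ->
  forall D, D = X *m adj X - adj X *m X ->
  \tr (X *m adj X) ^+ 2 <= (\sum_(i < n.+1) i%:R ^+ 2) * \tr (D *m adj D).
Proof.
move=> n0 X0 D DE; rewrite !tr_mul_adj.
have -> : \sum_(i < n.+1) i%:R ^+ 2 = (\sum_(i < n.+1) i%:R ^+ 2 : R)%:C :> C.
  by rewrite rmorph_sum; apply: eq_bigr => i _; rewrite rmorphXn rmorph_nat.
set f := \sum_i \sum_j normc (X i j) ^+ 2; set K := \sum_i _ ^+ 2; set S := \sum_i \sum_j _.
rewrite -rmorphXn -rmorphM lecR.
pose x (i j : 'I_n.+1) := normc (X i j) ^+ 2.
pose d i := \sum_j x i j - \sum_j x j i.
have Dd i : D i i = (d i)%:C.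
  rewrite DE !mxE /d rmorphB !rmorph_sum /=; congr (_ - _); apply: eq_bigr => j _.
    by rewrite !mxE mulcJ.
  by rewrite !mxE mulrC mulcJ.
have Sd : \sum_i d i ^+ 2 <= S.
  rewrite /S; apply: ler_sum => i _; rewrite [leRHS](bigD1 i) //= Dd /= expr0n addr0 sqr_sqrtr ?sqr_ge0 //.
  by rewrite lerDl sumr_ge0 // => j _; exact: sqr_ge0.
have fd : f <= \sum_(i < n.+1) i%:R * d i.
  have -> : \sum_(i < n.+1) i%:R * d i = \sum_(i < n.+1) \sum_(j < n.+1) (i%:R - j%:R) * x i j.
    under eq_bigr do rewrite /d mulrBr !mulr_sumr.
    rewrite sumrB [X in _ - X]exchange_big -sumrB; apply: eq_bigr => i _.
    by rewrite -sumrB; apply: eq_bigr => j _; rewrite mulrBl.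
  apply: ler_sum => i _; apply: ler_sum => j _; rewrite -/(x i j).
  case: (leqP i j) => ij; first by rewrite /x X0 // normc0 expr0n mulr0.
  rewrite ler_peMl ?sqr_ge0 // lerBrDr.
  by rewrite -[1]/(1%:R) -natrD ler_nat add1n.
have f0 : 0 <= f by apply: sumr_ge0 => i _; apply: sumr_ge0 => j _; exact: sqr_ge0.
have K0 : 0 < K.
  rewrite /K (bigD1 ord_max) //= ltr_pwDl //; first by rewrite exprn_gt0 // ltr0n.
  by apply: sumr_ge0 => i _; exact: sqr_ge0.
have sq k e : \sum_(i < n.+1) (d i * k - e * i%:R) ^+ 2 =
  k ^+ 2 * \sum_i d i ^+ 2 - 2 * k * e * (\sum_(i < n.+1) i%:R * d i) + e ^+ 2 * K.
  rewrite !mulr_sumr -sumrB -big_split /=; apply: eq_bigr => i _; ring.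
(* Cauchy-Schwarz for the vectors d and (i), as a sum of squares. With f as the coefficient, the
   lower bound [fd] leaves f^2 <= K times the sum of the d_i^2. *)
have : 0 <= K * (K * \sum_i d i ^+ 2 - 2 * f * (\sum_(i < n.+1) i%:R * d i) + f ^+ 2).
  have -> : K * (K * \sum_i d i ^+ 2 - 2 * f * (\sum_(i < n.+1) i%:R * d i) + f ^+ 2)
    = \sum_(i < n.+1) (d i * K - f * i%:R) ^+ 2 by rewrite sq; ring.
  by apply: sumr_ge0 => i _; exact: sqr_ge0.
rewrite pmulr_rge0 // => H.
have KS : K * \sum_i d i ^+ 2 <= K * S by rewrite ler_pM2l.
have ff : 2 * f ^+ 2 <= 2 * f * (\sum_(i < n.+1) i%:R * d i).
  by rewrite -mulrA ler_pM2l // expr2 ler_wpM2l.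
lra.
Qed.

(** By Schur's theorem X is lower triangular in some frame unitary for H; its diagonal consists of
    eigenvalues, which vanish. Both traces are independent of the frame. *)
Lemma nilpotent_commutator n (H X : 'M[C]_n.+1) : (0 < n)%N -> posdef H ->
  X ^+ n.+1 = 0 ->
  forall D, D = X *m dag H X - dag H X *m X ->
  \tr (X *m dag H X) ^+ 2 <= (\sum_(i < n.+1) i%:R ^+ 2) * \tr (D *m D).
Proof.
move=> n0 Hp Xn D DX.
have [V Vu HV] := posdef_factor Hp.
have [Q QU Qt] := @Schur _ _ (V *m X *m invmx V) (ltn0Sn n).
have Qu := unitarymx_unit QU.
have QQ : adj Q *m Q = 1%:M.
  by apply: mulmx1C; move/unitarymxP: QU; rewrite -map_trmx.
pose W := Q *m V.
have Wu : W \in unitmx by rewrite unitmx_mul Qu.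
have HW : H = adj W *m W.
  by rewrite /W adjM !mulmxA -(mulmxA _ (adj Q)) QQ mulmx1.
pose Y := W *m X *m invmx W.
have Yt : is_trig_mx Y.
  have <- : conjmx Q (V *m X *m invmx V) = Y; last exact: Qt.
  by rewrite /conjmx /Y /W (pinvmxE Qu) (invmxM Qu Vu) !mulmxA.
have Yn : Y ^+ n.+1 = 0.
  suff Yk k : Y ^+ k = W *m X ^+ k *m invmx W by rewrite Yk Xn mulmx0 mul0mx.
  elim: k => [|k IH]; first by rewrite !expr0 mulmx1 mulmxV.
  by rewrite !exprS IH -[_ * _]/(_ *m _) -[X * _]/(_ *m _) conj_mul.
have Y0 (i j : 'I_n.+1) : (i <= j)%N -> Y i j = 0.
  rewrite leq_eqVlt => /orP[/eqP/val_inj <-|]; last by move/is_trig_mxP : Yt; apply.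
  have : eigenvalue Y (Y i i).
    rewrite eigenvalue_root_char char_poly_trig // rootE horner_prod (bigD1 i) //=.
    by rewrite hornerXsubC subrr mul0r.
  case/eigenvalueP => v vE v0.
  have vk k : v *m Y ^+ k = (Y i i) ^+ k *: v.
    elim: k => [|k IH]; first by rewrite !expr0 mulmx1 scale1r.
    by rewrite exprS -[Y * _]/(_ *m _) mulmxA vE -scalemxAl IH scalerA -exprS.
  have := vk n.+1; rewrite Yn mulmx0 => /esym/eqP; rewrite scaler_eq0 (negPf v0) orbF expf_eq0 /=.
  by move/eqP.
have YD : W *m dag H X *m invmx W = adj Y by rewrite dag_factor.
pose D' := Y *m adj Y - adj Y *m Y.
have := strict_trig_commutator n0 Y0 (erefl D').
have DE : W *m D *m invmx W = D'.
  have A : W *m (X *m dag H X) *m invmx W = Y *m adj Y.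
    by rewrite (conj_mul _ _ Wu) YD.
  have B : W *m (dag H X *m X) *m invmx W = adj Y *m Y.
    by rewrite (conj_mul _ _ Wu) YD.
  by rewrite DX mulmxBr mulmxBl A B.
have aD' : adj D' = D' by exact: adj_commutator.
rewrite aD' -DE -(conj_mul _ _ Wu) (tr_conj _ Wu) -YD /Y -(conj_mul _ _ Wu) (tr_conj _ Wu).
exact.
Qed.
End HermitianAlgebra.

(** * Matrix-valued functions *)

Section MatrixCalculus.
Variable R : realType.
Local Notation C := R[i].

Lemma isW_sum (I : Type) (r : seq I) (F : I -> C -> C) t (P Q : I -> C) :
  (forall i, isW (F i) t (P i) (Q i)) ->
  isW (fun s => \sum_(i <- r) F i s) t (\sum_(i <- r) P i) (\sum_(i <- r) Q i).
Proof.
move=> H; elim: r => [|i r IH].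
  rewrite !big_nil; under eq_fun do rewrite big_nil; exact: isW_cst.
rewrite !big_cons; under eq_fun do rewrite big_cons.
exact: isWD.
Qed.

Definition mxW m n (A : C -> 'M[C]_(m, n)) t (P Q : 'M[C]_(m, n)) :=
  forall k l, isW (fun s => A s k l) t (P k l) (Q k l).

Lemma mxW_mul m n p (A : C -> 'M[C]_(m, n)) (B : C -> 'M[C]_(n, p)) t P Q P' Q' :
  mxW A t P Q -> mxW B t P' Q' ->
  mxW (fun s => A s *m B s) t (P *m B t + A t *m P') (Q *m B t + A t *m Q').
Proof.
move=> HA HB k l; under eq_fun do rewrite mxE.
rewrite !mxE -!big_split /=.
by apply: isW_sum => j; exact: isWM.
Qed.

Lemma mxWD m n (A B : C -> 'M[C]_(m, n)) t P Q P' Q' :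
  mxW A t P Q -> mxW B t P' Q' -> mxW (fun s => A s + B s) t (P + P') (Q + Q').
Proof.
move=> HA HB k l; under eq_fun do rewrite mxE.
by rewrite !mxE; exact: isWD.
Qed.

Lemma mxWZ m n c (A : C -> 'M[C]_(m, n)) t P Q :
  mxW A t P Q -> mxW (fun s => c *: A s) t (c *: P) (c *: Q).
Proof.
move=> HA k l; under eq_fun do rewrite mxE; rewrite !mxE.
by apply: isW_eq (isWM (isW_cst c t) (HA k l)) _ _; rewrite mul0r add0r.
Qed.

Lemma mxWN m n (A : C -> 'M[C]_(m, n)) t P Q :
  mxW A t P Q -> mxW (fun s => - A s) t (- P) (- Q).
Proof.
move=> /(mxWZ (-1)); rewrite !scaleN1r; congr (mxW _ t _ _).
by apply/funext => s; rewrite scaleN1r.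
Qed.

Lemma mxW_adj m n (A : C -> 'M[C]_(m, n)) t P Q :
  mxW A t P Q -> mxW (fun s => adj (A s)) t (adj Q) (adj P).
Proof.
by move=> HA k l; under eq_fun do rewrite !mxE; rewrite !mxE; exact: isWJ.
Qed.

Lemma mxW_eq m n (A : C -> 'M[C]_(m, n)) t P Q P' Q' :
  mxW A t P Q -> P = P' -> Q = Q' -> mxW A t P' Q'.
Proof. by move=> H <- <-. Qed.

Lemma mxW_unique m n (A : C -> 'M[C]_(m, n)) t P Q P' Q' :
  mxW A t P Q -> mxW A t P' Q' -> P = P' /\ Q = Q'.
Proof.
by move=> HA HB; split; apply/matrixP => k l; have [] := isW_unique (HA k l) (HB k l).
Qed.

Lemma mxW_near m n (A B : C -> 'M[C]_(m, n)) (t : C) P Q :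
  (\forall s \near (t : C^o), A s = B s) -> mxW A t P Q -> mxW B t P Q.
Proof.
move=> E HA k l; apply: isW_near (HA k l).
by move: E; apply: filterS => s ->.
Qed.

Lemma isW_tr n (A : C -> 'M[C]_n) t P Q : mxW A t P Q ->
  isW (fun s => \tr (A s)) t (\tr P) (\tr Q).
Proof. by move=> HA; rewrite /mxtrace; apply: isW_sum => i; exact: HA. Qed.

Lemma mxW_dmx n (A : C -> 'M[C]_n) t P Q : mxW A t P Q ->
  dmx_t A t = P /\ dmx_tbar A t = Q.
Proof.
move=> HA; split; apply/matrixP => k l; rewrite mxE.
  exact: isW_dt (HA k l).
exact: isW_dtb (HA k l).
Qed.

Section Gen.
Variables (U : set C) (oU : open (U : set C^o)).

Lemma gen_isW f t : gen U f -> U t -> isW f t (d_t f t) (d_tbar f t).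
Proof. by move=> /(gen_is_smooth oU) sf Ut; exact: smooth_isW sf Ut. Qed.

Lemma gen_dt f : gen U f -> gen U (d_t f).
Proof.
move=> gf; have sf := gen_is_smooth oU gf.
have s1 : smooth U (pderive 1 f) by move=> k; have [_ H _] := sf k.+1; exact: H.
have s2 : smooth U (pderive (0 +i* 1) f) by move=> k; have [_ _ H] := sf k.+1; exact: H.
rewrite /d_t; apply: gen_mul (gen_cst _ _).
apply: gen_add; first exact: gen_smooth.
apply: (gen_eq (f := fun t => (- (0 +i* 1)) * pderive (0 +i* 1) f t)).
  by move=> t _; rewrite mulNr.
by apply: gen_mul; [exact: gen_cst|exact: gen_smooth].
Qed.

Lemma gen_opp f : gen U f -> gen U (fun t => - f t).
Proof.
move=> gf; apply: (gen_eq (f := fun t => (- 1) * f t)) => [t _|].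
  by rewrite mulN1r.
by apply: gen_mul; [exact: gen_cst|].
Qed.

Lemma gen_sum (I : Type) (r : seq I) (F : I -> C -> C) :
  (forall i, gen U (F i)) -> gen U (fun t => \sum_(i <- r) F i t).
Proof.
move=> H; elim: r => [|i r IH].
  by under eq_fun do rewrite big_nil; exact: gen_cst.
by under eq_fun do rewrite big_cons; exact: gen_add.
Qed.

Lemma gen_prod (I : Type) (r : seq I) (F : I -> C -> C) :
  (forall i, gen U (F i)) -> gen U (fun t => \prod_(i <- r) F i t).
Proof.
move=> H; elim: r => [|i r IH].
  by under eq_fun do rewrite big_nil; exact: gen_cst.
by under eq_fun do rewrite big_cons; exact: gen_mul.
Qed.

Definition mxgen m n (A : C -> 'M[C]_(m, n)) := forall k l, gen U (fun t => A t k l).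

Lemma mxgen_mxW n (A : C -> 'M[C]_n) t : mxgen A -> U t ->
  mxW A t (dmx_t A t) (dmx_tbar A t).
Proof. by move=> gA Ut k l; rewrite !mxE; exact: gen_isW. Qed.

Lemma mxgen_mul m n p (A : C -> 'M[C]_(m, n)) (B : C -> 'M[C]_(n, p)) :
  mxgen A -> mxgen B -> mxgen (fun t => A t *m B t).
Proof.
move=> gA gB k l; under eq_fun do rewrite mxE.
by apply: gen_sum => j; exact: gen_mul.
Qed.

Lemma mxgen_adj m n (A : C -> 'M[C]_(m, n)) : mxgen A -> mxgen (fun t => adj (A t)).
Proof. by move=> gA k l; under eq_fun do rewrite !mxE; exact: gen_conj. Qed.

Lemma mxgen_det n (A : C -> 'M[C]_n) : mxgen A -> gen U (fun t => \det (A t)).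
Proof.
move=> gA; rewrite /determinant; apply: gen_sum => s.
by apply: gen_mul; [exact: gen_cst|apply: gen_prod => i; exact: gA].
Qed.

Lemma mxgen_inv n (A : C -> 'M[C]_n) : (forall t, U t -> A t \in unitmx) ->
  mxgen A -> mxgen (fun t => invmx (A t)).
Proof.
move=> Au gA k l.
apply: (gen_eq (f := fun t => (\det (A t))^-1 * cofactor (A t) l k)).
  by move=> t Ut; rewrite /invmx Au // !mxE.
apply: gen_mul.
  apply: gen_inv (mxgen_det gA) => t Ut.
  by have := Au t Ut; rewrite unitmxE unitfE.
rewrite /cofactor; apply: gen_mul; first exact: gen_cst.
by apply: mxgen_det => a b; under eq_fun do rewrite !mxE; exact: gA.
Qed.

Lemma mxgen_dt n (A : C -> 'M[C]_n) : mxgen A -> mxgen (dmx_t A).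
Proof. by move=> gA k l; under eq_fun do rewrite mxE; exact: gen_dt. Qed.

Definition mxholo m n (A : C -> 'M[C]_(m, n)) := forall k l, holomorphic U (fun t => A t k l).

Lemma mxholo_gen m n (A : C -> 'M[C]_(m, n)) : mxholo A -> mxgen A.
Proof. by move=> hA k l; apply: gen_smooth; have [] := hA k l. Qed.

Lemma mxholo_mul m n p (A : C -> 'M[C]_(m, n)) (B : C -> 'M[C]_(n, p)) :
  mxholo A -> mxholo B -> mxholo (fun t => A t *m B t).
Proof.
move=> gA gB k l; under eq_fun do rewrite mxE.
by apply: (holo_sum oU) => j _; exact: holoM.
Qed.

Lemma mxholo_cst m n (A : 'M[C]_(m, n)) : mxholo (fun=> A).
Proof. by move=> k l; exact: holo_cst. Qed.

Lemma mxholo_tr m n (A : C -> 'M[C]_(m, n)) : mxholo A -> mxholo (fun t => (A t)^T).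
Proof. by move=> hA k l; under eq_fun do rewrite mxE; exact: hA. Qed.

Lemma mxholo_eq m n (A B : C -> 'M[C]_(m, n)) : (forall t, U t -> A t = B t) ->
  mxholo A -> mxholo B.
Proof. by move=> E hA k l; apply: (holo_eq oU _ (hA k l)) => t Ut; rewrite E. Qed.

Lemma mxholo_W n (A : C -> 'M[C]_n) t : mxholo A -> U t -> mxW A t (dmx_t A t) 0.
Proof.
move=> hA Ut; apply: mxW_eq (mxgen_mxW (mxholo_gen hA) Ut) erefl _.
by apply/matrixP => k l; rewrite !mxE; have [_] := hA k l; apply.
Qed.

Lemma mxholo_dt n (A : C -> 'M[C]_n) : mxholo A -> mxholo (dmx_t A).
Proof. by move=> hA k l; under eq_fun do rewrite mxE; exact: holo_dt. Qed.

End Gen.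

(* Local data of a tt*-structure in a holomorphic frame; the last hypothesis is the
   flatness for lambda = 1 and lambda = -1. *)
Lemma mxtraceB n (X Y : 'M[C]_n) : \tr (X - Y) = \tr X - \tr Y.
Proof. exact: linearB. Qed.

Lemma tr_cyc n (X Y Z : 'M[C]_n) : \tr (X *m (Y *m Z)) = \tr (Z *m X *m Y).
Proof. by rewrite mulmxA mxtrace_mulC mulmxA. Qed.

(** With F = dP and dQ = [Q, A], the left side is the derivative of tr (P Q); cyclicity of the trace
    moves the connection form A onto P, leaving the covariant derivative of P. *)
Lemma tr_covariant n (F A P Q : 'M[C]_n) :
  \tr (F *m Q + P *m (Q *m A - A *m Q)) = \tr ((F + A *m P - P *m A) *m Q).
Proof.
rewrite mulmxBr mulmxBl mulmxDl [RHS]mxtraceB mxtraceD.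
by rewrite [X in _ + X]mxtraceB [in RHS]mxtraceD tr_cyc !mulmxA addrA.
Qed.

Lemma tr_commutator n (D P Q : 'M[C]_n) : D = P *m Q - Q *m P ->
  \tr ((D *m P - P *m D) *m Q) = \tr (D *m D).
Proof.
move=> DE; rewrite {4}DE mulmxBl mulmxBr !mxtraceB !mulmxA; congr (_ - _).
by rewrite -[LHS]mxtrace_mulC mulmxA mxtrace_mulC mulmxA.
Qed.

Lemma tr_dag_square n (K X Y : 'M[C]_n) a :
  \tr ((X + a *: Y) *m dag K (X + a *: Y)) =
  \tr (X *m dag K X) + conjc a * \tr (X *m dag K Y) +
  (a * \tr (Y *m dag K X) + a * (conjc a * \tr (Y *m dag K Y))).
Proof.
rewrite dagD dagZ; move: (dag K X) (dag K Y) => X' Y'.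
rewrite mulmxDl !mulmxDr !mxtraceD -!scalemxAr -!scalemxAl !mxtraceZ.
by rewrite mulrCA.
Qed.

Lemma tr_dag_conj n (K X Y : 'M[C]_n) : posdef K ->
  conjc (\tr (X *m dag K Y)) = \tr (Y *m dag K X).
Proof. by move=> Kp; rewrite -(tr_dag Kp) (dagM Kp) (dagK Kp). Qed.

(** Cauchy-Schwarz, |x|^2 <= z e, read off from |E + a phi|^2 >= 0 at its minimum a = - x / z. Here
    e = |E|^2, z = |phi|^2, and x and y are the two mixed traces of E and phi. *)
Lemma bochner_ineq (e x y z d q a : C) : a = - x / z -> y = conjc x ->
  conjc z = z -> 0 < z ->
  0 <= e + conjc a * x + (a * y + a * (conjc a * z)) ->
  q = d + e -> z * d + x * conjc x <= z * q.
Proof.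
move=> -> -> zJ z0.
have -> : conjc (- x / z) = - conjc x / z.
  by rewrite -[in RHS]zJ -conjc_inv -rmorphN -rmorphM.
move=> H0 ->.
rewrite -subr_ge0.
suff -> : z * (d + e) - (z * d + x * conjc x) =
  z * (e + - conjc x / z * x + (- x / z * conjc x + - x / z * (- conjc x / z * z))).
  by apply: mulr_ge0 => //; exact: ltW.
by field; rewrite gt_eqF.
Qed.

(** * The Bochner inequality in a holomorphic frame *)

Section Local.
Variables (n : nat) (U : set C) (H phi : C -> 'M[C]_n.+1).
Hypotheses (oU : open (U : set C^o)) (Hg : mxgen U H) (phih : mxholo U phi)
  (Hp : forall t, U t -> posdef (H t)).

Let A t := invmx (H t) *m dmx_t H t.
Let psi t := dag (H t) (phi t).
Hypothesis flat : forall lambda : C, lambda = 1 \/ lambda = -1 -> forall t, U t ->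
  dmx_t (fun s => lambda *: psi s) t - dmx_tbar (fun s => A s + lambda^-1 *: phi s) t
  + (A t + lambda^-1 *: phi t) *m (lambda *: psi t)
  - (lambda *: psi t) *m (A t + lambda^-1 *: phi t) = 0.

Lemma Hinv_gen : mxgen U (fun t => invmx (H t)).
Proof. by apply: mxgen_inv => // t Ut; exact: posdef_unit (Hp Ut). Qed.

Lemma A_gen : mxgen U A.
Proof. by apply: mxgen_mul; [exact: Hinv_gen|exact: mxgen_dt]. Qed.

Lemma psi_gen : mxgen U psi.
Proof.
apply: mxgen_mul => //; apply: mxgen_mul; first exact: Hinv_gen.
by apply: mxgen_adj; exact: mxholo_gen.
Qed.

(** Since H is Hermitian, its d_tbar derivative is the adjoint of d_t H = H A. *)
Lemma HW t : U t -> mxW H t (H t *m A t) (adj (A t) *m H t).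
Proof.
move=> Ut; have K0 := mxgen_mxW oU Hg Ut.
have E : H t *m A t = dmx_t H t by rewrite /A mulKVmx // posdef_unit //; exact: Hp.
rewrite E; apply: (mxW_eq K0 erefl).
have K' : mxW H t (adj (dmx_tbar H t)) (adj (dmx_t H t)).
  apply: mxW_near (mxW_adj K0); apply: (open_near_eq oU _ Ut) => s Us.
  by have [] := Hp Us.
have [_ ->] := mxW_unique K0 K'.
by rewrite -E adjM; have [-> _] := Hp Ut.
Qed.

(** As phi is holomorphic, the curvature is lambda times the covariant d_t derivative of psi plus a
    term free of lambda, the tt*-equation. The values lambda = 1 and lambda = -1 separate the
    two. *)
Lemma flat_eqs t : U t ->
  mxW A t (dmx_t A t) (phi t *m psi t - psi t *m phi t) /\
  mxW psi t (psi t *m A t - A t *m psi t) (dmx_tbar psi t).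
Proof.
move=> Ut.
have AW := mxgen_mxW oU A_gen Ut; have pW := mxgen_mxW oU psi_gen Ut.
have fW := mxholo_W oU phih Ut.
have E (l : C) : l = 1 \/ l = -1 ->
  l *: (dmx_t psi t + A t *m psi t - psi t *m A t) +
  (phi t *m psi t - psi t *m phi t - dmx_tbar A t) = 0.
  move=> l1; have l0 : l != 0 by case: l1 => ->; rewrite ?oppr_eq0 oner_eq0.
  rewrite -[RHS](flat l1 Ut).
  have [-> _] := mxW_dmx (mxWZ l pW).
  have [_ ->] := mxW_dmx (mxWD AW (mxWZ l^-1 fW)).
  rewrite scaler0 addr0 mulmxDl mulmxDr -!scalemxAr -!scalemxAl !scalerA.
  rewrite divff // mulVf // !scale1r.
  move: (dmx_t psi t) (dmx_tbar A t) (A t *m psi t) (psi t *m A t) => X1 X2 X3 X4.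
  move: (phi t *m psi t) (psi t *m phi t) => X5 X6.
  by apply/matrixP => i j; rewrite !mxE; ring.
have E1 := E 1 (or_introl erefl); have E2 := E (-1) (or_intror erefl).
move: E1 E2; rewrite scale1r scaleN1r.
move: (dmx_t psi t) (dmx_tbar A t) AW pW => X1 X2 AW pW E1 E2.
have two0 : (2%:R : C) != 0 by rewrite pnatr_eq0.
have F1 : X1 + A t *m psi t - psi t *m A t = 0.
  apply: (scalerI two0); rewrite scaler0 -[RHS](subrr 0) -{1}E1 -E2.
  move: (A t *m psi t) (psi t *m A t) (phi t *m psi t) (psi t *m phi t) => X3 X4 X5 X6.
  by apply/matrixP => i j; rewrite !mxE; ring.
split.
  apply: mxW_eq AW erefl _; apply/eqP; rewrite eq_sym -subr_eq0.
  by move: E1; rewrite F1 add0r => ->.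
apply: mxW_eq pW _ erefl; apply/eqP; rewrite -subr_eq0 -[X in _ == X]F1.
by rewrite opprB addrA.
Qed.

(** The covariant derivative of phi for the Chern connection; the next function is the squared norm
    of phi. *)
Let E t := dmx_t phi t + A t *m phi t - phi t *m A t.
Let f t := \tr (phi t *m psi t).

(** Differentiate H psi = adj phi H along tbar. In other words, the Chern connection commutes with
    taking adjoints. *)
Lemma psi_dtb t : U t -> dmx_tbar psi t = dag (H t) (E t).
Proof.
move=> Ut; have Hu := posdef_unit (Hp Ut).
have [_ pW] := flat_eqs Ut; have fW := mxholo_W oU phih Ut.
have HpE s : U s -> H s *m psi s = adj (phi s) *m H s.
  by move=> Us; rewrite /psi /dag !mulmxA mulmxV ?mul1mx // posdef_unit //; exact: Hp.
have W1 := mxW_near (open_near_eq oU HpE Ut) (mxW_mul (HW Ut) pW).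
have W2 := mxW_mul (mxW_adj fW) (HW Ut).
have [_ e] := mxW_unique W1 W2.
have {e} e : H t *m dmx_tbar psi t =
    adj (dmx_t phi t) *m H t + adj (phi t) *m (adj (A t) *m H t) - adj (A t) *m (adj (phi t) *m H t).
  by rewrite -e -(HpE t Ut) [X in X - _]addrC mulmxA addrK.
rewrite /dag -mulmxA; apply: (canRL (mulKmx Hu)).
by rewrite e /E !adjD adjN !adjM !mulmxDl mulNmx !mulmxA.
Qed.

Lemma f_isW t : U t -> isW f t (\tr (E t *m psi t)) (\tr (phi t *m dag (H t) (E t))).
Proof.
move=> Ut; have [_ pW] := flat_eqs Ut; have fW := mxholo_W oU phih Ut.
apply: isW_eq (isW_tr (mxW_mul fW pW)) _ _; last by rewrite mul0mx add0r psi_dtb.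
exact: tr_covariant.
Qed.

(** By the tt*-equation d_tbar E = [D0, phi], where D0 = [phi, psi]. Differentiating d_t f = tr (E
    psi) gives d_tbar d_t f = tr (D0 D0) + |E|^2, and Cauchy-Schwarz replaces f |E|^2 by |d_t
    f|^2. *)
Lemma bochner t : U t -> 0 < f t -> exists p q f1,
  [/\ isW f t f1 (conjc f1), isW (d_t f) t p q &
    forall D, D = phi t *m psi t - psi t *m phi t ->
    f t * \tr (D *m D) + f1 * conjc f1 <= f t * q].
Proof.
move=> Ut f0.
have [AW pW] := flat_eqs Ut; have fW := mxholo_W oU phih Ut.
have f'W := mxholo_W oU (mxholo_dt oU phih) Ut.
pose D0 := phi t *m psi t - psi t *m phi t.
rewrite (psi_dtb Ut) in pW.
have EW : mxW E t (dmx_t (dmx_t phi) t + (dmx_t A t *m phi t + A t *m dmx_t phi t) -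
    (dmx_t phi t *m A t + phi t *m dmx_t A t)) (D0 *m phi t - phi t *m D0).
  apply: mxW_eq (mxWD (mxWD f'W (mxW_mul AW fW)) (mxWN (mxW_mul fW AW))) erefl _.
  by rewrite !mulmx0 mul0mx addr0 !add0r.
have f1J : conjc (\tr (E t *m psi t)) = \tr (phi t *m dag (H t) (E t)).
  exact: tr_dag_conj (Hp Ut).
have FW := isW_tr (mxW_mul EW pW).
set q := \tr _ in FW; set p := \tr _ in FW.
exists q, p, (\tr (E t *m psi t)); split.
- by rewrite f1J; exact: f_isW.
- apply: isW_near FW; apply: (open_near_eq oU _ Ut) => s Us.
  by have := isW_dt (f_isW Us).
move=> D DE; have {DE}-> : D = D0 by [].
have qE : p = \tr (D0 *m D0) + \tr (E t *m dag (H t) (E t)).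
  rewrite /p mxtraceD; congr (_ + _).
  exact: tr_commutator.
have fJ : conjc (f t) = f t := tr_dag_conj (phi t) (phi t) (Hp Ut).
have Q0 := tr_dag_ge0 (Hp Ut) (E t + (- (\tr (E t *m psi t)) / f t) *: phi t).
exact (bochner_ineq erefl (esym f1J) fJ f0
  (eq_ind _ (fun z => 0 <= z) Q0 _ (tr_dag_square _ _ _ _)) qE).
Qed.

End Local.
End MatrixCalculus.

(** * Radial functions *)

Section Radial.
Variable R : realType.
Local Notation C := R[i].
Local Notation Re := complex.Re.
Local Notation Im := complex.Im.

Lemma is_derive_eqP (f : R -> R) (x d d' : R) :
  is_derive (x : R^o) (1 : R^o) (f : R^o -> R^o) d -> d = d' ->
  is_derive (x : R^o) (1 : R^o) (f : R^o -> R^o) d'.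
Proof. by move=> H <-. Qed.

Lemma is_derive_unique (f : R -> R) (x d d' : R) :
  is_derive (x : R^o) (1 : R^o) (f : R^o -> R^o) d ->
  is_derive (x : R^o) (1 : R^o) (f : R^o -> R^o) d' -> d = d'.
Proof. by case=> _ <- [_ <-]. Qed.

Lemma is_derive_rho (r h : R) : 0 < r ->
  is_derive (h : R^o) (1 : R^o) ((fun h => Num.sqrt (r ^+ 2 + h ^+ 2)) : R^o -> R^o)
    (h / Num.sqrt (r ^+ 2 + h ^+ 2)).
Proof.
move=> r0; have p0 : 0 < r ^+ 2 + h ^+ 2 by rewrite ltr_pwDl ?sqr_ge0 // exprn_gt0.
have A := @is_deriveD R R^o R^o (cst (r ^+ 2)) (fun s => s ^+ 2) h 1 0 _
     (is_derive_cst _ _ _) (@is_deriveX R R^o id 2 h 1 1 (is_derive_id _ _)).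
have B := @is_derive1_comp R Num.sqrt _ h _ _ (is_derive1_sqrt p0) A.
apply: is_derive_eqP B _.
rewrite /= expr1 add0r -![_ *: _]/(_ * _); field.
by rewrite gt_eqF // sqrtr_gt0.
Qed.

Lemma line_derive (f : C -> C) (t v : C) (x : R) : pderivable v f (t + x%:C * v) ->
  cder (fun h => f (t + h%:C * v)) x (pderive v f (t + x%:C * v)).
Proof.
move=> /pderivable_pder A; apply: cder_shift; move: A; rewrite /pder.
under eq_fun => h do rewrite -addrA -mulrDl -rmorphD.
by [].
Qed.

Lemma real_line_derive (f : C -> C) (x : R) : pderivable 1 f x%:C ->
  is_derive (x : R^o) (1 : R^o) ((fun h => Re (f h%:C)) : R^o -> R^o) (Re (pderive 1 f x%:C)).
Proof.
move=> A; have := @line_derive f 0 1 x; rewrite add0r mulr1 => /(_ A)[].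
by under eq_fun => h do rewrite add0r mulr1.
Qed.

Lemma wirtinger_laplace (a b c d : C) :
  ((a + (0 +i* 1) * b) / 2%:R + (- (0 +i* 1)) * ((c + (0 +i* 1) * d) / 2%:R)) / 2%:R =
  (a + (0 +i* 1) * (b - c) - ((0 +i* 1) * (0 +i* 1)) * d) * (4^-1)%:C.
Proof.
have -> : (4^-1 : R)%:C = 2%:R^-1 * 2%:R^-1 :> C.
  by rewrite fmorphV -invfM -natrM rmorph_nat.
by ring.
Qed.

Section RadialFunction.
Variable f : C -> C.
Hypotheses (sf : smooth Cstar f) (rf : forall t, t != 0 -> f t = f (normc t)%:C).

Let f_x := pderive 1 f.
Let f_y := pderive (0 +i* 1) f.

Lemma smooth_pd (U : set C) (g : C -> C) t : smooth U g -> U t ->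
  pderivable 1 g t /\ pderivable (0 +i* 1) g t.
Proof. by move=> sg; have [H _ _] := sg 1%N; apply: H. Qed.

Lemma smooth_x (U : set C) (g : C -> C) : smooth U g -> smooth U (pderive 1 g).
Proof. by move=> sg k; have [_ H _] := sg k.+1; exact: H. Qed.

Lemma smooth_y (U : set C) (g : C -> C) : smooth U g -> smooth U (pderive (0 +i* 1) g).
Proof. by move=> sg k; have [_ _ H] := sg k.+1; exact: H. Qed.

Let p (r h : R) : C := r%:C + h%:C * (0 +i* 1).
Let rho (r h : R) := Num.sqrt (r ^+ 2 + h ^+ 2).

Lemma p_neq0 r h : 0 < r -> p r h != 0.
Proof.
move=> r0; apply/eqP => /(congr1 (fun z : C => Re z)); rewrite /p !reE /= !(mul0r, mulr0, subr0, addr0).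
by move=> E; rewrite E ltxx in r0.
Qed.

Lemma fp_rho r h : 0 < r -> f (p r h) = f (rho r h)%:C.
Proof.
move=> r0; rewrite rf ?p_neq0 //; congr (f _%:C).
by rewrite /p /rho /= !(mul0r, mulr0, mulr1, subr0, addr0, add0r, oppr0).
Qed.

Lemma rho_gt0 r h : 0 < r -> 0 < rho r h.
Proof. by move=> r0; rewrite sqrtr_gt0 ltr_pwDl ?sqr_ge0 // exprn_gt0. Qed.

Lemma realC_neq0 (x : R) : 0 < x -> x%:C != 0.
Proof. by move=> x0; rewrite realC_eq0 gt_eqF. Qed.

(** On the vertical line through r the function is its restriction to the positive axis composed
    with h -> sqrt (r^2 + h^2); the chain rule does the rest. *)
Lemma radial_fy r h : 0 < r ->
  Re (f_y (p r h)) = Re (f_x (rho r h)%:C) * (h / rho r h).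
Proof.
move=> r0; have [_ dy] := smooth_pd sf (p_neq0 h r0).
have [A _] := @line_derive f r%:C (0 +i* 1) h dy.
have [dx _] := smooth_pd sf (realC_neq0 (rho_gt0 h r0)).
have B := @is_derive1_comp R _ _ h _ _ (real_line_derive dx) (is_derive_rho h r0).
apply: (is_derive_unique A).
move: B; congr (is_derive _ _ _ _); apply/funext => k /=.
by rewrite -fp_rho.
Qed.

(** At h = 0 only the factor h of f_y = h F'(rho) / rho contributes to the derivative. *)
Lemma radial_fyy r : 0 < r ->
  Re (pderive (0 +i* 1) f_y r%:C) = Re (f_x r%:C) / r.
Proof.
move=> r0; have sy := smooth_y sf; have sx := smooth_x sf.
have pr : p r 0 = r%:C by rewrite /p mul0r addr0.
have rr : rho r 0 = r by rewrite /rho expr0n addr0 sqrtr_sqr gtr0_norm.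
have [_ dy] := smooth_pd sy (p_neq0 0 r0).
have [A _] := @line_derive f_y r%:C (0 +i* 1) 0 dy.
rewrite -[_ + _]/(p r 0) pr in A.
have [dx _] := smooth_pd sx (realC_neq0 (rho_gt0 0 r0)).
have B := @is_derive1_comp R _ _ 0 _ _ (real_line_derive dx) (is_derive_rho 0 r0).
have n0 : rho r 0 != 0 by rewrite gt_eqF // rho_gt0.
have V := @is_deriveV R (rho r) 0 _ 1 n0 (is_derive_rho 0 r0).
have M := @is_deriveM R R^o _ _ 0 1 _ _ (is_derive_id (0 : R^o) (1 : R^o)) (@is_deriveM R R^o _ _ 0 1 _ _ B V).
apply: (is_derive_unique A).
have E : (fun k : R => Re (f_y (p r k))) =
    (id * (fun k => Re (f_x (rho r k)%:C) * (rho r k)^-1))%R.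
  apply/funext => k; rewrite radial_fy //.
  by rewrite -[RHS]/(_ * (_ * _)) mulrCA mulrA.
rewrite -[X in is_derive _ _ X _]/(fun k : R => Re (f_y (p r k))) E.
apply: is_derive_eqP M _.
rewrite [X in X + _](mul0r _) add0r -[LHS]/(Re (f_x (rho r 0)%:C) * (rho r 0)^-1 * 1).
by rewrite rr mulr1.
Qed.

(* P(s) = f(e^s) e^2s contradicts [blow_up]. *)
Lemma no_radial_bochner (k : R) : 0 < k -> (forall t, t != 0 -> 0 < f t) ->
  (forall r, 0 < r -> exists p q f1, [/\ isW f r%:C f1 (conjc f1), isW (d_t f) r%:C p q &
     k%:C * f r%:C ^+ 3 + f1 * conjc f1 <= f r%:C * q]) -> False.
Proof.
move=> k0 f0 H.
pose F (x : R) := Re (f x%:C); pose F1 (x : R) := Re (f_x x%:C).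
pose F2 (x : R) := Re (pderive 1 f_x x%:C).
have sx := smooth_x sf; have sy := smooth_y sf.
have dF x : 0 < x -> is_derive (x : R^o) (1 : R^o) (F : R^o -> R^o) (F1 x).
  by move=> x0; apply: real_line_derive; exact: (smooth_pd sf (realC_neq0 x0)).1.
have dF1 x : 0 < x -> is_derive (x : R^o) (1 : R^o) (F1 : R^o -> R^o) (F2 x).
  by move=> x0; apply: real_line_derive; exact: (smooth_pd sx (realC_neq0 x0)).1.
(* At a real point f1 = F' / 2 and Re q is a quarter of the radial Laplacian F'' + F' / r; the
   factor 4 clears both denominators. *)
have ineq r : 0 < r -> 4 * k * F r ^+ 3 <= F r * (F2 r + F1 r / r) - F1 r ^+ 2.
  move=> r0; have [a [q [f1 [W1 W2 L]]]] := H r r0.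
  have n0 := realC_neq0 r0.
  have fr : f r%:C = (F r)%:C.
    by have := f0 _ n0; rewrite ltcE => /andP[/eqP i0 _]; apply: eqC.
  have [/pder_pderive e1 /pder_pderive e2] := W1.
  have Ef1 : f1 = (F1 r / 2)%:C.
    have E1 : Re f1 = F1 r / 2.
      by rewrite /F1 /f_x e1 !reE; field.
    have E2 : Im f1 = 0.
      have := radial_fy 0 r0; rewrite mul0r mulr0 /p mul0r addr0 /f_y e2 !reE /=.
      by lra.
    by apply: eqC; rewrite ?E1 ?E2.
  have Eq : Re q = (F2 r + F1 r / r) / 4.
    have Edt : Re (d_tbar (d_t f) r%:C) = (F2 r + Re (pderive (0 +i* 1) f_y r%:C)) / 4.
      have Wx := smooth_isW sx n0; have Wy := smooth_isW sy n0.
      have W : isW (d_t f) r%:C ((d_t f_x r%:C + (- (0 +i* 1)) * d_t f_y r%:C) * 2%:R^-1)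
          ((d_tbar f_x r%:C + (- (0 +i* 1)) * d_tbar f_y r%:C) * 2%:R^-1).
        have -> : d_t f = (fun s => (f_x s + (- (0 +i* 1)) * f_y s) * 2%:R^-1).
          by apply/funext => s; rewrite /d_t mulNr.
        apply: isW_eq (isWM (isWD Wx (isWM (isW_cst _ _) Wy)) (isW_cst _ _)) _ _.
          by rewrite mulr0 addr0 mul0r add0r.
        by rewrite mulr0 addr0 mul0r add0r.
      rewrite (isW_dtb W) /d_tbar -/f_x -/f_y.
      rewrite wirtinger_laplace.
      have S : pderive (0 +i* 1) f_x r%:C = pderive 1 f_y r%:C := pderive_swap (@open_Cstar R) sf n0.
      rewrite S i2 /F2.
      move: (pderive 1 f_x r%:C) (pderive 1 f_y r%:C) (pderive (0 +i* 1) f_y r%:C) => x1 x3 x4.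
      by rewrite subrr mulr0 addr0 mulN1r opprK !reE /= mulr0 subr0.
    by rewrite -(isW_dtb W2) Edt radial_fyy.
  move: L; rewrite fr Ef1 conjc_real -rmorphXn -!rmorphM -rmorphD lecE => /andP[_].
  rewrite !reE /= mul0r subr0 Eq.
  move: (F1 r / r) (F1 r) (F2 r) (F r) => x1 x2 x3 x4; nra.
have F0 x : 0 < x -> 0 < F x.
  by move=> x0; have := f0 _ (realC_neq0 x0); rewrite ltcE => /andP[].
have dE (s : R) : is_derive (s : R^o) (1 : R^o) (@expR R : R^o -> R^o) (expR s).
  exact: is_derive_expR.
have e0 (s : R) : 0 < expR s by exact: expR_gt0.
have dE2 (s : R) : is_derive (s : R^o) (1 : R^o) ((fun s => expR s ^+ 2) : R^o -> R^o)
    (2 * expR s ^+ 2).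
  apply: is_derive_eqP (@is_deriveX R R^o (@expR R) 2 s 1 _ (dE s)) _.
  rewrite /= -[_ *: _]/(_ * _); ring.
have dE3 (s : R) : is_derive (s : R^o) (1 : R^o) ((fun s => expR s ^+ 3) : R^o -> R^o)
    (3 * expR s ^+ 3).
  apply: is_derive_eqP (@is_deriveX R R^o (@expR R) 3 s 1 _ (dE s)) _.
  rewrite /= -[_ *: _]/(_ * _); ring.
have dFE (s : R) := @is_derive1_comp R F _ s _ _ (dF _ (e0 s)) (dE s).
have dF1E (s : R) := @is_derive1_comp R F1 _ s _ _ (dF1 _ (e0 s)) (dE s).
(* The factor e^(2s) is log-linear, so (log P)'' = (log F(e^s))'', while it absorbs the r^2 that
   appears on passing to s = log r. Multiplying [ineq] by e^(6s) then gives the hypothesis of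
   [blow_up]. *)
pose P s := F (expR s) * expR s ^+ 2.
pose P1 s := F1 (expR s) * expR s ^+ 3 + 2 * (F (expR s) * expR s ^+ 2).
pose P2 s := F2 (expR s) * expR s ^+ 4 + 5 * (F1 (expR s) * expR s ^+ 3) + 4 * (F (expR s) * expR s ^+ 2).
have dP (s : R) : is_derive (s : R^o) (1 : R^o) (P : R^o -> R^o) (P1 s).
  apply: is_derive_eqP (@is_deriveM R R^o _ _ s 1 _ _ (dFE s) (dE2 s)) _.
  rewrite /= -![_ *: _]/(_ * _) /P1; ring.
have dP1 (s : R) : is_derive (s : R^o) (1 : R^o) (P1 : R^o -> R^o) (P2 s).
  have A := @is_deriveM R R^o _ _ s 1 _ _ (dF1E s) (dE3 s).
  have B := @is_deriveZ R R^o R^o P 2 s 1 _ (dP s).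
  apply: is_derive_eqP (@is_deriveD R R^o R^o _ _ s 1 _ _ A B) _.
  rewrite /= -![_ *: _]/(_ * _) /P1 /P2; ring.
apply: (@blow_up R P P1 P2 (4 * k)) => // [|s|s]; first by rewrite mulr_gt0.
  by rewrite /P mulr_gt0 ?F0 // exprn_gt0.
have E0 := e0 s; have := ineq _ E0; rewrite /P /P1 /P2.
move: (expR s) E0 => E E0.
have n0 : E != 0 by rewrite gt_eqF.
rewrite -(ler_pM2r (exprn_gt0 6 E0)) => H1.
have -> : 4 * k * (F E * E ^+ 2) ^+ 3 = 4 * k * F E ^+ 3 * E ^+ 6 by ring.
apply: le_trans H1 _; rewrite le_eqVlt; apply/orP; left; apply/eqP.
by field.
Qed.

End RadialFunction.
End Radial.

(** * The cyclic symmetry in charts *)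

Section Charts.
Variable R : realType.
Local Notation C := R[i].

Section LinearProp.
Variables (V W : lmodType C) (f : V -> W).
Hypothesis fl : linear f.
Lemma lin_0 : f 0 = 0.
Proof. by have := fl (-1) 0 0; rewrite !scaleN1r oppr0 addr0 addNr. Qed.
Lemma lin_D u v : f (u + v) = f u + f v.
Proof. by have := fl 1 u v; rewrite !scale1r. Qed.
Lemma lin_Z a u : f (a *: u) = a *: f u.
Proof. by have := fl a u 0; rewrite lin_0 !addr0. Qed.
Lemma lin_sum (I : Type) (r : seq I) (F : I -> V) :
  f (\sum_(i <- r) F i) = \sum_(i <- r) f (F i).
Proof. by elim: r => [|i r IH]; rewrite ?big_nil ?lin_0 // !big_cons lin_D IH. Qed.
End LinearProp.

Section ScalarProp.
Variables (V : lmodType C) (f : V -> C).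
Hypothesis fl : scalar f.
Lemma sca_0 : f 0 = 0.
Proof. by have := fl (-1) 0 0; rewrite !scaleN1r oppr0 addr0 mulN1r addNr. Qed.
Lemma sca_D u v : f (u + v) = f u + f v.
Proof. by have := fl 1 u v; rewrite scale1r mul1r. Qed.
Lemma sca_Z a u : f (a *: u) = a * f u.
Proof. by have := fl a u 0; rewrite sca_0 !addr0. Qed.
Lemma sca_sum (I : Type) (r : seq I) (F : I -> V) :
  f (\sum_(i <- r) F i) = \sum_(i <- r) f (F i).
Proof. by elim: r => [|i r IH]; rewrite ?big_nil ?sca_0 // !big_cons sca_D IH. Qed.
End ScalarProp.

Section Bundle.
Variables (r : nat) (B : bundle R r) (hB : holo_bundle B).

Section AtPoint.
Variables (i : chart B) (t : C).
Hypothesis it : dom i t.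

Lemma loc_lin : linear (loc i t : 'cV[C]_r -> fib B t). Proof. exact: hb_lin. Qed.

Lemma crd_lin : linear (crd i t : fib B t -> 'cV[C]_r).
Proof.
move=> a u v; apply: (can_inj (hb_locK hB it)).
by rewrite (hb_crdK hB it) loc_lin !(hb_crdK hB it).
Qed.

Lemma crd_frame l : crd i t (frame i t l) = delta_mx l 0.
Proof. exact: (hb_locK hB it). Qed.

Lemma frame_sum (a : fib B t) : a = \sum_l crd i t a l 0 *: frame i t l.
Proof.
rewrite -[LHS](hb_crdK hB it) {1}[crd i t a]matrix_sum_delta.
rewrite (lin_sum loc_lin); apply: eq_bigr => l _.
by rewrite big_ord1 (lin_Z loc_lin).
Qed.

Lemma crd_inj (a b : fib B t) : crd i t a = crd i t b -> a = b.
Proof. exact: (can_inj (hb_crdK hB it)). Qed.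

Lemma lin_mx m (h : fib B t -> 'cV[C]_m) : linear h -> forall a,
  h a = (\matrix_(k, l) h (frame i t l) k 0) *m crd i t a.
Proof.
move=> hl a; rewrite {1}[a]frame_sum (lin_sum hl); apply/matrixP => k z.
rewrite ord1 summxE !mxE; apply: eq_bigr => l _.
by rewrite (lin_Z hl) !mxE mulrC.
Qed.
End AtPoint.

End Bundle.

Section TTStar.
Variables (n : nat) (D : ttdata R n.+1) (tt : is_ttstar D).
Let hB := tt_bundle tt.

Definition ph t : fib D t -> fib D t := tt_Phi 1.

Section AtPoint.
Variables (i : chart D) (t : C).
Hypothesis it : dom i t.
Let t0 : Cstar t. Proof. exact: (hb_sub hB it). Qed.

Lemma ph_lin : linear (@ph t). Proof. exact: (Phi_linear tt). Qed.

Lemma crd_ph a : crd i t (ph a) = Phi_mx i t *m crd i t a.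
Proof.
apply: (lin_mx hB it (h := fun a => crd i t (ph a))) => c u v.
by rewrite ph_lin (crd_lin hB it).
Qed.

Lemma eta_crd (a b : fib D t) :
  tt_eta a b = ((crd i t a)^T *m eta_mx i t *m crd i t b) 0 0.
Proof.
rewrite {1}(frame_sum hB it a) {1}(frame_sum hB it b).
rewrite (sca_sum (eta_scalar tt t0 _)) !mxE; apply: eq_bigr => l _.
rewrite (sca_Z (eta_scalar tt t0 _)) mulrC; congr (_ * _).
rewrite (eta_sym tt t0) (sca_sum (eta_scalar tt t0 _)) !mxE; apply: eq_bigr => k _.
by rewrite (sca_Z (eta_scalar tt t0 _)) (eta_sym tt t0) !mxE.
Qed.

Lemma met_crd (a b : fib D t) :
  tt_met a b = (adj (crd i t a) *m met_mx i t *m crd i t b) 0 0.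
Proof.
rewrite {1}(frame_sum hB it a) {1}(frame_sum hB it b).
rewrite (sca_sum (met_scalar tt t0 _)) !mxE; apply: eq_bigr => l _.
rewrite (sca_Z (met_scalar tt t0 _)) mulrC; congr (_ * _).
rewrite (met_herm tt t0) (sca_sum (met_scalar tt t0 _)) !mxE rmorph_sum; apply: eq_bigr => k _.
rewrite (sca_Z (met_scalar tt t0 _)) rmorphM; rewrite !mxE; congr (_ * _).
by rewrite [RHS](met_herm tt t0).
Qed.

Lemma met_posdef : posdef (met_mx i t).
Proof.
split.
  by apply/matrixP => k l; rewrite !mxE [RHS](met_herm tt t0).
move=> v v0; have -> : v = crd i t (loc i t v) by rewrite (hb_locK hB it).
rewrite -met_crd; apply: (met_pos tt t0); apply: contra_neq v0 => E.
by rewrite -[v](hb_locK hB it) E (lin_0 (crd_lin hB it)).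
Qed.

Lemma bilin_ext m p (M M' : 'M[C]_(m, p)) :
  (forall (u : 'cV[C]_m) (v : 'cV[C]_p), (u^T *m M *m v) 0 0 = (u^T *m M' *m v) 0 0 :> C) -> M = M'.
Proof.
move=> H; apply/matrixP => k l; have := H (delta_mx k 0) (delta_mx l 0).
by rewrite trmx_delta -!rowE -!colE !mxE.
Qed.

Lemma crd_surj v : exists a : fib D t, v = crd i t a.
Proof. by exists (loc i t v); rewrite (hb_locK hB it). Qed.

Lemma eta_ph : (Phi_mx i t)^T *m eta_mx i t = eta_mx i t *m Phi_mx i t.
Proof.
apply: bilin_ext => u v; have [a ->] := crd_surj u; have [b ->] := crd_surj v.
rewrite !mulmxA -trmx_mul -crd_ph -(mulmxA _ (Phi_mx i t) (crd i t b)) -crd_ph -!eta_crd.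
exact: (Phi_selfadj tt t0).
Qed.

Lemma ph_iter k a : crd i t (iter k (@ph t) a) = Phi_mx i t ^+ k *m crd i t a.
Proof.
elim: k => [|k IH] /=; first by rewrite expr0 mul1mx.
by rewrite crd_ph IH exprS -mulmxA.
Qed.
End AtPoint.

Lemma met_gen (i : chart D) : mxgen (dom i) (met_mx i).
Proof. by move=> k l; apply: gen_smooth; exact: (met_smooth tt). Qed.

Lemma Phi_mxholo (i : chart D) : mxholo (dom i) (Phi_mx i).
Proof. by move=> k l; exact: (Phi_holo tt). Qed.

Lemma eta_mxholo (i : chart D) : mxholo (dom i) (eta_mx i).
Proof. by move=> k l; exact: (eta_holo tt). Qed.

Lemma chart_flat (i : chart D) (lambda : C) : lambda = 1 \/ lambda = -1 ->
  forall t, dom i t ->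
  dmx_t (fun s => lambda *: dag (met_mx i s) (Phi_mx i s)) t -
  dmx_tbar (fun s => invmx (met_mx i s) *m dmx_t (met_mx i) s + lambda^-1 *: Phi_mx i s) t
  + (invmx (met_mx i t) *m dmx_t (met_mx i) t + lambda^-1 *: Phi_mx i t) *m (lambda *: dag (met_mx i t) (Phi_mx i t))
  - (lambda *: dag (met_mx i t) (Phi_mx i t)) *m (invmx (met_mx i t) *m dmx_t (met_mx i) t + lambda^-1 *: Phi_mx i t) = 0.
Proof.
move=> l1 t it; have l0 : `|lambda| = 1 by case: l1 => ->; rewrite ?normrN normr1.
exact: (tt_flat tt l0 it).
Qed.

End TTStar.
End Charts.

(** * Linear algebra of a pair with sg phi = w phi sg *)

Section CyclicSymmetry.
Variable (F : fieldType) (n : nat).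
Local Notation N := n.+1.
Variables (w : F) (sg phi : 'M[F]_N).
Hypotheses (w_prim : N.-primitive_root w) (sgu : sg \in unitmx)
  (sgphi : sg *m phi = w *: (phi *m sg)).

Let w0 : w != 0.
Proof.
apply/eqP => E; have := prim_expr_order w_prim.
by rewrite E expr0n /= => /eqP; rewrite eq_sym oner_eq0.
Qed.

(** Conjugation by sg turns phi into phi / w, so w X - phi is w times a conjugate of X - phi, and
    the determinant picks up w^N = 1. *)
Lemma char_poly_cyclic : char_poly phi \Po (w *: 'X) = char_poly phi.
Proof.
pose P (A : 'M[F]_N) := map_mx polyC A.
have sgu' : P sg \in unitmx by rewrite map_unitmx.
rewrite -[LHS]/(comp_poly (w *: 'X) _) /char_poly -det_map_mx.
have -> : map_mx (comp_poly (w *: 'X)) (char_poly_mx phi) =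
    w%:P *: (invmx (P sg) *m char_poly_mx phi *m P sg).
  rewrite /char_poly_mx mulmxBr mulmxBl scalar_mxC mulmxKV // scalerBr.
  have -> : invmx (P sg) *m P phi *m P sg = w^-1%:P *: P phi.
    have K : P phi *m P sg = w^-1%:P *: (P sg *m P phi).
      by rewrite /P -!map_mxM sgphi map_mxZ scalerA -polyCM mulVf // scale1r.
    by rewrite -mulmxA K -scalemxAr mulKmx.
  rewrite scalerA -polyCM divff // scale1r.
  apply/matrixP => i j; rewrite !mxE; case: (i == j); rewrite ?mulr1n ?mulr0n.
    by rewrite rmorphB /= comp_polyX comp_polyC mul_polyC.
  by rewrite rmorphB /= !rmorph0 comp_polyC mulr0.
rewrite detZ !det_mulmx mulrAC -det_mulmx mulVmx // det1 mul1r.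
by rewrite -rmorphXn prim_expr_order // mul1r.
Qed.

Lemma char_poly_coef k : (0 < k < N)%N -> (char_poly phi)`_k = 0.
Proof.
move=> /andP[k0 kN].
have : (char_poly phi \Po (w *: 'X))`_k = (char_poly phi)`_k * w ^+ k.
  rewrite comp_polyE coef_sum; under eq_bigr => i _ do
    rewrite exprZn scalerA coefZ coefXn.
  rewrite size_char_poly (bigD1 (Ordinal (ltnW kN : (k < N.+1)%N))) //= eqxx mulr1 big1 ?addr0 // => i.
  by rewrite -val_eqE /= eq_sym => /negPf ->; rewrite mulr0.
rewrite char_poly_cyclic => /eqP; rewrite -[X in X == _]mulr1 -subr_eq0 -mulrBr mulf_eq0.
case/orP=> [/eqP //|]; rewrite subr_eq0 eq_sym => /eqP wk.
have := prim_order_dvd w_prim k; rewrite wk eqxx => dv.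
by have := dvdn_leq k0 dv; rewrite leqNgt kN.
Qed.

(** Only the leading and the constant coefficient of the characteristic polynomial survive;
    Cayley-Hamilton then gives the scalar. *)
Lemma cyclic_power : exists c, phi ^+ N = c%:M.
Proof.
exists (- (char_poly phi)`_0).
have p_eq : char_poly phi = 'X^N + ((char_poly phi)`_0)%:P.
  apply/polyP => k; rewrite coefD coefXn coefC.
  case: (ltngtP k N) => kN.
  - case: (posnP k) => [->|k0]; first by rewrite add0r.
    by rewrite char_poly_coef ?k0 // addr0.
  - by rewrite nth_default ?size_char_poly // add0r; case: k kN.
  - rewrite kN addr0; have := char_poly_monic phi.
    by rewrite monicE lead_coefE size_char_poly => /eqP.
have := Cayley_Hamilton phi; rewrite {1}p_eq rmorphD /= rmorphXn /= horner_mx_X horner_mx_C.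
by move/eqP; rewrite addr_eq0 => /eqP ->; rewrite raddfN.
Qed.

Lemma sg_pow k : sg *m phi ^+ k = w ^+ k *: (phi ^+ k *m sg).
Proof.
elim: k => [|k IH]; first by rewrite !expr0 mulmx1 mul1mx scale1r.
rewrite !exprS -[phi * _]/(_ *m _) mulmxA sgphi -scalemxAl -mulmxA IH -scalemxAr scalerA.
by rewrite mulmxA.
Qed.

Lemma trace_pow k : (0 < k < N)%N -> \tr (phi ^+ k) = 0.
Proof.
move=> /andP[k0 kN].
have : \tr (phi ^+ k) = w ^+ k * \tr (phi ^+ k).
  rewrite -{1}[phi ^+ k](mulKmx sgu) sg_pow -scalemxAr mxtraceZ; congr (_ * _).
  by rewrite mxtrace_mulC -mulmxA mulmxV // mulmx1.
move/eqP; rewrite -[X in X == _]mul1r -subr_eq0 -mulrBl mulf_eq0 => /orP[|/eqP //].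
rewrite subr_eq0 eq_sym => /eqP wk.
have := prim_order_dvd w_prim k; rewrite wk eqxx => dv.
by have := dvdn_leq k0 dv; rewrite leqNgt kN.
Qed.

Hypothesis phiN : phi ^+ N = 1%:M.
Hypothesis N0 : N%:R != 0 :> F.

(* Projection onto the eigenline of phi for the eigenvalue 1. *)
Definition line_proj : 'M[F]_N := N%:R^-1 *: \sum_(k < N) phi ^+ k.

(** Its trace is 1, the identity being the only power in the sum with non-zero trace. *)
Lemma line_proj_neq0 : line_proj != 0.
Proof.
apply/eqP => E; have : \tr line_proj = 1.
  rewrite /line_proj mxtraceZ raddf_sum /= big_ord_recl expr0 mxtrace1 big1 ?addr0 ?mulVf //.
  by move=> k _; rewrite lift0 trace_pow //= ltnS.
by rewrite E mxtrace0 => /eqP; rewrite eq_sym oner_eq0.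
Qed.

Lemma phi_line_proj : phi *m line_proj = line_proj.
Proof.
rewrite /line_proj -scalemxAr mulmx_sumr; congr (_ *: _).
under eq_bigr do rewrite -[_ *m _]/(_ * _) -exprS.
by rewrite big_ord_recr [RHS]big_ord_recl /= phiN expr0 addrC.
Qed.

Lemma line_proj_id (a : 'cV[F]_N) : phi *m a = a -> line_proj *m a = a.
Proof.
move=> Ha; rewrite /line_proj -scalemxAl mulmx_suml.
under eq_bigr => k _.
  have -> : phi ^+ k *m a = a.
    elim: (val k) => [|j IH]; first by rewrite expr0 mul1mx.
    by rewrite exprSr -[_ * phi]/(_ *m _) -mulmxA Ha.
  over.
by rewrite sumr_const card_ord -scaler_nat scalerA mulVf // scale1r.
Qed.

Lemma eigen_sg (a : 'cV[F]_N) k : phi *m a = a ->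
  phi *m (sg ^+ k *m a) = w ^- k *: (sg ^+ k *m a).
Proof.
move=> Ha; elim: k => [|k IH]; first by rewrite !expr0 mul1mx invr1 scale1r.
rewrite exprS -[sg * _]/(_ *m _) -mulmxA mulmxA.
have -> : phi *m sg = w^-1 *: (sg *m phi) by rewrite sgphi scalerA mulVf // scale1r.
by rewrite -scalemxAl -mulmxA IH -scalemxAr scalerA -invfM -exprS mulmxA.
Qed.

(** The vectors sg^k a are eigenvectors for the N distinct values w^-k, so N non-zero eigenspaces
    share a space of dimension N and each is a line. Transposes appear because [eigenspace] consists
    of row vectors. *)
Lemma eigenline_unique (a b : 'cV[F]_N) : a != 0 -> phi *m a = a -> phi *m b = b ->
  exists x, b = x *: a.
Proof.
move=> a0 Ha Hb.
pose E (k : 'I_N) := eigenspace phi^T (w ^- k).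
have ak k : (sg ^+ k *m a)^T != 0.
  rewrite -trmx0 (inj_eq trmx_inj); apply: contra_neq a0 => E0.
  elim: k E0 => [|k IH]; first by rewrite expr0 mul1mx.
  rewrite exprS -[sg * _]/(_ *m _) -mulmxA => E0; apply: IH.
  by rewrite -[LHS](mulKmx sgu) E0 mulmx0.
have inE k (v : 'cV[F]_N) : phi *m v = w ^- k *: v -> (v^T <= eigenspace phi^T (w ^- k))%MS.
  by move=> Hv; apply/eigenspaceP; rewrite -trmx_mul Hv linearZ.
have E1 k : (0 < \rank (E k))%N.
  have := mxrankS (inE k _ (eigen_sg k Ha)).
  by rewrite rank_rV ak.
have inj : {in predT &, injective (fun k : 'I_N => w ^- k)}.
  move=> i j _ _ /invr_inj /eqP; rewrite (eq_prim_root_expr w_prim) !modn_small //.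
  by move/eqP/val_inj.
have /mxdirectP /= dE := mxdirect_sum_eigenspace phi^T inj.
have sumE : (\sum_k \rank (E k) <= N)%N by rewrite -dE rank_leq_col.
have r1 : \rank (E ord0) = 1%N.
  apply/eqP; rewrite eqn_leq E1 andbT.
  have : (\rank (E ord0) + n <= \sum_k \rank (E k))%N.
    rewrite (bigD1 ord0) //= leq_add2l.
    apply: (@leq_trans (\sum_(k < N | k != ord0) 1)%N).
      by rewrite sum1_card cardC1 card_ord.
    by apply: leq_sum => k _; exact: E1.
  by move/leq_trans/(_ sumE); rewrite -[leqRHS]addn1 addnC leq_add2l.
have aE : (a^T <= E ord0)%MS by apply: inE; rewrite invr1 scale1r.
have bE : (b^T <= E ord0)%MS by apply: inE; rewrite invr1 scale1r.
have Ea : (E ord0 <= a^T)%MS.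
  have [_ <-] := mxrank_leqif_sup aE; rewrite r1 rank_rV.
  by have := ak 0%N; rewrite expr0 mul1mx => ->.
have /sub_rVP[x Hx] := submx_trans bE Ea.
by exists x; apply: trmx_inj; rewrite Hx linearZ.
Qed.
End CyclicSymmetry.

Section Omega.
Variables (R : realType) (n : nat).
Local Notation N := n.+1.
Definition omega : R[i] := cexp (0 +i* (2%:R * pi / N%:R)).

Lemma omegaE : omega = cis (- (2%:R * pi / N%:R)).
Proof. by rewrite /omega /cis; congr cexp; apply: eqC; rewrite !reE /= ?oppr0 ?opprK. Qed.

Lemma cisX (y : R) k : cis y ^+ k = cis (y *+ k).
Proof. by elim: k => [|k IH]; rewrite ?expr0 ?mulr0n ?cis0 // exprS IH mulrS cisD. Qed.

Lemma omega_prim : N.-primitive_root omega.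
Proof.
have N0 : (0 : R) < N%:R by rewrite ltr0n.
apply/andP; split=> //; apply/forallP => k; rewrite unity_rootE omegaE cisX.
apply/eqP; apply/idP/idP => [/eqP|].
  have -> : - (2%:R * pi / N%:R) *+ k.+1 = - ((2%:R * pi) * (k.+1%:R / N%:R)) :> R.
    by rewrite mulNrn -mulr_natr; congr (- _); ring.
  rewrite cisE => -[+ _]; rewrite cosN => c1.
  have p0 : 0 < 2%:R * pi :> R by rewrite mulr_gt0 // pi_gt0.
  have [|m] := cos_eq1 _ c1; first by rewrite mulr_ge0 ?divr_ge0 // ltW.
  rewrite -[RHS]mulr_natr => /(mulfI (lt0r_neq0 p0)) E.
  have : k.+1%:R = (m * N)%:R :> R by rewrite natrM -E divfK ?gt_eqF.
  move/eqP; rewrite eqr_nat => /eqP kE.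
  by rewrite eqn_leq ltn_ord /= dvdn_leq // kE dvdn_mull.
move=> /eqP ->; have -> : - (2%:R * pi / N%:R) *+ N = - (2%:R * pi) :> R.
  by rewrite mulNrn -[X in - X]mulr_natr divfK ?gt_eqF.
by rewrite cisE cosN sinN mulr_natl cos2pi sin2pi !oppr0.
Qed.
End Omega.

(** * The isomorphisms S and T_y in charts *)

Section Structure.
Variable R : realType.
Local Notation C := R[i].
Local Notation Re := complex.Re.
Local Notation Im := complex.Im.
Variables (n : nat) (D : ttdata R n.+1) (tt : is_ttstar D).
Local Notation N := n.+1.
Let hB := tt_bundle tt.
Local Notation w := (omega R n).

Lemma nonzero_vector t : Cstar t -> exists a : fib D t, a != 0.
Proof.
move=> t0; have [i it] := hb_cover hB t0.
exists (frame i t 0); apply/eqP => /(congr1 (crd i t)).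
rewrite (crd_frame hB it) (lin_0 (crd_lin hB it)) => /matrixP/(_ 0 0)/eqP.
by rewrite !mxE !eqxx oner_eq0.
Qed.

Section Rotation.
Variable T : forall (y : R) (t : C), fib D (cexp (0 +i* y) * t) -> fib D t.
Hypothesis T_iso : forall y : R,
  @is_iso R N (scale_Phi (cexp (- (0 +i* y))) (pullback (0 +i* y) D)) D (@T y).

(* [rot y t a] is the point T_y (a), in the fibre over e^{-iy} t. *)
Definition rot y t (a : fib D t) : fib D (cis y * t) :=
  T (eq_rect t (fun s => fib D s : Type) a _ (cexpNK (0 +i* y) t)).

Lemma Cstar_cis y (t : C) : Cstar t -> Cstar (cis y * t).
Proof. by move=> t0; rewrite /Cstar /= mulf_neq0 // cis_neq0. Qed.

Section Cast.
Variables (t s : C) (e : t = s).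
Let cast (a : fib D t) := eq_rect t (fun s => fib D s : Type) a s e.
(** The points t and e^z (e^-z t) agree only up to a proved equation, along which vectors are
    transported; transport preserves all of the structure. *)
Lemma cast_eta a b : tt_eta (cast a) (cast b) = tt_eta a b.
Proof. by rewrite /cast; case: s / e. Qed.
Lemma cast_met a b : tt_met (cast a) (cast b) = tt_met a b.
Proof. by rewrite /cast; case: s / e. Qed.
Lemma cast_ph a : ph (cast a) = cast (ph a).
Proof. by rewrite /cast; case: s / e. Qed.
Lemma cast_lin : linear (cast : fib D t -> fib D s).
Proof. by rewrite /cast; case: s / e. Qed.
Lemma cast_crd i a : crd i s (cast a) = crd i t a.
Proof. by rewrite /cast; case: s / e. Qed.
Lemma cast_inj : injective cast.
Proof. by rewrite /cast; case: s / e. Qed.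
End Cast.

Section AtPoint.
Variables (y : R) (t : C).
Hypothesis t0 : Cstar t.

Lemma rot_lin : linear (@rot y t : fib D t -> fib D (cis y * t)).
Proof.
move=> a u v; rewrite /rot cast_lin; exact: (iso_linear (T_iso y) (Cstar_cis y t0)).
Qed.

Lemma rot_eta a b : tt_eta (@rot y t a) (@rot y t b) = tt_eta a b.
Proof.
rewrite -[RHS](cast_eta (cexpNK (0 +i* y) t)).
exact: (iso_eta (T_iso y) (Cstar_cis y t0)).
Qed.

Lemma rot_met a b : tt_met (@rot y t a) (@rot y t b) = tt_met a b.
Proof.
rewrite -[RHS](cast_met (cexpNK (0 +i* y) t)).
exact: (iso_met (T_iso y) (Cstar_cis y t0)).
Qed.

Lemma rot_inj : injective (@rot y t).
Proof.
move=> a b /(bij_inj (iso_bij (T_iso y) (Cstar_cis y t0))).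
exact: cast_inj.
Qed.

(** The factor e^-z on the source cancels the differential e^z of rho_z, so the rotation commutes
    with the endomorphism Phi(d/dt) itself. *)
Lemma rot_ph a : @rot y t (ph a) = ph (@rot y t a).
Proof.
rewrite /rot -cast_ph.
set b := eq_rect _ _ _ _ _.
apply: etrans (iso_Phi (T_iso y) (Cstar_cis y t0) 1 b).
congr (@T y _ _); rewrite /= mulr1.
rewrite (Phi_form tt _ (cexp (0 +i* y))); last by rewrite -cexpNK.
rewrite scalerA -[X in X *: _](_ : 1 = _) ?scale1r //.
by have := cexpNK (- (0 +i* y)) 1; rewrite opprK !mulr1.
Qed.
End AtPoint.

Definition rot_mx (i j : chart D) y (s : C) : 'M[C]_N :=
  \matrix_(k, l) crd j s (@T y s (@frame R N (pullback_bundle (0 +i* y) D) i s l)) k 0.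

Lemma rot_crd (i j : chart D) y t a : Cstar t -> dom i t ->
  dom j (cis y * t) ->
  crd j (cis y * t) (@rot y t a) = rot_mx i j y (cis y * t) *m crd i t a.
Proof.
move=> t0 it jt.
have it' : dom i (cexp (0 +i* y) * (cis y * t)) by rewrite -cexpNK.
rewrite -(cast_crd (cexpNK (0 +i* y) t)).
apply: (lin_mx hB it' (h := fun b => crd j (cis y * t) (@T y (cis y * t) b))) => c u v.
have Tl := iso_linear (T_iso y) (Cstar_cis y t0).
by rewrite (Tl c u v) (crd_lin hB jt).
Qed.

Lemma rot_mx_holo (i j : chart D) y :
  mxholo ([set s | dom i (cexp (0 +i* y) * s)] `&` dom j) (rot_mx i j y).
Proof.
move=> k l; under [X in holomorphic _ X]eq_fun do rewrite mxE.
exact: (iso_holo (T_iso y)).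
Qed.

End Rotation.

Section Symmetry.
Variable S : forall t, fib D t -> fib D t.
Hypothesis S_iso : @is_iso R N D (scale_Phi w D) S.

Definition sg_mx (i : chart D) t : 'M[C]_N :=
  \matrix_(k, l) crd i t (S (frame i t l)) k 0.

Lemma mx_ext m p (M M' : 'M[C]_(m, p)) :
  (forall v : 'cV[C]_p, M *m v = M' *m v) -> M = M'.
Proof.
move=> H; apply/matrixP => k l; have := H (delta_mx l 0).
by rewrite -!colE => /matrixP/(_ k 0); rewrite !mxE.
Qed.

Lemma S_ph t a : Cstar t -> S (ph a) = w *: ph (@S t a).
Proof. by move=> t0; exact: (iso_Phi S_iso t0). Qed.

Lemma S_lin t : Cstar t -> linear (@S t : fib D t -> fib D t).
Proof. by move=> t0 c u v; exact: (iso_linear S_iso t0). Qed.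

Lemma S_eta t (a b : fib D t) : Cstar t -> tt_eta (S a) (S b) = tt_eta a b.
Proof. by move=> t0; exact: (iso_eta S_iso t0). Qed.

Lemma S_met t (a b : fib D t) : Cstar t -> tt_met (S a) (S b) = tt_met a b.
Proof. by move=> t0; exact: (iso_met S_iso t0). Qed.

Lemma S_inj t : Cstar t -> injective (@S t).
Proof. by move=> t0; exact: (bij_inj (iso_bij S_iso t0)). Qed.

Lemma sg_holo (i : chart D) : mxholo (dom i) (sg_mx i).
Proof.
move=> k l; under [X in holomorphic _ X]eq_fun do rewrite mxE.
by have := iso_holo S_iso i i k l; rewrite setIid.
Qed.

Section AtPoint.
Variables (i : chart D) (t : C).
Hypothesis it : dom i t.
Let t0 : Cstar t. Proof. exact: (hb_sub hB it). Qed.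

Lemma crd_S a : crd i t (S a) = sg_mx i t *m crd i t a.
Proof.
apply: (lin_mx hB it (h := fun a => crd i t (S a))) => c u v.
by rewrite (S_lin t0) (crd_lin hB it).
Qed.

Lemma sg_unit : sg_mx i t \in unitmx.
Proof.
rewrite -unitmx_tr -row_free_unit; apply: inj_row_free => v Hv.
have [a Ha] := crd_surj tt it v^T.
have : crd i t (S a) = 0.
  by rewrite crd_S -Ha -[LHS]trmxK trmx_mul trmxK Hv trmx0.
rewrite -(lin_0 (crd_lin hB it)) => /(crd_inj hB it).
rewrite -(lin_0 (S_lin t0)) => /(S_inj t0) a0.
by rewrite -[v]trmxK Ha a0 (lin_0 (crd_lin hB it)) trmx0.
Qed.

Lemma sg_phi : sg_mx i t *m Phi_mx i t = w *: (Phi_mx i t *m sg_mx i t).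
Proof.
apply: mx_ext => v; have [a ->] := crd_surj tt it v.
rewrite -mulmxA -(crd_ph tt it) -crd_S (S_ph _ t0) (lin_Z (crd_lin hB it)).
by rewrite (crd_ph tt it) crd_S -scalemxAl mulmxA.
Qed.
End AtPoint.

Lemma phN_exists : exists c : C -> C, forall t, Cstar t -> forall a : fib D t,
  iter N (@ph _ _ D t) a = c t *: a.
Proof.
have /choice[c Hc] : forall t, exists c : C, Cstar t -> forall a : fib D t,
    iter N (@ph _ _ D t) a = c *: a.
  move=> t; have [t0|] := pselect (Cstar t); last by exists 0.
  have [i it] := hb_cover hB t0.
  have [c Hc] := cyclic_power (omega_prim R n) (sg_unit it) (sg_phi it).
  exists c => _ a; apply: (crd_inj hB it).
  by rewrite (ph_iter tt it) Hc (lin_Z (crd_lin hB it)) mul_scalar_mx.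
by exists c.
Qed.

Section Scalar.
Variable c : C -> C.
Hypothesis Hc : forall t, Cstar t -> forall a : fib D t, iter N (@ph _ _ D t) a = c t *: a.

Lemma Phi_pow (i : chart D) t : dom i t -> Phi_mx i t ^+ N = (c t)%:M.
Proof.
move=> it; have t0 : Cstar t := hb_sub hB it.
apply: mx_ext => v; have [a ->] := crd_surj tt it v.
by rewrite -(ph_iter tt it) (Hc t0) (lin_Z (crd_lin hB it)) mul_scalar_mx.
Qed.

Lemma mxholo_pow (U : set C) (M : C -> 'M[C]_N) k : open (U : set C^o) ->
  mxholo U M -> mxholo U (fun t => M t ^+ k).
Proof.
move=> oU hM; elim: k => [|k IH].
  by apply: (mxholo_eq oU _ (mxholo_cst oU 1%:M)) => t _; rewrite expr0.
apply: (mxholo_eq oU _ (mxholo_mul oU hM IH)) => t _.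
by rewrite exprS.
Qed.

Lemma c_holo : holomorphic Cstar c.
Proof.
apply: holo_local => t t0; have [i it] := hb_cover hB t0; exists (dom i) => //.
have oi := @hb_open _ _ _ hB i.
have H := mxholo_pow N oi (Phi_mxholo tt i).
apply: (holo_eq oi _ (H 0 0)) => s si.
by rewrite (Phi_pow si) mxE eqxx mulr1n.
Qed.

Variable T : forall (y : R) (t : C), fib D (cexp (0 +i* y) * t) -> fib D t.
Hypothesis T_iso : forall y : R,
  @is_iso R N (scale_Phi (cexp (- (0 +i* y))) (pullback (0 +i* y) D)) D (@T y).

Lemma c_rot y t : Cstar t -> c (cis y * t) = c t.
Proof.
move=> t0; have [a a0] := nonzero_vector t0.
have E k : rot T y (iter k (@ph _ _ D t) a) = iter k (@ph _ _ D (cis y * t)) (rot T y a).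
  by elim: k => [//|k IH] /=; rewrite (rot_ph T_iso) // IH.
have := E N; rewrite (Hc t0) (Hc (Cstar_cis y t0)) (lin_Z (rot_lin T_iso y t0)) => /eqP.
rewrite -subr_eq0 -scalerBl scaler_eq0 => /orP[|/eqP].
  by rewrite subr_eq0 => /eqP ->.
rewrite -(lin_0 (rot_lin T_iso y t0)) => /(rot_inj T_iso t0) a00.
by rewrite a00 eqxx in a0.
Qed.

End Scalar.
End Symmetry.
End Structure.

(** * The characteristic polynomial is constant and non-zero *)

Section RadialHolomorphic.
Variable R : realType.
Local Notation C := R[i].
Local Notation Re := complex.Re.
Local Notation Im := complex.Im.

(** On the positive axis the angular derivative f_y of a radial function has real part zero, and f_y
    = i f_x. Applied to i f, the same argument handles the real part of f_x. *)
Lemma radial_holo_dx (f : C -> C) : holomorphic Cstar f ->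
  (forall t, t != 0 -> f t = f (normc t)%:C) ->
  forall r : R, 0 < r -> Im (pderive 1 f r%:C) = 0.
Proof.
move=> [sf hf] rf r r0; have n0 := realC_neq0 r0.
have := radial_fy sf rf 0 r0.
rewrite !mul0r mulr0 addr0.
have [/pder_pderive -> /pder_pderive ->] := smooth_isW sf n0.
by rewrite (hf _ n0) subr0 addr0 !reE /= mul0r sub0r mul1r => /eqP; rewrite oppr_eq0 => /eqP.
Qed.

Lemma radial_holo_const (f : C -> C) : holomorphic Cstar f ->
  (forall t, t != 0 -> f t = f (normc t)%:C) -> forall t, t != 0 -> f t = f 1.
Proof.
move=> hf rf.
have [sf hf'] := hf.
have hg : holomorphic Cstar (fun t => (0 +i* 1) * f t).
  by apply: (holoM (@open_Cstar R)) hf; exact: holo_cst (@open_Cstar R) _.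
have d0 (r : R) : 0 < r -> pderive 1 f r%:C = 0.
  move=> r0; have n0 := realC_neq0 r0.
  apply: eqC; last exact: radial_holo_dx.
  have := radial_holo_dx hg _ r0.
  have [/(_ _ n0)[/pderivable_pder A _] _ _] := sf 1%N.
  have B := pderM (pder_cst 1 (0 +i* 1) r%:C) A.
  rewrite (pder_pderive B) !reE /= !(mul0r, mul1r, add0r, addr0, subr0).
  by apply=> t t0; rewrite rf.
have cst (r s : R) : 0 < r -> r < s -> f r%:C = f s%:C.
  move=> r0 rs.
  have dRe x : r <= x <= s -> pderivable 1 f x%:C.
    move=> /andP[rx _]; have n0 := realC_neq0 (lt_le_trans r0 rx).
    exact: (smooth_pd sf n0).1.
  have p0 x : r <= x <= s -> pderive 1 f x%:C = 0.
    by move=> /andP[rx _]; apply: d0; exact: lt_le_trans rx.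
  have line x : r <= x <= s -> cder (fun h => f h%:C) x 0.
    move=> xI; have := @line_derive _ f 0 1 x; rewrite add0r mulr1 => /(_ (dRe x xI)).
    rewrite p0 //; congr (cder _ _ _); apply/funext => h.
    by rewrite add0r mulr1.
  apply: eqC.
    have [x _] := @mvt R (fun h => Re (f h%:C)) (fun=> 0) r s rs (fun x xI => (line x xI).1).
    by rewrite mul0r => /eqP; rewrite subr_eq0 eq_sym => /eqP.
  have [x _] := @mvt R (fun h => Im (f h%:C)) (fun=> 0) r s rs (fun x xI => (line x xI).2).
  by rewrite mul0r => /eqP; rewrite subr_eq0 eq_sym => /eqP.
move=> t t0; rewrite rf //; have nt := normc_gt0 t0.
have -> : (1 : C) = (1 : R)%:C by [].
case: (ltgtP (normc t) 1) => [l1|l1|->//].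
  exact: cst.
by apply/esym; exact: cst.
Qed.
End RadialHolomorphic.

Lemma tr_frame_change (F : comUnitRingType) n (M A P Q K L : 'M[F]_n) :
  M \in unitmx -> A \in unitmx ->
  \tr (invmx M *m P *m M *m (invmx M *m L *m invmx A *m (A *m (Q *m invmx A)) *m (A *m K *m M))) =
  \tr (P *m (L *m Q *m K)).
Proof.
move=> Mu Au; rewrite !mulmxA (mulmxK Mu) (mulmxKV Au) (mulmxKV Au).
by rewrite mxtrace_mulC !mulmxA (mulmxV Mu) mul1mx.
Qed.

(** * The norm of the Higgs field *)

Section HiggsNorm.
Variable R : realType.
Local Notation C := R[i].

Lemma tr_dag_invariant n (P P' H H' M : 'M[C]_n) : posdef H -> posdef H' ->
  H = adj M *m H' *m M -> P' *m M = M *m P ->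
  \tr (P *m dag H P) = \tr (P' *m dag H' P').
Proof.
move=> Hp Hp' HE PE; have Hu := posdef_unit Hp; have Hu' := posdef_unit Hp'.
have Mu : M \in unitmx.
  by move: Hu; rewrite HE unitmx_mul => /andP[].
have aMu : adj M \in unitmx by rewrite adj_unit.
have -> : P = invmx M *m P' *m M by rewrite -mulmxA PE mulKmx.
rewrite /dag HE !adjM adj_inv.
have -> : invmx (adj M *m H' *m M) = invmx M *m invmx H' *m invmx (adj M).
  by rewrite !invmxM ?unitmx_mul ?aMu ?Hu' // mulmxA.
exact: tr_frame_change.
Qed.

Lemma tr_mul_adj_gt0 n (A : 'M[C]_n) : A != 0 -> 0 < \tr (A *m adj A).
Proof.
move=> A0; rewrite lt_def tr_mul_adj_ge0 andbT; apply: contra_neq A0 => E.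
apply/matrixP => i j; rewrite mxE; apply/eqP; rewrite -normr_eq0 normCE realC_eq0.
rewrite -sqrf_eq0; move: E; rewrite tr_mul_adj => /eqP; rewrite realC_eq0.
rewrite psumr_eq0 => [/allP/(_ i (mem_index_enum _)) /=|k _]; last first.
  by apply: sumr_ge0 => l _; exact: sqr_ge0.
rewrite psumr_eq0 => [/allP/(_ j (mem_index_enum _)) //|k _].
exact: sqr_ge0.
Qed.

Lemma tr_dag_gt0 n (H X : 'M[C]_n) : posdef H -> X != 0 -> 0 < \tr (X *m dag H X).
Proof.
move=> Hp X0; have [W Wu HW] := posdef_factor Hp.
rewrite -(tr_conj _ Wu) (conj_mul _ _ Wu) (dag_factor _ Wu HW).
apply: tr_mul_adj_gt0; apply: contra_neq X0 => E.
have : W *m X = 0 by rewrite -[LHS](mulmxKV Wu) E mul0mx.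
by move=> E'; rewrite -[X](mulKmx Wu) E' mulmx0.
Qed.

Lemma sesq_ext m p (M M' : 'M[C]_(m, p)) :
  (forall (u : 'cV[C]_m) (v : 'cV[C]_p), (adj u *m M *m v) 0 0 = (adj u *m M' *m v) 0 0) -> M = M'.
Proof.
move=> H; apply: bilin_ext => u v; have := H (map_mx conjc u) v.
have -> // : adj (map_mx conjc u) = u^T.
by apply/matrixP => a b; rewrite !mxE conjcK.
Qed.

Variables (n : nat) (D : ttdata R n.+1) (tt : is_ttstar D).
Let hB := tt_bundle tt.
Local Notation N := n.+1.

Definition higgs_norm (i : chart D) t := \tr (Phi_mx i t *m dag (met_mx i t) (Phi_mx i t)).

(** Stated for an isometry between possibly different fibres, so that L = id gives independence of
    the chart and L = T_y gives rotation invariance. *)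
Lemma higgs_norm_isom (i j : chart D) t t' (L : fib D t -> fib D t') :
  dom i t -> dom j t' -> linear L -> (forall a b, tt_met (L a) (L b) = tt_met a b) ->
  (forall a, L (ph a) = ph (L a)) -> higgs_norm i t = higgs_norm j t'.
Proof.
move=> it jt Ll Lm Lp.
pose M := \matrix_(k, l) crd j t' (L (frame i t l)) k 0.
have ME a : crd j t' (L a) = M *m crd i t a.
  apply: (lin_mx hB it (h := fun a => crd j t' (L a))) => c u v.
  by rewrite Ll (crd_lin hB jt).
apply: (@tr_dag_invariant _ _ _ _ _ M (met_posdef tt it) (met_posdef tt jt)).
  apply: sesq_ext => u v; have [a ->] := crd_surj tt it u; have [b ->] := crd_surj tt it v.
  rewrite -(met_crd tt it) -Lm (met_crd tt jt) !ME adjM.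
  by rewrite !mulmxA.
apply: mx_ext => v; have [a ->] := crd_surj tt it v.
by rewrite -!mulmxA -(crd_ph tt it) -!ME -(crd_ph tt jt) Lp.
Qed.

Lemma higgs_norm_gen (i : chart D) : gen (dom i) (higgs_norm i).
Proof.
apply: gen_sum => k.
have oi := @hb_open _ _ _ hB i.
have pg := mxholo_gen (Phi_mxholo tt i).
have psig := psi_gen (met_gen tt i) (Phi_mxholo tt i) (fun t it => met_posdef tt it).
exact: (mxgen_mul pg psig k k).
Qed.

Hypothesis nv : forall t : C, Cstar t -> exists (X : C) (a : fib D t), tt_Phi X a != 0.

Lemma higgs_norm_gt0 (i : chart D) t : dom i t -> 0 < higgs_norm i t.
Proof.
move=> it; have t0 : Cstar t := hb_sub hB it.
apply: tr_dag_gt0; first exact (met_posdef tt it).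
have [X [a Xa]] := nv t0; apply: contra_neq Xa => E.
rewrite (Phi_form tt t0); have -> : tt_Phi 1 a = 0; last by rewrite scaler0.
apply: (crd_inj hB it); rewrite [LHS](crd_ph tt it) E mul0mx.
by rewrite (lin_0 (crd_lin hB it)).
Qed.

Variable T : forall (y : R) (t : C), fib D (cexp (0 +i* y) * t) -> fib D t.
Hypothesis T_iso : forall y : R,
  @is_iso R N (scale_Phi (cexp (- (0 +i* y))) (pullback (0 +i* y) D)) D (@T y).

(* The squared norm of a nilpotent Higgs field phi would be a radial function f with
   f dd^bar f - |df|^2 >= f |[phi, phi^dag]|^2 >= f^3 / K. *)
Lemma not_nilpotent : (0 < n)%N ->
  ~ (forall (i : chart D) t, dom i t -> Phi_mx i t ^+ N = 0).
Proof.
move=> n0 nil.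
have /choice[ch Hch] : forall t, exists i : chart D, Cstar t -> dom i t.
  move=> t; have [t0|t0] := pselect (Cstar t); first by have [i it] := hb_cover hB t0; exists i.
  have [i _] := hb_cover hB (oner_neq0 _ : Cstar (1 : C)).
  by exists i.
pose f t := higgs_norm (ch t) t.
have f_loc (i : chart D) t : dom i t -> f t = higgs_norm i t.
  move=> it; have t0 : Cstar t := hb_sub hB it.
  exact: (@higgs_norm_isom _ _ _ _ id (Hch t t0) it).
have sf : smooth Cstar f.
  apply: smooth_local => t t0; exists (dom (ch t)); first exact: Hch.
  apply: gen_is_smooth; first exact: (@hb_open _ _ _ hB).
  by apply: gen_eq (higgs_norm_gen (ch t)) => s si; rewrite (f_loc _ _ si).
have f_rot y t : Cstar t -> f (cis y * t) = f t.
  move=> t0; apply/esym.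
  apply: (@higgs_norm_isom _ _ _ _ (rot T y (t := t)) (Hch t t0) (Hch _ (Cstar_cis y t0))).
  - exact: rot_lin.
  - exact: rot_met.
  - by move=> a; exact: (rot_ph tt T_iso).
have rf t : t != 0 -> f t = f (normc t)%:C.
  move=> t0; have [s [y ->]] := pt_surj t0.
  by rewrite normc_pt f_rot // expR_pt; exact: pt_neq0.
have f0 t : t != 0 -> 0 < f t by move=> t0; apply: higgs_norm_gt0; exact: Hch.
pose K : R := \sum_(i < N) i%:R ^+ 2.
have K0 : 0 < K.
  rewrite /K (bigD1 ord_max) //= ltr_pwDl //; first by rewrite exprn_gt0 // ltr0n.
  by apply: sumr_ge0 => i _; exact: sqr_ge0.
apply: (no_radial_bochner sf rf (k := K^-1)) => //; first by rewrite invr_gt0.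
move=> r r0; have t0 := realC_neq0 r0.
move: (r%:C) t0 => t t0.
pose i := ch t; have it : dom i t by exact: Hch.
have oi := @hb_open _ _ _ hB i.
have fi0 := higgs_norm_gt0 it.
have [p [q [f1 [W1 W2 L]]]] := @bochner R n (dom i) (met_mx i) (Phi_mx i) oi (met_gen tt i)
  (Phi_mxholo tt i) (fun t it => met_posdef tt it) (chart_flat tt (i := i)) t it fi0.
exists p, q, f1; split.
- by apply: isW_near W1; apply: (open_near_eq oi _ it) => s si; rewrite (f_loc _ _ si).
- apply: isW_near W2; apply: (open_near_eq oi _ it) => s si.
  have sW := gen_isW oi (higgs_norm_gen i) si.
  have := isW_near (open_near_eq oi (fun u ui => esym (f_loc i u ui)) si) sW.
  by move=> H; exact (esym (isW_dt H)).
have := L _ erefl; rewrite -[\tr _ * _]/(higgs_norm i t * _) (f_loc i t it) => L'.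
(* The bound f^2 <= K tr (D D) for nilpotent matrices, multiplied by f / K, replaces f tr (D D) by
   f^3 / K. *)
apply: le_trans L'; rewrite lerD2r exprS mulrCA ler_pM2l // -(ler_pM2l (_ : 0 < K%:C)).
  rewrite mulrA -rmorphM divff ?gt_eqF // mul1r.
  have := nilpotent_commutator n0 (met_posdef tt it) (nil i t it) erefl.
  rewrite (_ : \sum_(k < N) k%:R ^+ 2 = K%:C) //.
  by rewrite rmorph_sum; apply: eq_bigr => k _; rewrite rmorphXn rmorph_nat.
by rewrite ltcR.
Qed.

End HiggsNorm.

(** * Global eigensections *)

Section Continuity.
Variable R : realType.
Local Notation C := R[i].
Local Notation Re := complex.Re.
Local Notation Im := complex.Im.

Lemma ccont_sum (I : Type) (r : seq I) (F : I -> C -> C) t :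
  (forall i, ccont (F i) t) -> ccont (fun s => \sum_(i <- r) F i s) t.
Proof.
move=> H; elim: r => [|i r IH].
  by under eq_fun do rewrite big_nil; exact: ccont_cst.
under eq_fun do rewrite big_cons.
exact: (ccontD (H i) IH).
Qed.

Definition mxcont m n (A : C -> 'M[C]_(m, n)) t := forall k l, ccont (fun s => A s k l) t.

Lemma mxcont_mul m n p (A : C -> 'M[C]_(m, n)) (B : C -> 'M[C]_(n, p)) t :
  mxcont A t -> mxcont B t -> mxcont (fun s => A s *m B s) t.
Proof.
move=> cA cB k l; under eq_fun do rewrite mxE.
by apply: ccont_sum => j; exact: ccontM.
Qed.

Lemma mxcont_tr m n (A : C -> 'M[C]_(m, n)) t : mxcont A t -> mxcont (fun s => (A s)^T) t.
Proof. by move=> cA k l; under eq_fun do rewrite mxE; exact: cA. Qed.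

Lemma mxholo_cont (U : set C) m n (A : C -> 'M[C]_(m, n)) t : mxholo U A -> U t -> mxcont A t.
Proof. by move=> hA Ut k l; exact: holo_cont (hA k l) Ut. Qed.

Lemma mxcont_near m n (A B : C -> 'M[C]_(m, n)) (t : C) :
  (\forall s \near (t : C^o), A s = B s) -> mxcont A t -> mxcont B t.
Proof.
move=> E cA k l; apply: ccont_near (cA k l).
by move: E; apply: filterS => s ->.
Qed.

(* The branch of the square root on the half-plane Re > 0. *)
Definition half_sqrt (z : C) : C :=
  Num.sqrt ((normc z + Re z) / 2) +i* (Im z / (2 * Num.sqrt ((normc z + Re z) / 2))).

Lemma half_sqrtK z : 0 < Re z -> half_sqrt z * half_sqrt z = z.
Proof.
move=> z0; rewrite /half_sqrt.
have n2 : normc z ^+ 2 = Re z ^+ 2 + Im z ^+ 2.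
  by case: (z) => x y /=; rewrite sqr_sqrtr // addr_ge0 ?sqr_ge0.
have n0 : 0 <= normc z by case: (z) => x y /=; exact: sqrtr_ge0.
have p0 : 0 < (normc z + Re z) / 2 by rewrite divr_gt0 // ltr_wpDl.
move: (sqr_sqrtr (ltW p0)); rewrite -sqrtr_gt0 in p0.
move: (Num.sqrt _) p0 => s s0 sE.
have nE : normc z = 2 * s ^+ 2 - Re z by rewrite sE; field.
have I2 : Im z ^+ 2 = 4 * s ^+ 2 * (s ^+ 2 - Re z).
  have -> : Im z ^+ 2 = normc z ^+ 2 - Re z ^+ 2 by rewrite n2; ring.
  by rewrite nE; ring.
have s00 : s != 0 by rewrite gt_eqF.
apply: eqC; rewrite !reE /=; last by field.
have -> : s * s - Im z / (2 * s) * (Im z / (2 * s)) = s ^+ 2 - Im z ^+ 2 / (4 * s ^+ 2) by field.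
by rewrite I2; field.
Qed.

Lemma half_sqrt_cont z : 0 < Re z -> ccont half_sqrt z.
Proof.
move=> z0.
have n0 : 0 <= normc z by case: (z) => x y /=; exact: sqrtr_ge0.
have p0 : 0 < (normc z + Re z) / 2 by rewrite divr_gt0 // ltr_wpDl.
have [cr ci] : ((fun x : C => Re x) @ (z : C^o) --> (Re z : R^o)) /\
   ((fun x : C => Im x) @ (z : C^o) --> (Im z : R^o)).
  by have /ccontP := @ccont_id R z.
have cn : (fun x : C => normc x) @ (z : C^o) --> (normc z : R^o).
  by have /ccontP[+ _] := ccont_norm (@ccont_id R z).
pose F := nbhs_filter (z : C^o).
have c1 := @cvgM R _ _ F _ _ _ _ (@cvgD R R^o _ _ F _ _ _ _ cn cr) (@cvg_cst R^o (2^-1) _ _ F).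
have c2 := @cvg_comp _ _ _ _ (@Num.sqrt R) _ _ _ c1 (@sqrt_continuous R _).
apply/ccontP; split; first exact: c2.
have c3 := @cvgM R _ _ F _ _ _ _ (@cvg_cst R^o (2 : R) _ _ F) c2.
have s0 : 2 * Num.sqrt ((normc z + Re z) / 2) != 0.
  by rewrite mulf_neq0 // gt_eqF // sqrtr_gt0.
exact: (@cvgM R _ _ F _ _ _ _ ci (@cvgV R _ _ F _ _ s0 c3)).
Qed.

(** Division by k(t0) brings the values near 1, into the domain of [half_sqrt]; a fixed root of
    k(t0) restores the factor. *)
Lemma local_sqrt (k : C -> C) (t0 : C) : k t0 != 0 -> exists g : C -> C,
  forall (t : C), 0 < Re (k t / k t0) -> g t * g t = k t /\ (ccont k t -> ccont g t).
Proof.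
move=> k0; pose c := sqrtc (k t0).
have cc : c * c = k t0 by rewrite -expr2 sqr_sqrtc.
exists (fun t => c * half_sqrt (k t / k t0)) => t r0; split.
  by rewrite mulrACA cc half_sqrtK // mulrC divfK.
move=> ck; apply: ccontM; first exact: ccont_cst.
have c1 : ccont (fun t => k t / k t0) t := ccontM ck (@ccont_cst R (k t0)^-1 t).
exact (@ccont_comp R half_sqrt (fun t => k t / k t0) t c1 (half_sqrt_cont r0)).
Qed.
End Continuity.

Section ContinuousSections.
Variable R : realType.
Local Notation C := R[i].
Variables (n : nat) (D : ttdata R n.+1) (tt : is_ttstar D).
Let hB := tt_bundle tt.
Local Notation N := n.+1.
Local Notation w := (omega R n).

Definition csec (V : forall t, fib D t) t :=
  forall i, dom i t -> mxcont (fun s => crd i s (V s)) t.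

Lemma csec_chart (V : forall t, fib D t) i t : dom i t ->
  mxcont (fun s => crd i s (V s)) t -> csec V t.
Proof.
move=> it cV j jt.
have oi := @hb_open _ _ _ hB i.
pose M s : 'M[C]_N := \matrix_(k, l) crd j s (frame i s l) k 0.
have hM : mxholo (dom i `&` dom j) M.
  by move=> k l; under [X in holomorphic _ X]eq_fun do rewrite mxE; exact: hb_trans.
apply: (@mxcont_near _ _ _ (fun s => M s *m crd i s (V s))); last first.
  by apply: mxcont_mul => //; exact: mxholo_cont hM _.
have oij : open (dom i `&` dom j : set C^o) by apply: openI => //; exact: hb_open.
apply: (open_near_eq oij _ (conj it jt)) => s [si sj].
by rewrite [RHS](lin_mx hB si (h := fun a => crd j s a)) //; exact: (crd_lin hB sj).
Qed.

Lemma eta_cont (V W : forall t, fib D t) t : Cstar t -> csec V t -> csec W t ->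
  ccont (fun s => tt_eta (V s) (W s)) t.
Proof.
move=> t0 cV cW; have [i it] := hb_cover hB t0.
have oi := @hb_open _ _ _ hB i.
have E s : dom i s -> ((crd i s (V s))^T *m eta_mx i s *m crd i s (W s)) 0 0 = tt_eta (V s) (W s).
  by move=> si; rewrite (eta_crd tt si).
apply: (ccont_near (open_near_eq oi E it)).
apply: mxcont_mul (cW i it) 0 0; apply: mxcont_mul; first exact: mxcont_tr (cV i it).
exact: mxholo_cont (eta_mxholo tt i) it.
Qed.

Variables (S : forall t, fib D t -> fib D t) (S_iso : @is_iso R N D (scale_Phi w D) S).
Variables (mu : C) (mu0 : mu != 0).
Hypothesis HmuN : forall (i : chart D) t, dom i t -> Phi_mx i t ^+ N = (mu ^+ N)%:M.

Let phi0 (i : chart D) t := mu^-1 *: Phi_mx i t.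

Lemma phi0N i t : dom i t -> phi0 i t ^+ N = 1%:M.
Proof.
move=> it; rewrite /phi0 exprZn HmuN // scale_scalar_mx exprVn mulVf //.
by rewrite expf_neq0.
Qed.

Lemma sg_phi0 i t : dom i t -> sg_mx S i t *m phi0 i t = w *: (phi0 i t *m sg_mx S i t).
Proof.
move=> it; rewrite /phi0 -scalemxAr (sg_phi tt S_iso it) -scalemxAl.
by rewrite !scalerA mulrC.
Qed.

Lemma ph_phi0 i t (a : fib D t) : dom i t ->
  ph a = mu *: a <-> phi0 i t *m crd i t a = crd i t a.
Proof.
move=> it; rewrite /phi0 -scalemxAl -(crd_ph tt it); split=> [->|E].
  by rewrite (lin_Z (crd_lin hB it)) scalerA mulVf // scale1r.
apply: (crd_inj hB it); rewrite (lin_Z (crd_lin hB it)) -E scalerA divff //.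
by rewrite scale1r.
Qed.

Let N0 : N%:R != 0 :> C. Proof. by rewrite pnatr_eq0. Qed.

Lemma eigen_unique t (a b : fib D t) : Cstar t -> a != 0 ->
  ph a = mu *: a -> ph b = mu *: b -> exists x, b = x *: a.
Proof.
move=> t0 a0 Ha Hb; have [i it] := hb_cover hB t0.
have [|x Hx] := eigenline_unique (omega_prim R n) (sg_unit tt S_iso it) (sg_phi0 it) _
  ((ph_phi0 a it).1 Ha) ((ph_phi0 b it).1 Hb).
  apply: contra_neq a0 => E; apply: (crd_inj hB it).
  by rewrite E (lin_0 (crd_lin hB it)).
by exists x; apply: (crd_inj hB it); rewrite Hx (lin_Z (crd_lin hB it)).
Qed.

Let Q i t := line_proj (phi0 i t).

Lemma Q_holo i : mxholo (dom i) (Q i).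
Proof.
have oi := @hb_open _ _ _ hB i.
have ph0 : mxholo (dom i) (phi0 i).
  move=> k l; under [X in holomorphic _ X]eq_fun do rewrite mxE.
  by apply: (holoM oi); [exact: holo_cst oi _|exact: (Phi_mxholo tt i)].
move=> k l; under [X in holomorphic _ X]eq_fun do rewrite mxE summxE.
apply: (holoM oi); first exact: holo_cst oi _.
by apply: (holo_sum oi) => j _; exact: (mxholo_pow j oi ph0).
Qed.

(** The projection Q onto the line of a is a polynomial in phi, hence self-adjoint for eta, so
    eta(a, b) = eta(a, Q b) with Q b a multiple of a. If eta(a, a) = 0, then a is orthogonal to
    everything. *)
Lemma eta_eigen_neq0 t (a : fib D t) : Cstar t -> a != 0 -> ph a = mu *: a -> tt_eta a a != 0.
Proof.
move=> t0 a0 Ha; apply: contra_neq a0 => Eaa; apply: (eta_nondeg tt t0) => b.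
have [i it] := hb_cover hB t0.
have Qa := line_proj_id (n := n) N0 ((ph_phi0 a it).1 Ha).
have sQ : (Q i t)^T *m eta_mx i t = eta_mx i t *m Q i t.
  have sp k : ((phi0 i t) ^+ k)^T *m eta_mx i t = eta_mx i t *m (phi0 i t) ^+ k.
    elim: k => [|k IH]; first by rewrite expr0 trmx1 mul1mx mulmx1.
    rewrite exprSr -[_ * phi0 i t]/(_ *m _) trmx_mul -mulmxA IH mulmxA.
    rewrite {1}/phi0 linearZ /= -scalemxAl (eta_ph tt it) scalemxAr -mulmxA.
    by rewrite -[phi0 i t *m _]/(_ * _) -[_ *m phi0 i t]/(_ * _) -exprS exprSr.
  rewrite /Q /line_proj linearZ /= -scalemxAl -scalemxAr; congr (_ *: _).
  rewrite linear_sum /= mulmx_suml mulmx_sumr; apply: eq_bigr => k _.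
  exact: sp.
pose b' := loc i t (Q i t *m crd i t b).
have b'E : crd i t b' = Q i t *m crd i t b by rewrite (hb_locK hB it).
have -> : tt_eta a b = tt_eta a b'.
  rewrite !(eta_crd tt it) b'E -{1}Qa trmx_mul -/(Q i t).
  by rewrite -(mulmxA _ (Q i t)^T) sQ !mulmxA.
have [->|a0] := eqVneq a 0.
  by rewrite (eta_sym tt t0) (sca_0 (eta_scalar tt t0 _)).
have [|x ->] := @eigen_unique t a b' t0 a0 Ha; last first.
  by rewrite (sca_Z (eta_scalar tt t0 _)) Eaa mulr0.
apply/(ph_phi0 b' it); rewrite b'E mulmxA.
by rewrite (phi_line_proj (phi0N it)).
Qed.

(** A column of the projection Q that is non-zero at t0. It is holomorphic because Q is a polynomial
    in phi, but may vanish away from t0. *)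
Lemma local_eigenframe t0 : Cstar t0 -> exists (i : chart D) (p : forall t, fib D t),
  [/\ dom i t0, mxholo (dom i) (fun t => crd i t (p t)),
      forall t, dom i t -> ph (p t) = mu *: p t & p t0 != 0].
Proof.
move=> t00; have [i it0] := hb_cover hB t00; exists i.
have Q0 := line_proj_neq0 (omega_prim R n) (sg_unit tt S_iso it0) (sg_phi0 it0) N0.
have [k [l kl]] : exists k l, Q i t0 k l != 0.
  apply: contrapT => H; move/eqP: Q0; apply; apply/matrixP => k l; rewrite [RHS]mxE.
  by apply: contrapT => /eqP E; apply: H; exists k, l.
pose p t := loc i t (Q i t *m (delta_mx l 0 : 'cV[C]_N)).
have pE t : dom i t -> crd i t (p t) = Q i t *m delta_mx l 0.
  by move=> it; rewrite (hb_locK hB it).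
have oi := @hb_open _ _ _ hB i.
exists p; split=> //.
- apply: (mxholo_eq oi (fun t it => esym (pE t it))).
  by apply: (mxholo_mul oi); [exact: Q_holo|exact: mxholo_cst].
- move=> t it; apply/(ph_phi0 _ it); rewrite pE // mulmxA.
  by rewrite (phi_line_proj (phi0N it)).
- apply: contra_neq kl => E; have := pE _ it0.
  by rewrite E (lin_0 (crd_lin hB it0)) -colE => /matrixP/(_ k 0); rewrite !mxE.
Qed.

Lemma eta_holo_chart i (p q : forall t, fib D t) :
  mxholo (dom i) (fun t => crd i t (p t)) -> mxholo (dom i) (fun t => crd i t (q t)) ->
  holomorphic (dom i) (fun t => tt_eta (p t) (q t)).
Proof.
move=> hp hq; have oi := @hb_open _ _ _ hB i.
apply: (holo_eq oi (f := fun t => ((crd i t (p t))^T *m eta_mx i t *m crd i t (q t)) 0 0)).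
  by move=> t it; rewrite (eta_crd tt it).
apply: (mxholo_mul oi) => //; apply: (mxholo_mul oi); first exact: mxholo_tr.
exact: eta_mxholo.
Qed.

(* Against a local holomorphic eigenvector p we have V = g p with g continuous and
   g^2 holomorphic. *)
Lemma eigensection_holo (W : set C) (V : forall t, fib D t) (h : C -> C) :
  open (W : set C^o) -> W `<=` Cstar -> (forall t, W t -> csec V t) ->
  (forall t, W t -> ph (V t) = mu *: V t) ->
  (forall t, W t -> tt_eta (V t) (V t) = h t) -> (forall t, W t -> h t != 0) ->
  holomorphic W h ->
  forall j, mxholo (W `&` dom j) (fun t => crd j t (V t)).
Proof.
move=> oW WC cV eV nV h0 hh j k l.
apply: holo_local => t0 [Wt0 jt0].
have [i [p [it0 hp ep p0]]] := local_eigenframe (WC _ Wt0).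
have oi := @hb_open _ _ _ hB i; have oj := @hb_open _ _ _ hB j.
have hpp := eta_holo_chart hp hp.
have pp0 : tt_eta (p t0) (p t0) != 0.
  by apply: eta_eigen_neq0 => //; [exact: WC|exact: ep].
have : \forall s \near (t0 : C^o), [/\ W s, dom i s, dom j s & tt_eta (p s) (p s) != 0].
  have c := holo_cont hpp it0.
  have H := @cvgc_neq0 R _ (nbhs (t0 : C^o)) (nbhs_filter _) _ _ pp0 c.
  have H1 := open_near oW Wt0; have H2 := open_near oi it0; have H3 := open_near oj jt0.
  by near=> s; split; near: s.
move=> /nbhsCP[d d0 Hd].
pose B := [set s : C | normc (s - t0) < d].
have oB : open (B : set C^o).
  apply/openCP => s sB; exists (d - normc (s - t0)); first by rewrite subr_gt0.
  move=> u us; rewrite /B /=.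
  have -> : u - t0 = (u - s) + (s - t0) by ring.
  by apply: le_lt_trans (le_normcD _ _) _; rewrite -ltrBrDr.
exists B; first by rewrite /B /= subrr normc0.
pose g s := tt_eta (p s) (V s) / tt_eta (p s) (p s).
have Vg s : B s -> V s = g s *: p s.
  move=> /Hd[Ws si sj ps0].
  have p0s : p s != 0.
    by apply: contra_neq ps0 => ->; rewrite (sca_0 (eta_scalar tt (WC _ Ws) _)).
  have [x Hx] := eigen_unique (WC _ Ws) p0s (ep s si) (eV s Ws).
  by rewrite /g Hx (sca_Z (eta_scalar tt (WC _ Ws) _)) mulfK.
have gg s : B s -> g s * g s = h s / tt_eta (p s) (p s).
  move=> Bs; have [Ws si sj ps0] := Hd _ Bs.
  have Cs := WC _ Ws.
  rewrite -(nV s Ws) (Vg s Bs) (sca_Z (eta_scalar tt Cs _)) (eta_sym tt Cs).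
  by rewrite (sca_Z (eta_scalar tt Cs _)) mulrA mulfK.
have g0 s : B s -> g s != 0.
  move=> Bs; have [Ws si sj ps0] := Hd _ Bs.
  have : g s * g s != 0 by rewrite gg // mulf_neq0 ?invr_eq0 // h0.
  by apply: contra_neq => ->; rewrite mul0r.
have hg : holomorphic B g.
  apply: (holo_sqrt oB) => //.
  - move=> s Bs; have [Ws si sj ps0] := Hd _ Bs.
    have cp : csec p s by apply: (csec_chart si); exact: mxholo_cont hp si.
    have Cs := WC _ Ws.
    exact (ccontM (eta_cont Cs cp (cV s Ws)) (ccontV ps0 (eta_cont Cs cp cp))).
  - apply: (holo_eq oB (fun s Bs => esym (gg s Bs))).
    apply: (holoM oB); first by apply: holo_sub hh => s /Hd[].
    apply: (holoV oB); first by move=> s /Hd[].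
    by apply: holo_sub hpp => s /Hd[].
pose M s : 'M[C]_N := \matrix_(k, l) crd j s (frame i s l) k 0.
have hM : mxholo B M.
  move=> a b; under [X in holomorphic _ X]eq_fun do rewrite mxE.
  by apply: holo_sub (hb_trans hB i j a b) => s /Hd[].
have hp' : mxholo B (fun t => crd i t (p t)).
  by move=> a b; apply: holo_sub (hp a b) => s /Hd[].
apply: (holo_eq oB (f := fun s => g s * (M s *m crd i s (p s)) k l)); last first.
  by apply: (holoM oB) => //; exact: (mxholo_mul oB).
move=> s Bs; have [Ws si sj ps0] := Hd _ Bs.
rewrite (Vg s Bs) (lin_Z (crd_lin hB sj)) [RHS]mxE; congr (_ * _).
congr (fun_of_matrix _ k l).
by rewrite [RHS](lin_mx hB si (h := fun a => crd j s a)) //; exact: (crd_lin hB sj).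
Unshelve. all: by end_near. Qed.

(** The local eigenvector p is rescaled by a continuous root of 1 / (N eta(p, p)). *)
Lemma local_lift t0 : Cstar t0 -> exists2 u : forall t, fib D t,
  exists2 d, 0 < d & forall t, normc (t - t0) < d ->
    [/\ Cstar t, csec u t, ph (u t) = mu *: u t & tt_eta (u t) (u t) = N%:R^-1] & True.
Proof.
move=> t00; have [i [p [it0 hp ep p0]]] := local_eigenframe t00.
have oi := @hb_open _ _ _ hB i.
have hpp := eta_holo_chart hp hp.
have pp0 : tt_eta (p t0) (p t0) != 0 by apply: eta_eigen_neq0 => //; exact: ep.
pose k t := (N%:R * tt_eta (p t) (p t))^-1.
have k0 : k t0 != 0 by rewrite invr_eq0 mulf_neq0.
have ck t : dom i t -> tt_eta (p t) (p t) != 0 -> ccont k t.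
  move=> it pt0; apply: ccontV; first by rewrite mulf_neq0.
  by apply: ccontM; [exact: ccont_cst|exact: holo_cont hpp it].
have [g Hg] := local_sqrt k0.
have : \forall s \near (t0 : C^o), [/\ dom i s, tt_eta (p s) (p s) != 0 & 0 < complex.Re (k s / k t0)].
  have H := @cvgc_neq0 R _ (nbhs (t0 : C^o)) (nbhs_filter _) _ _ pp0 (holo_cont hpp it0).
  have H2 := open_near oi it0.
  have /ccontP[cr _] : ccont (fun s => k s / k t0) t0.
    by apply: ccontM; [exact: ck|exact: ccont_cst].
  have H3 : \forall s \near (t0 : C^o), 0 < complex.Re (k s / k t0).
    apply: (cr [set x : R | 0 < x]); rewrite divff //.
    exact: (lt_nbhsr (@ltr01 R)).
  by near=> s; split; near: s.
move=> /nbhsCP[d d0 Hd].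
exists (fun t => g t *: p t) => //; exists d => // t /Hd[it pt0 r0].
have t0' : Cstar t := hb_sub hB it.
have [gg cg] := Hg t r0.
split=> //.
- apply: (csec_chart it).
  apply: (@mxcont_near _ _ _ (fun s => g s *: crd i s (p s))).
    by apply: (open_near_eq oi _ it) => s si; rewrite (lin_Z (crd_lin hB si)).
  move=> a b; under eq_fun do rewrite mxE.
  by apply: ccontM; [exact/cg/ck|exact: (mxholo_cont hp it)].
- by rewrite /ph (lin_Z (Phi_linear tt t0' 1)) -/(ph _) ep // !scalerA mulrC.
rewrite (sca_Z (eta_scalar tt t0' _)) (eta_sym tt t0') (sca_Z (eta_scalar tt t0' _)) mulrA gg /k.
by rewrite invfM mulfVK.
Unshelve. all: by end_near. Qed.

End ContinuousSections.

Section Signs.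
Variable R : realType.
Local Notation C := R[i].

Definition sgn (b : bool) : C := (-1) ^+ b.
Lemma sgn_addb a b : sgn (a (+) b) = sgn a * sgn b.
Proof. by case: a; case: b; rewrite /sgn /= ?expr0 ?expr1 ?mulrNN ?mulr1 ?mul1r. Qed.
Lemma sgnK b : sgn b * sgn b = 1.
Proof. by rewrite -sgn_addb addbb. Qed.
Lemma sgnJ b : conjc (sgn b) = sgn b.
Proof. by rewrite /sgn; case: b; rewrite ?expr1 ?expr0; apply: eqC; rewrite !reE /= ?oppr0. Qed.
(** The values c and -c are 2 |c| apart, so a function taking only these values and converging to
    one of them is eventually equal to it. *)
Lemma sgn_const {T} (F : set_system T) {FF : Filter F} (f : T -> C) (b : T -> bool) b0 (c : C) :
  c != 0 -> f @ F --> (sgn b0 * c : C^o) -> (\forall x \near F, f x = sgn (b x) * c) ->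
  \forall x \near F, b x = b0.
Proof.
move=> c0 H E.
have : \forall x \near F, normc (f x - sgn b0 * c) < normc c.
  apply: (H (fun z => normc (z - sgn b0 * c) < normc c)).
  by apply/nbhsCP; exists (normc c); first exact: normc_gt0.
move: E; apply: filterS2 => x ->.
case: (b x) b0 {H} => [] [] //; rewrite /sgn /= ?expr1 ?expr0 ?mulN1r ?mul1r.
  rewrite -opprD normcN -mulr2n normcMn mulr2n gtrDl => /ltW.
  by rewrite leNgt normc_gt0.
rewrite opprK -mulr2n normcMn mulr2n gtrDl => /ltW.
by rewrite leNgt normc_gt0.
Qed.

Lemma sgn_const_near (f : C -> C) (b : C -> bool) (t c : C) : c != 0 -> f t = sgn (b t) * c ->
  ccont f t -> (\forall x \near (t : C^o), f x = sgn (b x) * c) ->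
  \forall x \near (t : C^o), b x = b t.
Proof.
move=> c0 ft cf E.
apply: (@sgn_const _ (nbhs (t : C^o)) (nbhs_filter _) f b (b t) c c0 _ E).
by rewrite -ft.
Qed.

Lemma sgn_const_nearR (f : R -> C) (b : R -> bool) (t : R) (c : C) : c != 0 -> f t = sgn (b t) * c ->
  f @ (t : R^o) --> (f t : C^o) -> (\forall x \near (t : R^o), f x = sgn (b x) * c) ->
  \forall x \near (t : R^o), b x = b t.
Proof.
move=> c0 ft cf E.
apply: (@sgn_const _ (nbhs (t : R^o)) (nbhs_filter _) f b (b t) c c0 _ E).
by rewrite -ft.
Qed.
End Signs.

(** * Curves of rotated vectors and the choice of sign *)

Section GlobalSection.
Variable R : realType.
Local Notation C := R[i].
Variables (n : nat) (D : ttdata R n.+1) (tt : is_ttstar D).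
Let hB := tt_bundle tt.
Local Notation N := n.+1.
Local Notation w := (omega R n).
Variables (S : forall t, fib D t -> fib D t) (S_iso : @is_iso R N D (scale_Phi w D) S).
Variable T : forall (y : R) (t : C), fib D (cexp (0 +i* y) * t) -> fib D t.
Hypothesis T_iso : forall y : R,
  @is_iso R N (scale_Phi (cexp (- (0 +i* y))) (pullback (0 +i* y) D)) D (@T y).
Hypothesis T_cont : forall (t : C) (a : fib D t), Cstar t ->
  continuous_curve (fun y : R => map_at (@T y) a).
Local Notation rot y a := (@rot R n D T y _ a).

Section Curves.
Variables (t : C) (t0 : Cstar t) (y : R).

(** Continuity at y of a curve of vectors above x -> e^(-ix) t, tested in the charts around its
    value; this is the form in which [T_cont] is used. *)
Definition ccurve (p : forall x, fib D (cis x * t)) :=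
  forall i, dom i (cis y * t) -> forall k,
    (fun x => crd i (cis x * t) (p x) k 0) @ (y : R^o) --> (crd i (cis y * t) (p y) k 0 : C^o).

Lemma cis_cvg : (fun x => cis x * t) @ (y : R^o) --> (cis y * t : C^o).
Proof.
have [a _] := nonzero_vector tt t0.
by have [H _] := T_cont a t0 y; exact: H.
Qed.

Lemma rot_curve (a : fib D t) : ccurve (fun x => rot x a).
Proof. by move=> i it k; have [_ H] := T_cont a t0 y; exact: (H i it k). Qed.

Lemma mxcurve m p (M : C -> 'M[C]_(m, p)) : mxcont M (cis y * t) ->
  forall k l, (fun x => M (cis x * t) k l) @ (y : R^o) --> (M (cis y * t) k l : C^o).
Proof.
move=> cM k l.
exact: (@cvg_comp _ _ _ (fun x => cis x * t) (fun s => M s k l) _ _ _ cis_cvg (cM k l)).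
Qed.

Lemma csec_curve (V : forall t, fib D t) : csec V (cis y * t) -> ccurve (fun x => V (cis x * t)).
Proof. by move=> cV i it k; exact: (mxcurve (cV i it)). Qed.

Lemma cvgc_sum (I : Type) (r : seq I) (F : I -> R -> C) (G : I -> C) :
  (forall i, F i @ (y : R^o) --> (G i : C^o)) ->
  (fun x => \sum_(i <- r) F i x) @ (y : R^o) --> (\sum_(i <- r) G i : C^o).
Proof.
move=> H; elim: r => [|i r IH].
  rewrite big_nil; under eq_fun do rewrite big_nil.
  exact: (@cvgc_cst R _ _ (nbhs_filter (y : R^o)) 0).
rewrite big_cons; under eq_fun do rewrite big_cons.
exact (@cvgcD R _ _ (nbhs_filter (y : R^o)) _ _ _ _ (H i) IH).
Qed.

Lemma mx_cvg m p q (A : R -> 'M[C]_(m, p)) (B : R -> 'M[C]_(p, q)) :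
  (forall k l, (fun x => A x k l) @ (y : R^o) --> (A y k l : C^o)) ->
  (forall k l, (fun x => B x k l) @ (y : R^o) --> (B y k l : C^o)) ->
  forall k l, (fun x => (A x *m B x) k l) @ (y : R^o) --> ((A y *m B y) k l : C^o).
Proof.
move=> HA HB k l; rewrite mxE; under eq_fun do rewrite mxE.
apply: cvgc_sum => j.
exact (@cvgcM R _ _ (nbhs_filter (y : R^o)) _ _ _ _ (HA k j) (HB j l)).
Qed.

Lemma curve_near (U : set C) : open (U : set C^o) -> U (cis y * t) ->
  \forall x \near (y : R^o), U (cis x * t).
Proof. by move=> oU Uy; exact: (cis_cvg (open_near oU Uy)). Qed.

Lemma cvgc_near (f g : R -> C) (l : C) : (\forall x \near (y : R^o), f x = g x) ->
  f @ (y : R^o) --> (l : C^o) -> g @ (y : R^o) --> (l : C^o).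
Proof.
move=> E; apply: cvg_trans; apply: near_eq_cvg.
by near=> x; near: x.
Unshelve. all: by end_near. Qed.

Lemma curve_eta (p q : forall x, fib D (cis x * t)) : ccurve p -> ccurve q ->
  (fun x => tt_eta (p x) (q x)) @ (y : R^o) --> (tt_eta (p y) (q y) : C^o).
Proof.
move=> cp cq; have [i it] := hb_cover hB (Cstar_cis y t0).
have oi := @hb_open _ _ _ hB i.
rewrite (eta_crd tt it).
apply: (cvgc_near (f := fun x => ((crd i (cis x * t) (p x))^T *m eta_mx i (cis x * t) *m crd i (cis x * t) (q x)) 0 0)).
  by have := curve_near oi it; apply: filterS => x xi; rewrite (eta_crd tt xi).
apply: mx_cvg => [|k l]; last by rewrite ord1; exact: (cq i it k).
apply: mx_cvg => [k l|]; first by rewrite mxE ord1; under eq_fun do rewrite mxE; exact: (cp i it l).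
exact: (mxcurve (mxholo_cont (eta_mxholo tt i) it)).
Qed.

Lemma S_curve k (p : forall x, fib D (cis x * t)) : ccurve p ->
  ccurve (fun x => iter k (@S _) (p x)).
Proof.
move=> cp; elim: k => [//|k IH] /= i it m.
have oi := @hb_open _ _ _ hB i.
rewrite (crd_S tt S_iso it).
apply: (cvgc_near (f := fun x => (sg_mx S i (cis x * t) *m crd i (cis x * t) (iter k (@S _) (p x))) m 0)).
  by have := curve_near oi it; apply: filterS => x xi; rewrite (crd_S tt S_iso xi).
apply: mx_cvg => [|a b]; last by rewrite ord1; exact: (IH i it a).
exact: (mxcurve (mxholo_cont (sg_holo S_iso i) it)).
Qed.
End Curves.

Variables (mu : C) (mu0 : mu != 0).
Hypothesis HmuN : forall (i : chart D) t, dom i t -> Phi_mx i t ^+ N = (mu ^+ N)%:M.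

Definition lift t (a : fib D t) := ph a = mu *: a /\ tt_eta a a = N%:R^-1.

Let Ninv0 : (N%:R^-1 : C) != 0. Proof. by rewrite invr_eq0 pnatr_eq0. Qed.

Lemma lift_neq0 t (a : fib D t) : Cstar t -> lift a -> a != 0.
Proof.
move=> t0 [_ La]; apply: contra_neq Ninv0 => a0.
by rewrite -La a0 (sca_0 (eta_scalar tt t0 _)).
Qed.

Lemma eta_scale t (a b : fib D t) x z : Cstar t ->
  tt_eta (x *: a) (z *: b) = x * z * tt_eta a b.
Proof.
move=> t0; rewrite (sca_Z (eta_scalar tt t0 _)) (eta_sym tt t0) (sca_Z (eta_scalar tt t0 _)).
by rewrite (eta_sym tt t0) mulrA [z * x]mulrC.
Qed.

Definition sign_of t (a b : fib D t) : bool := `[< a = - b >].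

Lemma lift_sign t (a b : fib D t) : Cstar t -> lift a -> lift b -> a = sgn R (sign_of a b) *: b.
Proof.
move=> t0 La Lb.
have [x Hx] := eigen_unique tt S_iso mu0 t0 (lift_neq0 t0 Lb) Lb.1 La.1.
have /eqP : x ^+ 2 = 1.
  apply: (mulIf Ninv0); rewrite -{1}Lb.2 mul1r -La.2 Hx (eta_scale _ _ _ _ t0).
  by rewrite expr2.
rewrite sqrf_eq1 /sign_of => /orP[] /eqP xE; move: Hx; rewrite xE ?scale1r ?scaleN1r => ->.
  case: asboolP => [E|_]; last by rewrite scale1r.
  by rewrite scaleN1r.
by case: asboolP => // _; rewrite scaleN1r.
Qed.

Lemma eta_sgn t (a : fib D t) x z : Cstar t -> lift a ->
  tt_eta (sgn R x *: a) (sgn R z *: a) = sgn R (x (+) z) * N%:R^-1.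
Proof. by move=> t0 [_ La]; rewrite (eta_scale _ _ _ _ t0) La sgn_addb. Qed.

Lemma rot_lift y t (a : fib D t) : Cstar t -> lift a -> lift (rot y a).
Proof.
move=> t0 [pa na]; split; last by rewrite (rot_eta T_iso).
by rewrite -(rot_ph tt T_iso) // pa (lin_Z (rot_lin T_iso y t0)).
Qed.

(** A pointwise choice, possibly discontinuous, which serves as the reference for all signs. *)
Lemma lifts_exist : exists A : forall t, fib D t, forall t, Cstar t -> lift (A t).
Proof.
have H t : exists a : fib D t, Cstar t -> lift a.
  have [t0|] := pselect (Cstar t); last by exists 0.
  have [u [d d0 Hu] _] := local_lift tt S_iso mu0 HmuN t0.
  exists (u t) => _; have [|_ _ pu nu] := Hu t; first by rewrite subrr normc0.
  by split.
exists (fun t => projT1 (cid (H t))) => t t0.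
by case: (cid (H t)) => /= a; apply.
Qed.

Variables (A : forall t, fib D t) (LA : forall t, Cstar t -> lift (A t)).

(* If the choice of sign of A has monodromy -1 around 0 (b = true), multiplication by
   the square root of t makes it single-valued. *)
Lemma A_global : exists (b : bool) (V : forall t, fib D t),
  [/\ forall t, Cstar t -> csec V t,
      forall t, Cstar t -> ph (V t) = mu *: V t,
      forall t, Cstar t -> exists2 x, V t = x *: A t & x * x = t ^+ b &
      map_at (@T (2%:R * pi)) (A 1) = map_at (@T 0) (A 1) -> b = false].
Proof.
have H t0 : exists ud : (forall t, fib D t) * R, Cstar t0 -> 0 < ud.2 /\ forall t, normc (t - t0) < ud.2 ->
    [/\ Cstar t, csec ud.1 t & lift (ud.1 t)].
  have [t00|] := pselect (Cstar t0); last by exists (A, 1).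
  have [u [d d0 Hu] _] := local_lift tt S_iso mu0 HmuN t00.
  by exists (u, d) => _; split=> //= t /Hu[? ? ? ?]; split=> //; split.
pose u t0 := (projT1 (cid (H t0))).1; pose d t0 := (projT1 (cid (H t0))).2.
have Hu t0 : Cstar t0 -> 0 < d t0 /\ forall t, normc (t - t0) < d t0 ->
    [/\ Cstar t, csec (u t0) t & lift (u t0 t)].
  by move=> t00; rewrite /u /d; case: (cid (H t0)) => /= ud; apply.
(* Measured against A, these signs may jump. They become locally constant in combinations where A
   occurs twice: up to the factor N, such a combination is the eta-product of two continuous
   lifts. *)
pose sig t0 t := sign_of (u t0 t) (A t).
pose rho y t := sign_of (rot y (A t)) (A (cis y * t)).
have uE t0 t : Cstar t0 -> normc (t - t0) < d t0 -> u t0 t = sgn R (sig t0 t) *: A t.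
  move=> /Hu[_ H0] /H0[t0' _ lu]; apply: lift_sign => //; exact: LA.
have rE y t : Cstar t -> rot y (A t) = sgn R (rho y t) *: A (cis y * t).
  move=> t0; apply: lift_sign; [exact: Cstar_cis|exact: rot_lift (LA t0)|].
  by apply: LA; exact: Cstar_cis.
have center t0 : Cstar t0 -> normc (t0 - t0) < d t0.
  by move=> /Hu[d0 _]; rewrite subrr normc0.
have ball_near t0 : Cstar t0 -> \forall t \near (t0 : C^o), normc (t - t0) < d t0.
  by move=> /Hu[d0 _]; apply/nbhsCP; exists (d t0).
have H2 t0 : t0 != 0 -> exists2 d, 0 < d & forall t1, normc (t1 - t0) < d -> t1 != 0 ->
    \forall t \near (t1 : C^o), sig t0 t (+) sig t1 t = sig t0 t1 (+) sig t1 t1.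
  move=> t00; have [d0 Hd] := Hu t0 t00; exists (d t0) => // t1 t1d t10.
  have [_ c0 _] := Hd t1 t1d; have [_ H1] := Hu t1 t10.
  have [_ c1 _] := H1 t1 (center t1 t10).
  apply: (@sgn_const_near R (fun t => tt_eta (u t0 t) (u t1 t)) (fun t => sig t0 t (+) sig t1 t) t1 _ Ninv0).
  - by rewrite -(eta_sgn _ _ t10 (LA t10)) -uE // -uE //; exact: center.
  - exact: (eta_cont tt t10 c0 c1).
  have N1 : \forall t \near (t1 : C^o), normc (t - t0) < d t0.
    apply/nbhsCP; exists (d t0 - normc (t1 - t0)); first by rewrite subr_gt0.
    move=> s; rewrite ltrBrDr => ss; have -> : s - t0 = (s - t1) + (t1 - t0) by ring.
    by apply: le_lt_trans (le_normcD _ _) _.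
  have := ball_near t1 t10; move: N1; apply: filterS2 => t ht0 ht1.
  have [tC _ _] := Hd t ht0.
  by rewrite -(eta_sgn _ _ tC (LA tC)) -uE // -uE.
have H3 y t : t != 0 -> same_germ (rho^~ t) y (fun y' => sig (cis y * t) (cis y' * t)).
  move=> t0; have t10 := Cstar_cis y t0.
  have [d0 Hd] := Hu _ t10; have [_ c1 _] := Hd _ (center _ t10).
  apply: (@sgn_const_nearR R (fun x => tt_eta (rot x (A t)) (u (cis y * t) (cis x * t)))
     (fun x => rho x t (+) sig (cis y * t) (cis x * t)) y _ Ninv0).
  - by rewrite -(eta_sgn _ _ t10 (LA t10)) -rE // -uE //; exact: center.
  - apply: (curve_eta t0); first exact: rot_curve.
    exact: csec_curve.
  - have Hn : \forall x \near (y : R^o), normc (cis x * t - cis y * t) < d (cis y * t).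
      exact: (cis_cvg t0 (ball_near _ t10)).
    apply: (@filterS R (nbhs (y : R^o)) (nbhs_filter (y : R^o)) _ _ _ Hn) => x hx.
  have xC := Cstar_cis x t0.
  by rewrite -(eta_sgn _ _ xC (LA xC)) -rE // -uE.
(* At a fixed angle, continuity in t' comes from the matrix of T_y in charts, which is
   holomorphic. *)
have H4 y t : t != 0 -> \forall t' \near (t : C^o),
    rho y t' (+) sig t t' (+) sig (cis y * t) (cis y * t') =
    rho y t (+) sig t t (+) sig (cis y * t) (cis y * t).
  move=> t0; have t10 := Cstar_cis y t0.
  have [d1 Hd1] := Hu _ t10; have [_ c1 _] := Hd1 _ (center _ t10).
  have [d0 Hd0] := Hu _ t0; have [_ c0 _] := Hd0 _ (center _ t0).
  have ruE t' : Cstar t' -> normc (t' - t) < d t ->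
      rot y (u t t') = sgn R (rho y t' (+) sig t t') *: A (cis y * t').
    move=> tC' ht'; rewrite uE // (lin_Z (rot_lin T_iso y tC')) rE // scalerA.
    by rewrite addbC sgn_addb.
  have cmul : (fun t' => cis y * t') @ (t : C^o) --> (cis y * t : C^o).
    exact (ccontM (@ccont_cst R (cis y) t) (@ccont_id R t)).
  have near1 : \forall t' \near (t : C^o), normc (cis y * t' - cis y * t) < d (cis y * t).
    exact: (cmul _ (ball_near _ t10)).
  apply: (@sgn_const_near R (fun t' => tt_eta (rot y (u t t')) (u (cis y * t) (cis y * t')))
     (fun t' => rho y t' (+) sig t t' (+) sig (cis y * t) (cis y * t')) t _ Ninv0); last first.
  - have := ball_near t t0; move: near1; apply: filterS2 => t' h1 h0.
    have [tC _ _] := Hd0 t' h0; have t'C := Cstar_cis y tC.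
    by rewrite -(eta_sgn _ _ t'C (LA t'C)) -ruE // -uE.
  2: by rewrite /= -(eta_sgn _ _ t10 (LA t10)) -ruE // -?uE //; exact: center.
  have [i it] := hb_cover hB t0; have [j jt] := hb_cover hB t10.
  have oi := @hb_open _ _ _ hB i; have oj := @hb_open _ _ _ hB j.
  have neari := open_near oi it.
  have nearj : \forall t' \near (t : C^o), dom j (cis y * t') := cmul _ (open_near oj jt).
  pose F t' := ((rot_mx T i j y (cis y * t') *m crd i t' (u t t'))^T *m eta_mx j (cis y * t')
      *m crd j (cis y * t') (u (cis y * t) (cis y * t'))) 0 0.
  have FE t' : Cstar t' -> dom i t' -> dom j (cis y * t') ->
      F t' = tt_eta (rot y (u t t')) (u (cis y * t) (cis y * t')).
    by move=> tC' it' jt'; rewrite (eta_crd tt jt') (rot_crd tt T_iso _ tC' it' jt').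
  have compc m p (M : C -> 'M[C]_(m, p)) : mxcont M (cis y * t) -> mxcont (fun t' => M (cis y * t')) t.
    move=> cM k l.
    exact (@ccont_comp R (fun s => M s k l) (fun t' => cis y * t') t cmul (cM k l)).
  apply: (@ccont_near R F).
    have := open_near (@open_Cstar R) t0; move: neari nearj; apply: filterS3 => t' it' jt' tC'.
    exact: FE.
  apply: mxcont_mul (compc _ _ (fun s => crd j s (u (cis y * t) s)) (c1 j jt)) 0 0.
  apply: mxcont_mul; last exact: compc (mxholo_cont (eta_mxholo tt j) jt).
  apply: mxcont_tr; apply: mxcont_mul (c0 i it); apply: (compc _ _ (rot_mx T i j y)).
  apply: (mxholo_cont (rot_mx_holo T_iso i j y)); split=> //=.
  by rewrite -cexpNK.
have [m [C1 C2]] := sign_lift H2 H3 H4.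
pose b := rho (2%:R * pi) 1 (+) rho 0 1.
(* Halving both coordinates gives a root of [pt s y], which changes sign when y grows by 2 pi. For b
   = true so does [m], hence q descends to the punctured plane in either case. *)
pose q s y := pt (s / 2) (y / 2) ^+ b * sgn R (m s y).
have q_period s y : q s (y + 2%:R * pi) = q s y.
  rewrite /q C2 -/b sgn_addb.
  have -> : (y + 2%:R * pi) / 2 = y / 2 + pi by field.
  have -> : pt (s / 2) (y / 2 + pi) = - pt (s / 2) (y / 2) :> C.
    rewrite /pt cisD (_ : cis pi = -1) ?mulrN1 ?mulNr //.
    by rewrite cisE cospi sinpi oppr0; apply: eqC; rewrite !reE /= ?oppr0.
  case: (b); rewrite /sgn /= ?expr1 ?expr0 ?mulr1 //.
  by rewrite mulNr mulrN1 mulrN opprK.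
have q_per s y k : q s (y + (2%:R * pi) *+ k) = q s y.
  by elim: k => [|k IH]; rewrite ?mulr0n ?addr0 // mulrSr addrA q_period.
have q_inj s y s' y' : pt s y = pt s' y' -> q s y = q s' y'.
  move=> E; case: (leP y y') => [|/ltW] yy.
    by have [-> [k ->]] := pt_inj E yy; rewrite q_per.
  by have [-> [k ->]] := pt_inj (esym E) yy; rewrite q_per.
have Hsy t : exists sy : R * R, Cstar t -> t = pt sy.1 sy.2.
  have [t0|] := pselect (Cstar t); last by exists (0, 0).
  by have [s [y E]] := pt_surj t0; exists (s, y).
pose P t := projT1 (cid (Hsy t)).
have HP t : Cstar t -> t = pt (P t).1 (P t).2.
  by rewrite /P; case: (cid (Hsy t)).
pose V t := q (P t).1 (P t).2 *: A t.
have VE s y : V (pt s y) = q s y *: A (pt s y).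
  by rewrite /V (@q_inj _ _ s y) // -HP //; exact: pt_neq0.
exists b, V; split.
- move=> t t0; have [s0 [y0 tE]] := pt_surj t0; subst t.
  have [e e0 He] := C1 s0 y0.
  have [d0 Hd] := Hu _ t0; have [_ c0 _] := Hd _ (center _ t0).
  have [i it] := hb_cover hB t0; have oi := @hb_open _ _ _ hB i.
  (* The coefficient of V against the continuous lift u, since eta(u, u) = 1 / N; its continuity is
     read off in polar coordinates. *)
  pose g t := N%:R * tt_eta (V t) (u (pt s0 y0) t).
  pose kap := sgn R (m s0 y0 (+) sig (pt s0 y0) (pt s0 y0)).
  have Vloc s y : `|s - s0| < e -> `|y - y0| < e -> normc (pt s y - pt s0 y0) < d (pt s0 y0) ->
      V (pt s y) = (pt (s / 2) (y / 2) ^+ b * kap) *: u (pt s0 y0) (pt s y).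
    move=> se ye hd; rewrite VE uE // scalerA /q -!mulrA; congr (_ * _ *: _).
    rewrite /kap -(He s y se ye) sgn_addb -mulrA sgnK mulr1.
    by [].
  have gloc s y : `|s - s0| < e -> `|y - y0| < e -> normc (pt s y - pt s0 y0) < d (pt s0 y0) ->
      g (pt s y) = pt (s / 2) (y / 2) ^+ b * kap.
    move=> se ye hd; rewrite /g Vloc //; have [tC _ [_ nu]] := Hd _ hd.
    rewrite -{2}[u _ _]scale1r (eta_scale _ _ _ _ tC) nu mulr1.
    by rewrite mulrCA divff ?mulr1 // pnatr_eq0.
  have ss e' : 0 < e' -> `|s0 - s0| < e' by rewrite subrr normr0.
  have yy e' : 0 < e' -> `|y0 - y0| < e' by rewrite subrr normr0.
  have cg : ccont g (pt s0 y0).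
    have g0E : g (pt s0 y0) = pt (s0 / 2) (y0 / 2) ^+ b * kap by apply: gloc; [exact: ss|exact: yy|exact: center].
    rewrite ccontE => Q HQ0.
    have HQ : nbhs (pt (s0 / 2) (y0 / 2) ^+ b * kap : C^o) Q by rewrite -g0E.
    have cpow : ccont (fun z : C => z ^+ b * kap) (pt (s0 / 2) (y0 / 2)).
      apply: ccontM; last exact: ccont_cst.
      by case: (b); [exact: ccont_id|exact: ccont_cst].
    have [e1 e10 He1] := pt_cont (cpow _ HQ).
    have [e2 e20 He2] := pt_cont (ball_near _ t0).
    pose e' := Num.min e (Num.min e1 e2).
    have e'0 : 0 < e' by rewrite !lt_min e0 e10.
    have [d' d'0 Hd'] := pt_open s0 y0 e'0.
    apply/nbhsCP; exists d' => // t /Hd'[s [y [se ye ->]]].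
    move: se ye; rewrite !lt_min => /and3P[s1 s2 s3] /and3P[y1 y2 y3].
    have hd := He2 s y s3 y3.
    rewrite [(_ @^-1` _) _]/= gloc //.
    have half x x' : `|x - x'| < e1 -> `|x / 2 - x' / 2| < e1.
      move=> xe; rewrite -mulrBl normrM [`|2^-1|]ger0_norm ?invr_ge0 //.
      apply: le_lt_trans xe; rewrite ler_piMr // invf_le1 //.
      by rewrite ler1n.
    by apply: He1; exact: half.
  apply: (csec_chart tt it).
  apply: (@mxcont_near R _ _ (fun t => g t *: crd i t (u (pt s0 y0) t))); last first.
    by move=> k l; under eq_fun do rewrite mxE; exact (ccontM cg (c0 i it k l)).
  have [e2 e20 He2] := pt_cont (ball_near _ t0).
  pose e' := Num.min e e2.
  have e'0 : 0 < e' by rewrite !lt_min e0.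
  have [d' d'0 Hd'] := pt_open s0 y0 e'0.
  have N1 : \forall t \near (pt s0 y0 : C^o), V t = g t *: u (pt s0 y0) t.
    apply/nbhsCP; exists d' => // t /Hd'[s [y [se ye ->]]].
    move: se ye; rewrite !lt_min => /andP[s1 s2] /andP[y1 y2].
    have hd := He2 s y s2 y2.
    by rewrite gloc // -Vloc.
  have := open_near oi it; move: N1; apply: filterS2 => t Vt it'.
  by rewrite Vt (lin_Z (crd_lin hB it')).
- move=> t t0; rewrite /V /ph (lin_Z (Phi_linear tt t0 1)) -/(ph _) (LA t0).1 !scalerA.
  by rewrite mulrC.
- move=> t t0; exists (q (P t).1 (P t).2) => //.
  rewrite [in RHS](HP t t0) /q mulrACA sgnK mulr1 -exprMn -ptD -!splitr.
  by [].
move=> E; rewrite /b.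
have : rho (2%:R * pi) 1 = rho 0 1.
  (* The sign is a function on the total space, so an equality of points there suffices and the base
     points need not be matched by hand. *)
  exact: (congr1 (fun p : total_space D => `[< projT2 p = - A (projT1 p) >]) E).
by move=> ->; rewrite addbb.
Qed.
End GlobalSection.

(** * The cyclic frame *)

Section FibreFrame.
Variable R : realType.
Local Notation C := R[i].
Variables (n : nat) (D : ttdata R n.+1) (tt : is_ttstar D).
Let hB := tt_bundle tt.
Local Notation N := n.+1.
Local Notation w := (omega R n).
Variables (S : forall t, fib D t -> fib D t) (S_iso : @is_iso R N D (scale_Phi w D) S).

Let wN : w ^+ N = 1 := prim_expr_order (omega_prim R n).
Let w0 : w != 0.
Proof. by rewrite -unitfE -(unitrX_pos _ (ltn0Sn n)) wN unitr1. Qed.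

Section AtPoint.
Variables (t : C) (t0 : Cstar t).

Lemma met_scale (a b : fib D t) x z : tt_met (x *: a) (z *: b) = conjc x * z * tt_met a b.
Proof.
rewrite (sca_Z (met_scalar tt t0 _)) (met_herm tt t0) (sca_Z (met_scalar tt t0 _)) rmorphM.
by rewrite [tt_met a b](met_herm tt t0) mulrA [z * _]mulrC.
Qed.

Lemma met_sum (I J : Type) (r : seq I) (q : seq J) (F : I -> fib D t) (G : J -> fib D t) :
  tt_met (\sum_(i <- r) F i) (\sum_(j <- q) G j) = \sum_(i <- r) \sum_(j <- q) tt_met (F i) (G j).
Proof.
rewrite (met_herm tt t0) (sca_sum (met_scalar tt t0 _)) rmorph_sum; apply: eq_bigr => i _.
by rewrite -(sca_sum (met_scalar tt t0 _)) [RHS](met_herm tt t0).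
Qed.

Lemma eta_sum (I J : Type) (r : seq I) (q : seq J) (F : I -> fib D t) (G : J -> fib D t) :
  tt_eta (\sum_(i <- r) F i) (\sum_(j <- q) G j) = \sum_(i <- r) \sum_(j <- q) tt_eta (F i) (G j).
Proof.
rewrite (eta_sym tt t0) (sca_sum (eta_scalar tt t0 _)); apply: eq_bigr => i _.
by rewrite (eta_sym tt t0) (sca_sum (eta_scalar tt t0 _)).
Qed.

Lemma S_sum (I : Type) (r : seq I) (F : I -> fib D t) :
  S (\sum_(i <- r) F i) = \sum_(i <- r) S (F i).
Proof. exact: (lin_sum (S_lin S_iso t0)). Qed.

Lemma iterS_Z k x (a : fib D t) : iter k (@S t) (x *: a) = x *: iter k (@S t) a.
Proof. by elim: k => [//|k IH] /=; rewrite IH (lin_Z (S_lin S_iso t0)). Qed.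

Lemma iterS_eta k (a b : fib D t) : tt_eta (iter k (@S t) a) (iter k (@S t) b) = tt_eta a b.
Proof. by elim: k => [//|k IH] /=; rewrite (S_eta S_iso _ _ t0). Qed.

Variables (mu : C) (mu0 : mu != 0).

Lemma ph_iterS k (a : fib D t) : ph a = mu *: a ->
  ph (iter k (@S t) a) = (w^-1 ^+ k * mu) *: iter k (@S t) a.
Proof.
move=> Ha; elim: k => [|k IH]; first by rewrite expr0 mul1r.
rewrite iterS; have := S_ph S_iso (iter k (@S t) a) t0; rewrite IH (lin_Z (S_lin S_iso t0)) => E.
by rewrite exprS -mulrA -[RHS]scalerA E scalerA mulVf // scale1r.
Qed.

Lemma eigen_orth (a b : fib D t) x z : ph a = x *: a -> ph b = z *: b -> x != z -> tt_eta a b = 0.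
Proof.
move=> Ha Hb xz; have := Phi_selfadj tt t0 1 a b.
rewrite -!/(ph _) Ha Hb (sca_Z (eta_scalar tt t0 _)) (eta_sym tt t0) (sca_Z (eta_scalar tt t0 _)).
rewrite (eta_sym tt t0 b) => /eqP; rewrite -subr_eq0 -mulrBl mulf_eq0 subr_eq0 (negbTE xz).
by move=> /eqP.
Qed.

Lemma iterS_orth k l (a : fib D t) : ph a = mu *: a -> (k < N)%N -> (l < N)%N -> k != l ->
  tt_eta (iter k (@S t) a) (iter l (@S t) a) = 0.
Proof.
move=> Ha kN lN kl; apply: eigen_orth (ph_iterS k Ha) (ph_iterS l Ha) _.
apply: contra_neq kl => /(mulIf mu0); rewrite !exprVn => /invr_inj/eqP.
by rewrite (eq_prim_root_expr (omega_prim R n)) !modn_small // => /eqP.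
Qed.

(* For a in the mu-eigenline and s with S^N a = s^N a, the vectors fr s j a
   (j < N) form a cyclic basis for ph / mu which diagonalises S. *)
Definition fr (s : C) (j : nat) (a : fib D t) : fib D t :=
  \sum_(k < N) ((s * w ^+ j)^-1 ^+ k) *: iter k (@S t) a.

Lemma fr_scale s j x a : fr s j (x *: a) = x *: fr s j a.
Proof.
rewrite /fr scaler_sumr; apply: eq_bigr => k _.
by rewrite iterS_Z !scalerA mulrC.
Qed.

Lemma fr_mod s j a : fr s (j %% N) a = fr s j a.
Proof. by rewrite /fr (expr_mod _ wN). Qed.

Lemma ph_fr s j a : ph a = mu *: a -> ph (fr s j a) = mu *: fr s j.+1 a.
Proof.
move=> Ha; rewrite /fr /ph (lin_sum (Phi_linear tt t0 1)) scaler_sumr; apply: eq_bigr => k _.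
rewrite (lin_Z (Phi_linear tt t0 1)) -/(ph _) (ph_iterS k Ha) !scalerA; congr (_ *: _).
have -> : (s * w ^+ j.+1)^-1 = (s * w ^+ j)^-1 * w^-1 by rewrite exprSr mulrA invfM.
by move: (s * _)^-1 w^-1 => x z; rewrite exprMn mulrA mulrC.
Qed.

Variables (s : C) (s0 : s != 0).

Let z0 j : s * w ^+ j != 0. Proof. by rewrite mulf_neq0 ?expf_neq0. Qed.

Lemma S_fr j (a : fib D t) : iter N (@S t) a = s ^+ N *: a -> S (fr s j a) = (s * w ^+ j) *: fr s j a.
Proof.
move=> Ha; rewrite /fr S_sum scaler_sumr.
pose tau k := (s * w ^+ j) *: (((s * w ^+ j)^-1 ^+ k) *: iter k (@S t) a).
transitivity (\sum_(k < N) tau k.+1).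
  apply: eq_bigr => k _; rewrite (lin_Z (S_lin S_iso t0)) -iterS /tau scalerA.
  by rewrite [in RHS]exprS mulrA divff // mul1r.
rewrite big_ord_recr [RHS]big_ord_recl /= [LHS]addrC.
(* S shifts the sum by one index; the term that leaves at the top re-enters at the bottom because
   S^N a = s^N a and (s w^j)^N = s^N. *)
suff -> : tau n.+1 = tau 0%N by [].
rewrite /tau Ha expr0 scale1r; congr (_ *: _); rewrite scalerA.
have -> : (s * w ^+ j)^-1 ^+ N = (s ^+ N)^-1.
  have wj : (w ^+ j) ^+ N = 1 by rewrite exprAC wN expr1n.
  by rewrite exprVn (exprMn_comm _ (mulrC _ _)) wj mulr1.
by rewrite mulVf ?scale1r // expf_neq0.
Qed.

Lemma fr_eta i j (a : fib D t) q : ph a = mu *: a -> iter N (@S t) a = s ^+ N *: a ->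
  tt_eta a a = q / N%:R ->
  tt_eta (fr s i a) (fr s j a) = if s ^+ 2 * w ^+ (i + j) == 1 then q else 0.
Proof.
move=> Ha HN Hq; case: eqP => [E|/eqP E].
  rewrite /fr eta_sum.
  transitivity (\sum_(k < N) tt_eta a a); last first.
    by rewrite sumr_const card_ord Hq -[LHS]mulr_natr divfK // pnatr_eq0.
  apply: eq_bigr => k _; rewrite (bigD1 k) //= big1 => [|l lk].
    rewrite addr0 (eta_scale tt _ _ _ _ t0) iterS_eta -exprMn -invfM.
    have -> : s * w ^+ i * (s * w ^+ j) = s ^+ 2 * w ^+ (i + j) by rewrite exprD; ring.
    by rewrite E invr1 expr1n mul1r.
  rewrite (eta_scale tt _ _ _ _ t0) (iterS_orth Ha) ?mulr0 //.
  by rewrite eq_sym.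
have := S_eta S_iso (fr s i a) (fr s j a) t0.
rewrite !S_fr // (eta_scale tt _ _ _ _ t0).
have -> : s * w ^+ i * (s * w ^+ j) = s ^+ 2 * w ^+ (i + j) by rewrite exprD; ring.
move=> /eqP; rewrite -[X in _ == X]mul1r -subr_eq0 -mulrBl mulf_eq0 subr_eq0 (negbTE E).
by move=> /eqP.
Qed.

(** S is unitary for the metric, and the two vectors are eigenvectors of S for distinct eigenvalues
    of modulus 1. *)
Lemma fr_met i j (a : fib D t) : iter N (@S t) a = s ^+ N *: a -> conjc s * s = 1 ->
  (i < N)%N -> (j < N)%N -> i != j -> tt_met (fr s i a) (fr s j a) = 0.
Proof.
move=> HN ss iN jN ij.
have := S_met S_iso (fr s i a) (fr s j a) t0.
have ww k : conjc w ^+ k * w ^+ k = 1 by rewrite -exprMn omegaE cis_conj expr1n.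
rewrite !S_fr // met_scale rmorphM rmorphXn /= mulrACA ss mul1r.
move=> /eqP; rewrite -[X in _ == X]mul1r -subr_eq0 -mulrBl mulf_eq0 => /orP[|/eqP //].
rewrite subr_eq0 => /eqP E; case/negP: ij.
have : w ^+ i = w ^+ j.
  by rewrite -[RHS]mul1r -(ww i) mulrAC E mul1r.
by move=> /eqP; rewrite (eq_prim_root_expr (omega_prim R n)) !modn_small.
Qed.
End AtPoint.
End FibreFrame.

(** * Constancy of signs and rotation invariance of the metric *)

Section Invariance.
Variable R : realType.
Local Notation C := R[i].

Lemma near_constant (b : C -> bool) :
  (forall t, t != 0 -> \forall s \near (t : C^o), b s = b t) ->
  forall t u, t != 0 -> u != 0 -> b t = b u.
Proof.
move=> H t u t0 u0; have [s [y ->]] := pt_surj t0; have [s' [y' ->]] := pt_surj u0.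
have inT (x : R) : x \in `]-oo, +oo[ by rewrite in_itv.
transitivity (b (pt s' y)).
  apply: (@locally_constant_near _ _ (fun s => b (pt s y)) `]-oo, +oo[) => // x _.
  by have := pt_near_s (H _ (pt_neq0 x y)); apply: filterS.
apply: (@locally_constant_near _ _ (fun y => b (pt s' y)) `]-oo, +oo[) => // x _.
by have := pt_near_y (H _ (pt_neq0 s' x)); apply: filterS.
Qed.

Variables (n : nat) (D : ttdata R n.+1) (tt : is_ttstar D).
Let hB := tt_bundle tt.
Local Notation N := n.+1.
Local Notation w := (omega R n).
Variables (S : forall t, fib D t -> fib D t) (S_iso : @is_iso R N D (scale_Phi w D) S).
Variable T : forall (y : R) (t : C), fib D (cexp (0 +i* y) * t) -> fib D t.
Hypothesis T_iso : forall y : R,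
  @is_iso R N (scale_Phi (cexp (- (0 +i* y))) (pullback (0 +i* y) D)) D (@T y).
Hypothesis T_cont : forall (t : C) (a : fib D t), Cstar t ->
  continuous_curve (fun y : R => map_at (@T y) a).
Local Notation rot y a := (@rot R n D T y _ a).

Lemma iterS_csec k (V : forall t, fib D t) t : Cstar t -> csec V t ->
  csec (fun t => iter k (@S t) (V t)) t.
Proof.
move=> t0 cV; elim: k => [//|k IH] i it.
have oi := @hb_open _ _ _ hB i.
apply: (@mxcont_near _ _ _ (fun s => sg_mx S i s *m crd i s (iter k (@S s) (V s)))).
  have := open_near oi it; apply: filterS => s si.
  by rewrite iterS (crd_S tt S_iso si).
by apply: mxcont_mul (IH i it); exact: mxholo_cont (sg_holo S_iso i) it.
Qed.

Variables (mu : C) (mu0 : mu != 0).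
Variables (A : forall t, fib D t) (LA : forall t, Cstar t -> lift mu (A t)).

Let wN : w ^+ N = 1 := prim_expr_order (omega_prim R n).
Let w0 : w != 0.
Proof. by rewrite -unitfE -(unitrX_pos _ (ltn0Sn n)) wN unitr1. Qed.

Let Ninv0 : (N%:R^-1 : C) != 0. Proof. by rewrite invr_eq0 pnatr_eq0. Qed.

(** The sign by which S^N acts on the eigenline does not depend on the vector, so it is read off
    from the continuous section V; the factor N t^-b cancels eta(V, V). *)
Lemma S_order (b : bool) (V : forall t, fib D t) : (forall t, Cstar t -> csec V t) ->
  (forall t, Cstar t -> exists2 x, V t = x *: A t & x * x = t ^+ b) ->
  exists d : bool, forall t, Cstar t -> iter N (@S t) (A t) = sgn R d *: A t.
Proof.
move=> cV VA.
pose e t := sign_of (iter N (@S t) (A t)) (A t).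
have eE t : Cstar t -> iter N (@S t) (A t) = sgn R (e t) *: A t.
  move=> t0; apply: (lift_sign tt S_iso mu0 t0) (LA t0).
  have [pA nA] := LA t0; split; last by rewrite (iterS_eta S_iso t0).
  by rewrite (ph_iterS S_iso t0 N pA) exprVn wN invr1 mul1r.
exists (e 1) => t t0; rewrite eE //; congr (sgn R _ *: _).
apply: (@near_constant e _ t 1 t0 (oner_neq0 _)) => {t0}t t0.
pose f t := N%:R * t ^- b * tt_eta (iter N (@S t) (V t)) (V t).
have fE t' : Cstar t' -> f t' = sgn R (e t') * 1.
  move=> t'0; rewrite /f; have [x -> xx] := VA t' t'0.
  rewrite (iterS_Z S_iso t'0) eE // scalerA (eta_scale tt _ _ _ _ t'0).
  rewrite (LA t'0).2 [x * _ * x]mulrAC xx; move: (sgn R _) => z.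
  have N0 : (N%:R : C) != 0 by rewrite pnatr_eq0.
  have u0 : t' ^+ b != 0 by rewrite expf_neq0.
  by move: (t' ^+ b) u0 => u u0; move: (N%:R) N0 => m m0; field; rewrite u0 m0.
apply: (@sgn_const_near R f e t 1 (oner_neq0 _) (fE t t0)); last first.
  by have := open_near (@open_Cstar R) t0; apply: filterS => s; exact: fE.
have c1 : ccont (fun s : C => s ^- b) t.
  have ci := ccontV t0 (@ccont_id R t); case: (b).
    by apply: (@ccont_near R _ _ t _ ci); near=> s; rewrite /= expr1.
  by apply: (@ccont_near R _ _ t _ (@ccont_cst R 1 t)); near=> s; rewrite /= expr0 invr1.
have c2 : ccont (fun s => tt_eta (iter N (@S s) (V s)) (V s)) t.
  by apply: (eta_cont tt t0); [apply: iterS_csec => //; exact: cV|exact: cV].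
exact (ccontM (ccontM (@ccont_cst R N%:R t) c1) c2).
Unshelve. all: by end_near. Qed.

(** Both sides are lifts for the eigenvalue w^-k mu and so agree up to sign. Their eta-product is
    continuous in y, whence d may depend on k and t but not on y. *)
Lemma iterS_rot k t : Cstar t -> exists d : bool, forall y,
  iter k (@S _) (rot y (A t)) = sgn R d *: rot y (iter k (@S t) (A t)).
Proof.
move=> t0.
pose muk := w^-1 ^+ k * mu.
have muk0 : muk != 0 by rewrite mulf_neq0 // expf_neq0 // invr_eq0.
have L1 y : lift muk (iter k (@S _) (rot y (A t))).
  have yt0 := Cstar_cis y t0.
  have [pA nA] := rot_lift tt T_iso y t0 (LA t0).
  by split; [exact: ph_iterS|rewrite (iterS_eta S_iso yt0)].
have L2 y : lift muk (rot y (iter k (@S t) (A t))).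
  apply: (rot_lift tt T_iso y t0); have [pA nA] := LA t0.
  by split; [exact: ph_iterS|rewrite (iterS_eta S_iso t0)].
pose e y := sign_of (iter k (@S _) (rot y (A t))) (rot y (iter k (@S t) (A t))).
have eE y : iter k (@S _) (rot y (A t)) = sgn R (e y) *: rot y (iter k (@S t) (A t)).
  exact: (lift_sign tt S_iso muk0 (Cstar_cis y t0)).
exists (e 0) => y; rewrite eE; congr (sgn R _ *: _).
have inT (x : R) : x \in `]-oo, +oo[ by rewrite in_itv.
apply: (@locally_constant_near _ _ e `]-oo, +oo[) => // x _.
pose f y := tt_eta (iter k (@S _) (rot y (A t))) (rot y (iter k (@S t) (A t))).
have fE y' : f y' = sgn R (e y') * N%:R^-1.
  rewrite /f eE -[X in tt_eta _ X]scale1r (eta_scale tt _ _ _ _ (Cstar_cis y' t0)) mulr1.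
  by rewrite (L2 y').2.
suff : \forall z \near (x : R^o), e z = e x by apply: filterS.
apply: (@sgn_const_nearR R f e x _ Ninv0 (fE x)); last by near=> z; exact: fE.
apply: (curve_eta tt T_cont t0); last exact: (rot_curve T_cont).
apply: (S_curve tt S_iso T_cont t0); exact: (rot_curve T_cont).
Unshelve. all: by end_near. Qed.

Lemma iterS_met_rot k l t y : Cstar t ->
  tt_met (iter k (@S _) (A (cis y * t))) (iter l (@S _) (A (cis y * t))) =
  tt_met (iter k (@S _) (A t)) (iter l (@S _) (A t)).
Proof.
move=> t0; have [d Hd] := iterS_rot k t0; have [d' Hd'] := iterS_rot l t0.
have E z : tt_met (iter k (@S _) (A (cis z * t))) (iter l (@S _) (A (cis z * t))) =
    sgn R d * sgn R d' * tt_met (iter k (@S _) (A t)) (iter l (@S _) (A t)).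
  have zt0 := Cstar_cis z t0.
  have Az : A (cis z * t) = sgn R (sign_of (A (cis z * t)) (rot z (A t))) *: rot z (A t).
    exact: (lift_sign tt S_iso mu0 zt0 (LA zt0) (rot_lift tt T_iso z t0 (LA t0))).
  rewrite Az; move: (sign_of _ _) => c.
  rewrite !(iterS_Z S_iso zt0) (met_scale tt zt0) sgnJ sgnK mul1r Hd Hd'.
  by rewrite (met_scale tt zt0) sgnJ (rot_met T_iso z t0).
(* T_0 need not be the identity, but E at z = 0 still compares t with itself. *)
by rewrite E -(E 0) cis0 mul1r.
Qed.

Lemma fr_met_rot s j t y : Cstar t ->
  tt_met (fr S s j (A (cis y * t))) (fr S s j (A (cis y * t))) =
  tt_met (fr S s j (A t)) (fr S s j (A t)).
Proof.
move=> t0; have yt0 := Cstar_cis y t0.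
rewrite /fr (met_sum tt t0) (met_sum tt yt0); apply: eq_bigr => k _; apply: eq_bigr => l _.
by rewrite (met_scale tt t0) (met_scale tt yt0) iterS_met_rot.
Qed.

Lemma fr_met_radial s j t u : Cstar t -> Cstar u -> normc t = normc u ->
  tt_met (fr S s j (A t)) (fr S s j (A t)) = tt_met (fr S s j (A u)) (fr S s j (A u)).
Proof.
move=> t0 u0 tu.
have nu0 : normc u != 0 by rewrite gt_eqF // normc_gt0.
have [y yE] : exists y, t / u = cis y.
  by apply: cis_surj; rewrite normcM normcV // tu divff.
by rewrite -(fr_met_rot s j y u0) -yE divfK.
Qed.
End Invariance.

(** * The Toda equation *)

Section FrameAlgebra.
Variables (F : comUnitRingType) (n : nat).
Implicit Types P Q X Y B : 'M[F]_n.
Lemma frame_eq P' Q P X Y B : P' *m Q \in unitmx ->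
  P' *m Q *m P *m B = P' *m (Q *m X) *m P + P' *m Q *m Y -> P *m B = X *m P + Y.
Proof.
move=> Qu E; apply: (can_inj (mulKmx Qu)).
by rewrite mulmxA E mulmxDr !mulmxA.
Qed.

Lemma frame_adj P' Q P X Y G : Q \in unitmx -> P' \in unitmx ->
  P' *m Q *m P *m G = X *m (P' *m Q *m P) -> X *m P' = P' *m Y -> P *m G = invmx Q *m Y *m Q *m P.
Proof.
move=> Qu Pu E XY; apply: (can_inj (mulKmx Qu)); apply: (can_inj (mulKmx Pu)).
by rewrite !mulmxA (mulmxK Qu) -XY E !mulmxA.
Qed.

Lemma frame_commutator P X Y G H Z : P \in unitmx -> P *m X = G *m P -> P *m Y = H *m P ->
  P *m Z = (G *m H - H *m G) *m P -> Z = X *m Y - Y *m X.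
Proof.
move=> Pu PX PY E; apply: (can_inj (mulKmx Pu)); rewrite E mulmxBl mulmxBr.
by rewrite !(mulmxA P) PX PY -!mulmxA PX PY.
Qed.
End FrameAlgebra.

(** * Flatness in a cyclic frame *)

Section Gauge.
Variable R : realType.
Local Notation C := R[i].
Variables (n : nat) (U : set C) (H phi : C -> 'M[C]_n.+1).
Hypotheses (oU : open (U : set C^o)) (Hg : mxgen U H) (phih : mxholo U phi)
  (Hp : forall t, U t -> posdef (H t)).
Hypothesis flat : forall lambda : C, lambda = 1 \/ lambda = -1 -> forall t, U t ->
  dmx_t (fun s => lambda *: dag (H s) (phi s)) t -
  dmx_tbar (fun s => invmx (H s) *m dmx_t H s + lambda^-1 *: phi s) t
  + (invmx (H t) *m dmx_t H t + lambda^-1 *: phi t) *m (lambda *: dag (H t) (phi t))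
  - (lambda *: dag (H t) (phi t)) *m (invmx (H t) *m dmx_t H t + lambda^-1 *: phi t) = 0.

Lemma adj0 : adj (0 : 'M[C]_n.+1) = 0.
Proof. by rewrite /adj map_mx0 trmx0. Qed.

(** The tt*-equation after the holomorphic change of frame P. K, B, F and G are the metric, the
    Chern form, phi and its adjoint in the new frame, each characterised by an equation free of
    inverses. *)
Lemma gauge (P K B F G : C -> 'M[C]_n.+1) : mxholo U P -> (forall t, U t -> P t \in unitmx) ->
  (forall t, U t -> K t = adj (P t) *m H t *m P t) ->
  mxgen U B -> (forall t, U t -> K t *m B t = dmx_t K t) ->
  (forall t, U t -> P t *m F t = phi t *m P t) ->
  (forall t, U t -> K t *m G t = adj (F t) *m K t) ->
  forall t, U t -> dmx_tbar B t = F t *m G t - G t *m F t.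
Proof.
move=> hP uP KE gB KB PF KG t Ut.
have PB s : U s -> P s *m B s = invmx (H s) *m dmx_t H s *m P s + dmx_t P s.
  move=> Us; have Pu := uP s Us; have Hu := posdef_unit (Hp Us).
  have W := mxW_mul (mxW_mul (mxW_adj (mxholo_W oU hP Us)) (HW oU Hg Hp Us)) (mxholo_W oU hP Us).
  have [KW _] := mxW_dmx (mxW_near (open_near_eq oU (fun u Uu => esym (KE u Uu)) Us) W).
  have := KB s Us; rewrite KW KE //.
  move: (invmx (H s) *m dmx_t H s) (dmx_t P s) => X Y.
  rewrite adj0 mul0mx add0r => E.
  have Q : adj (P s) *m H s \in unitmx by rewrite unitmx_mul adj_unit Pu.
  exact: frame_eq Q E.
have PG : P t *m G t = dag (H t) (phi t) *m P t.
  have Pu := uP t Ut; have Hu := posdef_unit (Hp Ut).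
  have Pa : adj (P t) \in unitmx by rewrite adj_unit.
  have E := KG t Ut; rewrite KE // in E.
  apply: (frame_adj Hu Pa E); rewrite -!adjM PF //.
have W1 := mxW_mul (mxholo_W oU hP Ut) (mxgen_mxW oU gB Ut).
have [AW _] := flat_eqs oU Hg phih Hp flat Ut.
have W2 := mxWD (mxW_mul AW (mxholo_W oU hP Ut)) (mxholo_W oU (mxholo_dt oU hP) Ut).
have [_] := mxW_unique (mxW_near (open_near_eq oU PB Ut) W1) W2.
rewrite mul0mx add0r mulmx0 !addr0 => E.
exact: (frame_commutator (uP t Ut) (PF t Ut) PG E).
Qed.

Variables (P : C -> 'M[C]_n.+1) (g : 'I_n.+1 -> C -> C) (mu : C).
Hypotheses (hP : mxholo U P) (uP : forall t, U t -> P t \in unitmx).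
Hypothesis KE : forall t, U t -> \matrix_(k, l) (g k t *+ (k == l)) = adj (P t) *m H t *m P t.
Hypothesis g0 : forall j t, U t -> g j t != 0.
Hypothesis PF : forall t, U t -> P t *m \matrix_(k, l) (mu *+ (k == ordS l)) = phi t *m P t.

Lemma diag_gen j : gen U (g j).
Proof.
have := mxgen_mul (mxgen_mul (mxgen_adj (mxholo_gen hP)) Hg) (mxholo_gen hP) j j.
apply: gen_eq => t Ut; rewrite -KE // mxE eqxx.
by [].
Qed.

Lemma dlog_gen j : gen U (fun s => d_t (g j) s / g j s).
Proof.
apply: gen_mul; first exact: gen_dt oU _ (diag_gen j).
by apply: gen_inv (diag_gen j) => t; exact: g0.
Qed.

Lemma gen0 : gen U (fun=> 0). Proof. exact: gen_cst. Qed.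

(** For a diagonal metric the Chern form is diagonal with entries d log g_j, and the adjoint of the
    cyclic shift is the backward shift weighted by quotients of the g_j. The diagonal of the
    tt*-equation is the Toda equation for log g_j with the extra factor |mu|^2. *)
Lemma cyclic_flat j t : U t -> d_tbar (fun s => d_t (g j) s / g j s) t =
  mu * conjc mu * (g j t / g (ord_pred j) t - g (ordS j) t / g j t).
Proof.
move=> Ut.
pose K s : 'M[C]_n.+1 := \matrix_(k, l) (g k s *+ (k == l)).
pose B s : 'M[C]_n.+1 := \matrix_(k, l) ((d_t (g k) s / g k s) *+ (k == l)).
pose F : 'M[C]_n.+1 := \matrix_(k, l) (mu *+ (k == ordS l)).
pose G s : 'M[C]_n.+1 := \matrix_(k, l) ((conjc mu * g l s / g k s) *+ (l == ordS k)).
have gB : mxgen U B.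
  move=> k l; under eq_fun do rewrite mxE.
  by case: (k == l); [exact: dlog_gen|exact: gen0].
have KB s : U s -> K s *m B s = dmx_t K s.
  move=> Us; apply/matrixP => k l; rewrite !mxE (bigD1 k) //= big1 => [|m mk]; last first.
    by rewrite !mxE eq_sym (negbTE mk) mul0r.
  have -> : (fun s => K s k l) = if k == l then g k else fun=> 0.
    by apply/funext => u; rewrite mxE; case: (k == l).
  rewrite !mxE eqxx addr0; case: (k == l).
    by rewrite mulr1n mulrC divfK // g0.
  rewrite mulr0; apply/esym; exact: (isW_dt (isW_cst 0 s)).
have KG s : U s -> K s *m G s = adj F *m K s.
  move=> Us; apply/matrixP => k l; rewrite !mxE.
  rewrite (bigD1 k) //= big1 => [|m mk]; last first.
    by rewrite !mxE eq_sym (negbTE mk) mul0r.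
  rewrite (bigD1 l) //= big1 => [|m mk]; last first.
    by rewrite !mxE (negbTE mk) mulr0.
  rewrite !mxE !eqxx !addr0 !mulr1n; case: (l == ordS k); last by rewrite !mulr0n conjc0 mulr0 mul0r.
  by rewrite !mulr1n mulrC divfK // g0.
have := gauge hP uP KE gB KB PF KG Ut.
move=> /matrixP/(_ j j); rewrite [LHS]mxE.
have -> : (fun s => B s j j) = (fun s => d_t (g j) s / g j s).
  by apply/funext => u; rewrite mxE eqxx.
move=> ->; rewrite !mxE.
rewrite (bigD1 (ord_pred j)) //= big1 => [|m mj]; last first.
  rewrite !mxE; case: eqP => [jm|_]; last by rewrite mul0r.
  by rewrite jm ordSK eqxx in mj.
rewrite (bigD1 (ordS j)) //= [X in _ - (_ + X)]big1 => [|m mj]; last first.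
  by rewrite !mxE (negbTE mj) mul0r.
by rewrite !mxE ord_predK !eqxx !mulr1n !addr0; ring.
Qed.

(* Since L is real, the order of the two derivatives is irrelevant; the term in
   log |t|^2 is harmonic. *)
Lemma toda_local (j : 'I_n.+1) (c : R) (t : C) : U t -> U `<=` Cstar ->
  (forall j t, U t -> 0 < g j t) ->
  let L s := (ln (complex.Re (g j s)))%:C - c%:C * (ln (complex.Re (s * conjc s)))%:C in
  gen U L /\
  d_t (d_tbar L) t = mu * conjc mu * (g j t / g (ord_pred j) t - g (ordS j) t / g j t).
Proof.
move=> Ut UC gp L.
have ss s : U s -> 0 < s * conjc s.
  move=> /UC s0; rewrite -normCK; rewrite exprn_gt0 // normr_gt0.
  exact: s0.
have gn : gen U (fun s => s * conjc s) by apply: gen_mul; [exact: gen_id|apply: gen_conj; exact: gen_id].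
have gl := gen_ln (fun s Us => gp j s Us) (diag_gen j).
have gl2 := gen_ln ss gn.
have gL : gen U L.
  apply: gen_add => //; apply: gen_opp; apply: gen_mul gl2; exact: gen_cst.
split=> //.
have LW s : U s -> isW L s (d_t (g j) s / g j s - c%:C / s) (d_tbar L s).
  move=> Us.
  have W1 : isW (fun s => (ln (complex.Re (g j s)))%:C) s (d_t (g j) s / g j s) (d_tbar (g j) s / g j s).
    apply: isW_ln; last exact (gen_isW oU (diag_gen j) Us).
    by have := open_near oU Us; apply: filterS => u; exact: gp.
  have W2 : isW (fun s => (ln (complex.Re (s * conjc s)))%:C) s (conjc s / (s * conjc s)) (s / (s * conjc s)).
    apply: isW_ln; first by have := open_near oU Us; apply: filterS => u; exact: ss.
    apply: isW_eq (isWM (isW_id s) (isWJ (isW_id s))) _ _.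
      by rewrite conjc0 mulr0 addr0 mul1r.
    by rewrite conjc1 mulr1 mul0r add0r.
  have W3 := isWD W1 (isWM (isW_cst (- (c%:C)) s) W2).
  have s0 := UC s Us.
  have sJ0 : conjc s != 0 by rewrite conjc_eq0.
  have W4 : isW L s (d_t (g j) s / g j s - c%:C / s)
     (d_tbar (g j) s / g j s - c%:C * (s / (s * conjc s))).
    have -> : L = fun s => (ln (complex.Re (g j s)))%:C + - (c%:C) * (ln (complex.Re (s * conjc s)))%:C.
      by apply/funext => u; rewrite /L mulNr.
    apply: isW_eq W3 _ _; rewrite mul0r add0r mulNr //; congr (_ - _ * _).
    by rewrite invfM mulrCA divff // mulr1.
  by have -> : d_tbar L s = _ := isW_dtb W4.
have LJ s : U s -> d_tbar L s = conjc (d_t (g j) s / g j s - c%:C / s).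
  move=> Us; have := isWJ (LW s Us).
  have -> : (fun s => conjc (L s)) = L.
    by apply/funext => u; rewrite /L; apply: eqC; rewrite !reE /=; ring.
  by move=> W; have [_ ->] := isW_unique (LW s Us) W.
(* This is d_t L; its second term is holomorphic, so [cyclic_flat] gives d_tbar M. *)
pose M s := d_t (g j) s / g j s - c%:C / s.
have MW : isW M t (d_t M t) (mu * conjc mu * (g j t / g (ord_pred j) t - g (ordS j) t / g j t)).
  have W1 := isW_eq (gen_isW oU (dlog_gen j) Ut) erefl (cyclic_flat j Ut).
  have W2 := isWD W1 (isWM (isW_cst (- (c%:C)) t) (isWV (UC t Ut) (isW_id t))).
  have E : (fun s => d_t (g j) s / g j s + - (c%:C) * s^-1) = M.
    by apply/funext => u; rewrite /M mulNr.
  rewrite E in W2; have -> : d_t M t = _ := isW_dt W2.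
  by apply: isW_eq W2 erefl _; ring.
have W := isW_near (open_near_eq oU (fun s Us => esym (LJ s Us)) Ut) (isWJ MW).
rewrite (isW_dt W) rmorphM rmorphB /= !rmorphM /= !conjc_inv conjcK.
have gJ i : conjc (g i t) = g i t.
  by have := gp i t Ut; rewrite lt_def => /andP[_]; move=> /ger0_real/CrealP.
by rewrite !gJ [conjc mu * _]mulrC.
Qed.
End Gauge.

(** * Indices modulo n + 1 *)

Section Indices.
Variable n : nat.
Local Notation N := n.+1.

Definition idx (j : int) : 'I_N := inord (absz (j %% N%:Z)%Z).

Lemma idx_eq (j : int) : exists q : int, j = (idx j)%:Z + q * N%:Z.
Proof.
exists (j %/ N%:Z)%Z; rewrite /idx inordK; last by lia.
by have := divz_eq j N%:Z; lia.
Qed.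

Lemma idxP (j : int) (k : 'I_N) q : j = k%:Z + q * N%:Z -> idx j = k.
Proof.
move=> ->; apply: val_inj; rewrite /idx /= addrC modzMDl modz_small; last by have := ltn_ord k; lia.
by rewrite inordK /=; have := ltn_ord k; lia.
Qed.

Lemma idx_ord (k : 'I_N) : idx (Posz k) = k.
Proof. by apply: (idxP (q := 0)); rewrite mul0r addr0. Qed.

Lemma idx_period j : idx (j + N%:Z) = idx j.
Proof. by have [q E] := idx_eq j; apply: (idxP (q := q + 1)); rewrite {1}E; ring. Qed.

Lemma idx_succ j : idx (j + 1) = ordS (idx j).
Proof.
have [q E] := idx_eq j; have := ltn_ord (idx j); move: (idx j) E => k E kN.
have [kn|kn] := ltnP k.+1 N.
  by apply: (idxP (q := q)); rewrite E /= modn_small //; lia.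
by apply: (idxP (q := q + 1)); rewrite E /= (_ : k.+1 = N) ?modnn; lia.
Qed.

Lemma idx_pred j : idx (j - 1) = ord_pred (idx j).
Proof. by rewrite -[j in RHS](subrK 1) idx_succ ordSK. Qed.

Variables (l : nat) (l_le : (l <= n)%N).

(** The involution i -> l - 1 - i modulo N, that is, the index with which eta pairs i. *)
Definition partner (i : 'I_N) : 'I_N := inord (if (i < l)%N then l.-1 - i else n + l - i)%N.

Lemma partnerE i : partner i = (if (i < l)%N then l.-1 - i else n + l - i)%N :> nat.
Proof. by have := ltn_ord i; rewrite /partner; case: ifP => il iN; rewrite inordK; lia. Qed.

Lemma toda_etaE (R : realType) (i j : 'I_N) : toda_eta R n l i j = (j == partner i)%:R.
Proof.
rewrite /toda_eta; congr (_ %:R); congr nat_of_bool; rewrite -val_eqE /= partnerE.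
have iN := ltn_ord i; have jN := ltn_ord j.
by case: ifP => il; lia.
Qed.

Lemma partnerK : involutive partner.
Proof.
move=> i; apply: val_inj; have iN := ltn_ord i.
move: (partnerE i) (partnerE (partner i)); move: (partner (partner i)) (partner i) => a c /=.
by case: (ltnP i l) => il ->; case: ifP => + ->; lia.
Qed.

Lemma idx_partner j : idx (l%:Z - j - 1) = partner (idx j).
Proof.
have [q E] := idx_eq j; have := ltn_ord (idx j); have := partnerE (idx j).
move: (idx j) (partner (idx j)) E => k k' E; case: ifP => kl kE kN.
  by apply: (idxP (q := - q)); lia.
by apply: (idxP (q := - q - 1)); lia.
Qed.
End Indices.

(** * From the cyclic frame to the Toda structure *)

Section CyclicFrame.
Variable R : realType.
Local Notation C := R[i].
Variables (n : nat) (D : ttdata R n.+1) (tt : is_ttstar D).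
Let hB := tt_bundle tt.
Local Notation N := n.+1.
Variables (e : 'I_N -> forall t, fib D t) (mu : C) (b : bool) (l : nat).
Hypotheses (l_le : (l <= n)%N) (mu0 : mu != 0).
Hypothesis e_holo : forall j i, mxholo (dom i) (fun t => crd i t (e j t)).
Hypothesis e_ph : forall j t, Cstar t -> ph (e j t) = mu *: e (ordS j) t.
Hypothesis e_eta : forall i j t, Cstar t -> tt_eta (e i t) (e j t) = t ^+ b * toda_eta R n l i j.
Hypothesis e_met : forall i j t, Cstar t -> i != j -> tt_met (e i t) (e j t) = 0.
Hypothesis e_radial : forall j t u, Cstar t -> Cstar u -> normc t = normc u ->
  tt_met (e j t) (e j t) = tt_met (e j u) (e j u).

Local Notation part := (@partner n l).
Definition fmet j t : C := tt_met (e j t) (e j t).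
(** The coordinate of a along e_j, obtained by duality: eta(e_(part j), e_j) = t^b, and all other
    products with e_(part j) vanish. *)
Definition fcoord t (a : fib D t) (j : 'I_N) : C := t ^- b * tt_eta (e (part j) t) a.

Section AtPoint.
Variables (t : C) (t0 : Cstar t).

Lemma tb0 : t ^+ b != 0. Proof. by rewrite expf_neq0. Qed.

Lemma fcoord_sum (v : 'I_N -> C) m : fcoord (\sum_j v j *: e j t) m = v m.
Proof.
rewrite /fcoord (sca_sum (eta_scalar tt t0 _)) (bigD1 m) //= big1 => [|j jm].
  rewrite (sca_Z (eta_scalar tt t0 _)) e_eta // toda_etaE // partnerK // eqxx.
  by rewrite addr0 mulr1 mulrCA mulVf ?mulr1 // tb0.
by rewrite (sca_Z (eta_scalar tt t0 _)) e_eta // toda_etaE // partnerK // (negbTE jm) !mulr0.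
Qed.

Lemma fcoord_lin m : scalar (fun a : fib D t => fcoord a m).
Proof. by move=> c u v; rewrite /fcoord (eta_scalar tt t0) mulrDr mulrCA. Qed.

Lemma fcoord_e j m : fcoord (e j t) m = (m == j)%:R.
Proof.
rewrite -[e j t](_ : \sum_k (k == j)%:R *: e k t = _); first exact: fcoord_sum.
rewrite (bigD1 j) //= eqxx scale1r big1 ?addr0 // => k kj.
by rewrite (negbTE kj) scale0r.
Qed.

Definition frame_mx (i : chart D) (t : C) : 'M[C]_N := \matrix_(k, j) crd i t (e j t) k 0.

Lemma frame_mxE i (v : 'cV[C]_N) : dom i t ->
  frame_mx i t *m v = crd i t (\sum_j v j 0 *: e j t).
Proof.
move=> it; rewrite (lin_sum (crd_lin hB it)); apply/matrixP => k z.
rewrite ord1 summxE !mxE; apply: eq_bigr => j _.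
by rewrite (lin_Z (crd_lin hB it)) !mxE mulrC.
Qed.

(** Pairing with the dual vectors recovers every coefficient, so the N vectors are independent. *)
Lemma frame_unit i : dom i t -> frame_mx i t \in unitmx.
Proof.
move=> it; rewrite -unitmx_tr -row_free_unit; apply: inj_row_free => v Hv.
have : crd i t (\sum_j v^T j 0 *: e j t) = 0.
  by rewrite -frame_mxE // -[LHS]trmxK trmx_mul trmxK Hv trmx0.
rewrite -(lin_0 (crd_lin hB it)) => /(crd_inj hB it) E.
apply/matrixP => z m; rewrite ord1 [RHS]mxE.
have := fcoord_sum (fun j => v^T j 0) m.
by rewrite E (sca_0 (fcoord_lin m)) mxE => ->.
Qed.

Lemma fcoordK (a : fib D t) : a = \sum_j fcoord a j *: e j t.
Proof.
have [i it] := hb_cover hB t0.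
pose v := invmx (frame_mx i t) *m crd i t a.
have E : a = \sum_j v j 0 *: e j t.
  by apply: (crd_inj hB it); rewrite -frame_mxE // mulKVmx // frame_unit.
rewrite {1}E; apply: eq_bigr => j _; congr (_ *: _).
by rewrite [in RHS]E fcoord_sum.
Qed.

Lemma fmet_gt0 j : 0 < fmet j t.
Proof.
apply: (met_pos tt t0); apply/eqP => E; have := fcoord_e j j.
rewrite E (sca_0 (fcoord_lin j)) eqxx => /eqP.
by rewrite eq_sym oner_eq0.
Qed.

Lemma fmet_real j : fmet j t = (complex.Re (fmet j t))%:C.
Proof.
have := fmet_gt0 j; case: (fmet j t) => x y; rewrite ltcE /= => /andP[/eqP y0 _].
by rewrite y0.
Qed.

Lemma fmet_Re_gt0 j : 0 < complex.Re (fmet j t).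
Proof. by have := fmet_gt0 j; rewrite fmet_real ltcR. Qed.

(* The real structure maps e_j to a multiple of its eta-dual vector. *)
Lemma fmet_partner j : fmet j t * fmet (part j) t = (t * conjc t) ^+ b.
Proof.
have [kappa [kg kk kD kZ]] := tt_real tt t0.
have ke m : kappa (e m t) = (t ^- b * fmet m t) *: e (part m) t.
  rewrite [LHS]fcoordK (bigD1 (part m)) //= big1 => [|k kj].
    by rewrite addr0 /fcoord (eta_sym tt t0) -kg partnerK.
  rewrite /fcoord (eta_sym tt t0) -kg e_met // ?mulr0 ?scale0r //.
  by apply: contra_neq kj => ->; rewrite partnerK.
have := kk (e j t); rewrite ke kZ ke scalerA partnerK // => /(congr1 (fun a => fcoord a j)).
rewrite (sca_Z (fcoord_lin j)) fcoord_e eqxx mulr1.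
rewrite rmorphM /= {1}fmet_real conjc_real -fmet_real => E.
have c0 : conjc (t ^- b) * t ^- b != 0 by rewrite mulf_neq0 ?conjc_eq0 // invr_eq0 tb0.
apply: (mulfI c0); rewrite mulrACA E.
rewrite conjc_inv rmorphXn /= -invfM -exprMn mulrC [conjc t * t]mulrC mulfV //.
by rewrite expf_neq0 // mulf_neq0 ?conjc_eq0.
Qed.

Lemma eta_fcoord (a c : fib D t) : tt_eta a c =
  t ^+ b * \sum_(i < N) \sum_(j < N) fcoord a i * toda_eta R n l i j * fcoord c j.
Proof.
rewrite {1}(fcoordK a) {1}(fcoordK c) (sca_sum (eta_scalar tt t0 _)) exchange_big mulr_sumr.
apply: eq_bigr => j _; rewrite (sca_Z (eta_scalar tt t0 _)) (eta_sym tt t0).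
rewrite (sca_sum (eta_scalar tt t0 _)) !mulr_sumr; apply: eq_bigr => i _.
by rewrite (sca_Z (eta_scalar tt t0 _)) (eta_sym tt t0) e_eta //; ring.
Qed.

Lemma met_fcoord (a c : fib D t) : tt_met a c =
  \sum_j conjc (fcoord a j) * fmet j t * fcoord c j.
Proof.
rewrite {1}(fcoordK c) (sca_sum (met_scalar tt t0 _)); apply: eq_bigr => j _.
rewrite (sca_Z (met_scalar tt t0 _)) mulrC; congr (_ * _).
rewrite (met_herm tt t0) {1}(fcoordK a) (sca_sum (met_scalar tt t0 _)) (bigD1 j) //= big1 => [|k kj].
  by rewrite addr0 (sca_Z (met_scalar tt t0 _)) rmorphM [fmet j t in RHS](met_herm tt t0).
by rewrite (sca_Z (met_scalar tt t0 _)) e_met ?mulr0 // eq_sym.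
Qed.

Lemma ph_fcoord (a : fib D t) : ph a = \sum_j (mu * fcoord a j) *: e (ordS j) t.
Proof.
rewrite {1}(fcoordK a) /ph (lin_sum (Phi_linear tt t0 1)); apply: eq_bigr => j _.
by rewrite (lin_Z (Phi_linear tt t0 1)) -/(ph _) e_ph // scalerA mulrC.
Qed.
End AtPoint.

Lemma normc_sqr (z : C) : complex.Re (z * conjc z) = normc z ^+ 2.
Proof.
have n0 : 0 <= complex.Re z ^+ 2 + complex.Im z ^+ 2 by rewrite addr_ge0 ?sqr_ge0.
by case: z n0 => x y /= n0; rewrite sqr_sqrtr // mulrN opprK !expr2.
Qed.

(** The logarithm of g(e_j, e_j) / |t|^b, with the factor of the sign twist divided out; |t| is
    entered through t conj t, which is polynomial in t and its conjugate. *)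
Definition flog j t : R := ln (complex.Re (fmet j t)) - b%:R / 2%:R * ln (complex.Re (t * conjc t)).

Lemma flog_radial j t u : Cstar t -> Cstar u -> normc t = normc u -> flog j t = flog j u.
Proof. by move=> t0 u0 tu; rewrite /flog /fmet (e_radial j t0 u0 tu) !normc_sqr tu. Qed.

Lemma flog_exp j t : Cstar t -> normc t ^+ b * expR (flog j t) = complex.Re (fmet j t).
Proof.
move=> t0; have n0 := normc_gt0 t0; have g0 := fmet_Re_gt0 t0 j.
rewrite /flog normc_sqr lnXn // expRB lnK //.
have -> : b%:R / 2%:R * (ln (normc t) *+ 2) = b%:R * ln (normc t) by rewrite -[_ *+ 2]mulr_natr; field.
case: (b); last by rewrite mul0r expR0 divr1 mul1r.
by rewrite mul1r lnK // expr1 mulrCA divff ?mulr1 // gt_eqF.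
Qed.

Lemma flog_partner j t : Cstar t -> flog j t + flog (part j) t = 0.
Proof.
move=> t0; have g0 := fmet_Re_gt0 t0 j; have g1 := fmet_Re_gt0 t0 (part j).
have n0 := normc_gt0 t0.
suff : ln (complex.Re (fmet j t)) + ln (complex.Re (fmet (part j) t)) = b%:R * ln (complex.Re (t * conjc t)).
  by rewrite /flog => E; rewrite addrACA E; field.
rewrite -lnM //; have := fmet_partner t0 j; rewrite (fmet_real t0 j) (fmet_real t0 (part j)).
have -> : t * conjc t = (normc t ^+ 2)%:C.
  apply: eqC; first by rewrite normc_sqr.
  by rewrite !reE /=; ring.
rewrite -rmorphM -rmorphXn /= => /complexI ->.
by case: (b); rewrite ?expr1 ?expr0 ?mul1r ?mul0r ?ln1.
Qed.

Lemma col_mul m p q (A : 'M[C]_(m, p)) (B : 'M[C]_(p, q)) k j :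
  (A *m B) k j = (A *m col j B) k 0.
Proof. by rewrite !mxE; apply: eq_bigr => x _; rewrite !mxE. Qed.

Lemma adj_col m p q (A : 'M[C]_(m, p)) (B : 'M[C]_(m, q)) k j :
  (adj A *m B) k j = (adj (col k A) *m col j B) 0 0.
Proof. by rewrite !mxE; apply: eq_bigr => x _; rewrite !mxE. Qed.

Lemma flog_chart (i : chart D) j t : dom i t ->
  gen (dom i) (fun s => (flog j s)%:C) /\
  d_t (d_tbar (fun s => (flog j s)%:C)) t =
    mu * conjc mu * (fmet j t / fmet (ord_pred j) t - fmet (ordS j) t / fmet j t).
Proof.
move=> it; have oi := @hb_open _ _ _ hB i.
have colE s k : col k (frame_mx i s) = crd i s (e k s).
  by apply/matrixP => x y; rewrite ord1 !mxE.
have hP : mxholo (dom i) (frame_mx i).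
  by move=> k m; under [X in holomorphic _ X]eq_fun do rewrite mxE; exact: e_holo.
have uP s : dom i s -> frame_mx i s \in unitmx.
  by move=> si; apply: frame_unit => //; exact: (hb_sub hB si).
have KE s : dom i s -> \matrix_(k, m) (fmet k s *+ (k == m)) =
    adj (frame_mx i s) *m met_mx i s *m frame_mx i s.
  move=> si; have sC := hb_sub hB si.
  apply/matrixP => k m; rewrite mxE -mulmxA adj_col.
  have -> : col m (met_mx i s *m frame_mx i s) = met_mx i s *m crd i s (e m s).
    by rewrite -colE; apply/matrixP => x y; rewrite ord1 [LHS]mxE col_mul.
  rewrite colE mulmxA -(met_crd tt si).
  case: eqVneq => [->|km]; first by rewrite mulr1n.
  by rewrite mulr0n e_met.
have g0 k s : dom i s -> 0 < fmet k s by move=> si; apply: fmet_gt0; exact: (hb_sub hB si).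
have g1 k s : dom i s -> fmet k s != 0 by move=> si; rewrite gt_eqF // g0.
have PF s : dom i s -> frame_mx i s *m \matrix_(k, m) (mu *+ (k == ordS m)) =
    Phi_mx i s *m frame_mx i s.
  move=> si; have sC := hb_sub hB si.
  apply/matrixP => k m; rewrite [RHS]col_mul colE -(crd_ph tt si) e_ph //.
  rewrite (lin_Z (crd_lin hB si)) !mxE (bigD1 (ordS m)) //= big1 => [|x xm].
    by rewrite !mxE eqxx addr0 mulr1n mulrC.
  by rewrite !mxE (negbTE xm) mulr0n mulr0.
have [G E] := toda_local oi (met_gen tt i) (Phi_mxholo tt i) (fun s si => met_posdef tt si)
  (chart_flat tt (i := i)) hP uP KE g1 PF j (b%:R / 2%:R) it (fun s si => hb_sub hB si) g0.
have LE : (fun s => (flog j s)%:C) = (fun s => (ln (complex.Re (fmet j s)))%:C -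
    (b%:R / 2%:R)%:C * (ln (complex.Re (s * conjc s)))%:C).
  by apply/funext => s; rewrite /flog; apply: eqC; rewrite !reE /=; ring.
by rewrite LE.
Qed.

Lemma flog_gen j : gen Cstar (fun s => (flog j s)%:C).
Proof.
apply: gen_smooth; apply: smooth_local => t t0; have [i it] := hb_cover hB t0.
exists (dom i) => //; apply: gen_is_smooth; first exact: (@hb_open _ _ _ hB i).
exact: (flog_chart j it).1.
Qed.

Lemma laplace_scale (F : C -> C) (a : R) t : gen Cstar F -> 0 < a -> Cstar t ->
  d_t (d_tbar (fun s => F (a%:C * s))) t = (a ^+ 2)%:C * d_t (d_tbar F) (a%:C * t).
Proof.
move=> gF a0 t0; have oC := @open_Cstar R.
have aC s : Cstar s -> Cstar (a%:C * s) by move=> s0; rewrite /Cstar /= mulf_neq0 // realC_neq0.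
(* d_tbar F is the conjugate of d_t applied to the conjugate of F, so closure under d_t suffices. *)
have gQ : gen Cstar (d_tbar F).
  apply: (gen_eq _ (gen_conj (gen_dt oC (gen_conj gF)))) => s s0.
  by rewrite (isW_dt (isWJ (gen_isW oC gF s0))) conjcK.
have E s : Cstar s -> d_tbar F (a%:C * s) * a%:C = d_tbar (fun s => F (a%:C * s)) s.
  by move=> s0; rewrite (isW_dtb (isW_scale (gen_isW oC gF (aC s s0)))).
have W := isWM (isW_scale (gen_isW oC gQ (aC t t0))) (isW_cst a%:C t).
rewrite (isW_dt (isW_near (open_near_eq oC E t0) W)).
by rewrite mulr0 addr0 rmorphXn /=; ring.
Qed.

Let c := normc mu.
Let c0 : 0 < c. Proof. exact: normc_gt0. Qed.

(** As [flog] is radial, undoing t -> mu t only requires scaling by 1 / |mu|; the Laplacian then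
    gains |mu|^-2, which cancels the factor |mu|^2 of the flatness equation. *)
Definition todaw (j : int) (s : C) : R := flog (idx n j) (c^-1%:C * s).

Let scaleC s : Cstar s -> Cstar (c^-1%:C * s).
Proof. by move=> s0; rewrite /Cstar /= mulf_neq0 // realC_neq0 // invr_gt0. Qed.

Lemma expR_flogB j k t : Cstar t ->
  (expR (flog j t - flog k t))%:C = fmet j t / fmet k t.
Proof.
move=> t0; rewrite (fmet_real t0 j) (fmet_real t0 k) -!flog_exp // expRB -fmorphV -rmorphM.
congr (_%:C); have : normc t ^+ b != 0 by rewrite expf_neq0 // gt_eqF // normc_gt0.
have := expR_gt0 (flog k t); move: (expR (flog k t)) (normc t ^+ b) => x z x0 z0.
by field; rewrite z0 gt_eqF.
Qed.

Lemma todaw_solution : toda_solution n l todaw.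
Proof.
split.
- move=> j; apply: gen_is_smooth; first exact: (@open_Cstar R).
  apply: (gen_scale (f := fun s => (flog (idx n j) s)%:C) (c := c^-1)); first exact: scaleC.
  exact: flog_gen.
- by move=> j t t0; rewrite /todaw idx_period.
- by move=> j t t0; rewrite /todaw (idx_partner l_le) flog_partner //; exact: scaleC.
move=> j t t0; have t1 := scaleC t0.
have [i it] := hb_cover hB t1; have [_ E] := flog_chart (idx n j) it.
rewrite (laplace_scale (flog_gen (idx n j))) ?invr_gt0 // E rmorphB /=.
rewrite /todaw !expR_flogB // idx_pred idx_succ.
have -> : mu * conjc mu = (c ^+ 2)%:C.
  by apply: eqC; [rewrite normc_sqr|rewrite !reE /=; ring].
rewrite mulrA -rmorphM /= -exprMn mulVf ?expr1n ?mul1r //.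
by rewrite gt_eqF.
Qed.

Lemma todaw_radial : radial todaw.
Proof.
move=> j t t0; have nt := normc_gt0 t0.
apply: flog_radial; [exact: scaleC| |].
  by apply: scaleC; rewrite /Cstar /= normr_eq0.
rewrite !normcM; congr (_ * _).
by rewrite normCE normc_real // ltW.
Qed.

Variables (zeta : C) (zetaE : cexp zeta = mu).

(** The isomorphism takes coordinates in the frame e_j. Pulling back along t -> mu t turns dt into
    mu dt, matching phi = mu times the shift, and turns e^(w_j) into e^(flog j) by radiality; the
    twist restores t^b and |t|^b. *)
Lemma model_iso : isomorphic D (sign_twist b (pullback zeta (toda n l todaw))).
Proof.
exists (fun t (a : fib D t) => \col_j fcoord a j : fib (sign_twist b (pullback zeta (toda n l todaw))) t).
have lT t : Cstar t -> linear (fun a : fib D t => \col_j fcoord a j : 'cV[C]_N).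
  by move=> t0 x u v; apply/matrixP => k z; rewrite !mxE (fcoord_lin t0).
split.
- exact: lT.
- move=> t t0; exists (fun v : 'cV[C]_N => \sum_j v j 0 *: e j t) => [a|v].
    by rewrite [RHS](fcoordK t0); apply: eq_bigr => j _; rewrite mxE.
  by apply/matrixP => k z; rewrite ord1 mxE (fcoord_sum t0 (fun j => v j 0)).
- move=> i [] k m /=.
  have oi := @hb_open _ _ _ hB i.
  have -> : dom i `&` [set t | Cstar (cexp zeta * t)] = dom i.
    apply/seteqP; split=> [t []//|t it]; split=> //=.
    by rewrite /Cstar /= mulf_neq0 ?zetaE //; exact: (hb_sub hB it).
  apply: (holo_eq oi (f := fun t => t ^- b * tt_eta (e (part k) t) (frame i t m))).
    by move=> t _; rewrite mxE.
  apply: (holoM oi).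
    have hV := holoV oi (fun t it => hb_sub hB it) (holo_id oi).
    case: (b); first by apply: (holo_eq oi _ hV) => t _; rewrite expr1.
    by apply: (holo_eq oi _ (holo_cst oi 1)) => t _; rewrite expr0 invr1.
  apply: (eta_holo_chart tt (e_holo (part k) i) (q := fun t => frame i t m)).
  apply: (mxholo_eq oi _ (mxholo_cst oi (delta_mx m 0))) => t it.
  by rewrite (crd_frame hB it).
- move=> t t0 a d; rewrite (eta_fcoord t0) /=; congr (_ * _).
  by apply: eq_bigr => i _; apply: eq_bigr => j _; rewrite !mxE.
- move=> t t0 a d; rewrite (met_fcoord t0) /= mulr_sumr; apply: eq_bigr => j _.
  rewrite !mxE (fmet_real t0 j) -flog_exp // /todaw idx_ord zetaE.
  have -> : flog j (c^-1%:C * (mu * t)) = flog j t.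
    have m0 : Cstar (mu * t) by rewrite /Cstar /= mulf_neq0.
    apply: flog_radial => //; first exact: scaleC.
    rewrite !normcM -/c normc_real ?invr_ge0 ?(ltW c0) // mulrA mulVf ?mul1r //.
    by rewrite gt_eqF.
  have -> : `|t| ^+ b = (normc t ^+ b)%:C by case: (b).
  move: (conjc _) (fcoord d j) (expR _) (normc t ^+ b) => x y z q.
  by rewrite (rmorphM _ q z) /=; ring.
- move=> t t0 X a; rewrite (Phi_form tt t0) -/(ph a) (lin_Z (lT t t0)) /= zetaE.
  rewrite mulrC -scalerA; congr (_ *: _).
  rewrite (ph_fcoord t0) (lin_sum (lT t t0)) scaler_sumr; apply: eq_bigr => j _.
  rewrite (lin_Z (lT t t0)) mxE scalerA; congr (_ *: _).
  by apply/matrixP => k z; rewrite ord1 !mxE (fcoord_e t0) eqxx andbT.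
Qed.
End CyclicFrame.

(** * Roots of the eigenvalue and of the sign *)

Section Root.
Variable R : realType.
Local Notation C := R[i].

Lemma nth_root (c : C) n : c != 0 -> exists2 mu : C, mu != 0 & mu ^+ n.+1 = c.
Proof.
move=> /pt_surj[s [y ->]]; exists (pt (s / n.+1%:R) (y / n.+1%:R)); first exact: pt_neq0.
have N0 : n.+1%:R != 0 :> R by rewrite pnatr_eq0.
have E (x : R) : (x / n.+1%:R) *+ n.+1 = x by rewrite -[LHS]mulr_natr divfK.
by rewrite /pt (exprMn_comm _ (mulrC _ _)) cisX E -rmorphXn /= -expRM_natr divfK.
Qed.

Lemma cexp_surj (mu : C) : mu != 0 -> exists zeta, cexp zeta = mu.
Proof.
move=> /pt_surj[s [y ->]]; exists (s +i* (- y)).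
rewrite /pt cisE /cexp /= cosN sinN mulrC.
by [].
Qed.

Variables (n : nat).
Local Notation N := n.+1.
Local Notation w := (omega R n).

(** The choice s = e^(i pi d / N). Among the N-th roots of (-1)^d it is singled out by s^2 = w^d,
    which turns the pairing condition s^2 w^(i+j) = 1 into N | d + i + j. *)
Lemma sign_root (d : bool) : exists s : C,
  [/\ s != 0, s ^+ N = sgn R d, conjc s * s = 1 & s ^+ 2 = w ^+ d].
Proof.
exists (cis (- (d%:R * pi / N%:R))); split.
- exact: cis_neq0.
- rewrite cisX mulNrn -[_ *+ N]mulr_natr divfK ?pnatr_eq0 //.
  case: d; last by rewrite mul0r oppr0 cis0.
  by rewrite mul1r cisE cosN sinN cospi sinpi opprK /sgn expr1; apply: eqC; rewrite !reE /= ?oppr0.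
- exact: cis_conj.
- rewrite cisX omegaE; case: d; last by rewrite !mul0r oppr0 mul0rn cis0 expr0.
  by rewrite expr1 mul1r mulNrn -[_ *+ 2]mulr_natl mulrA.
Qed.

(** The sum d + i + j is below 2 N, hence divisible by N only when it is 0 or N. This is the pattern
    of eta for l = 1 when d is false and for l = 0 when d is true. *)
Lemma toda_eta_root (d : bool) (i j : 'I_N) :
  (w ^+ (d + (i + j)) == 1) = ((if (i < ~~ d)%N then i + j + 1 == ~~ d else i + j == n + ~~ d)%N).
Proof.
rewrite -(prim_order_dvd (omega_prim R n)); have := ltn_ord i; have := ltn_ord j.
move: (nat_of_ord i) (nat_of_ord j) => {}i {}j iN jN.
have E m : (m < N + N)%N -> (N %| m)%N = (m == 0%N) || (m == N).
  move=> mN; apply/idP/orP => [/dvdnP[q mE]|[]/eqP -> //].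
  by case: q mE => [|[|q]] mE; [left|right|]; nia.
have dij : (d + (i + j) < N + N)%N by case: (d); lia.
rewrite (E _ dij) {E dij}; case: d => /=; first by lia.
by case: (ltnP i 1); lia.
Qed.
End Root.

(** * Assembling the isomorphism with the Toda structure *)

Section Proof.
Variable R : realType.
Local Notation C := R[i].
Variables (n : nat) (D : ttdata R n.+1) (tt : is_ttstar D).
Let hB := tt_bundle tt.
Local Notation N := n.+1.
Local Notation w := (omega R n).
Variables (S : forall t, fib D t -> fib D t) (S_iso : @is_iso R N D (scale_Phi w D) S).

Lemma fr_holo (V : forall t, fib D t) (i : chart D) s j :
  mxholo (dom i) (fun t => crd i t (V t)) -> mxholo (dom i) (fun t => crd i t (fr S s j (V t))).
Proof.
move=> hV; have oi := @hb_open _ _ _ hB i.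
have hk k : mxholo (dom i) (fun t => crd i t (iter k (@S t) (V t))).
  elim: k => [//|k IH].
  apply: (mxholo_eq oi _ (mxholo_mul oi (sg_holo S_iso i) IH)) => t it.
  by rewrite iterS (crd_S tt S_iso it).
move=> a b.
apply: (holo_eq oi (f := fun t => \sum_(k < N) ((s * w ^+ j)^-1 ^+ k) * crd i t (iter k (@S t) (V t)) a b)).
  move=> t it; rewrite /fr (lin_sum (crd_lin hB it)) summxE; apply: eq_bigr => k _.
  by rewrite (lin_Z (crd_lin hB it)) mxE.
apply: (holo_sum oi) => k _; apply: (holoM oi); first exact: holo_cst oi _.
exact: hk.
Qed.
End Proof.

Theorem proposition4p3 (R : realType) (n : nat) (n_gt0 : (0 < n)%N)
  (D : ttdata R n.+1) (D_ttstar : is_ttstar D)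
  (Phi_nonvanishing : forall t : R[i], Cstar t ->
     exists (X : R[i]) (a : fib D t), tt_Phi X a != 0)
  (D_fixed : isomorphic D (scale_Phi (cexp (0 +i* (2%:R * pi / n.+1%:R))) D))
  (T : forall (y : R) (t : R[i]), fib D (cexp (0 +i* y) * t) -> fib D t)
  (T_iso : forall y : R,
     @is_iso R n.+1 (scale_Phi (cexp (- (0 +i* y))) (pullback (0 +i* y) D)) D
       (T y))
  (T_cont : forall (t : R[i]) (a : fib D t), Cstar t ->
     continuous_curve (fun y : R => map_at (T y) a)) :
  exists (l : nat) (w : int -> R[i] -> R) (zeta : R[i]) (b : bool),
    [/\ (l <= n)%N,
        toda_solution n l w,
        radial w,
        isomorphic D (sign_twist b (pullback zeta (toda n l w))) &
        (forall (t : R[i]) (a : fib D t), Cstar t ->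
           map_at (T (2%:R * pi)) a = map_at (T 0) a) -> b = false].
Proof.
case: D_fixed => S S_iso0.
have S_iso : @is_iso R n.+1 D (scale_Phi (omega R n) D) S := S_iso0.
have tt := D_ttstar; have hB := tt_bundle tt.
have [c Hc] := phN_exists tt S_iso.
have c_const t : t != 0 -> c t = c 1.
  apply: radial_holo_const; first exact: (c_holo tt Hc).
  move=> u u0; have [s [y ->]] := pt_surj u0.
  by rewrite normc_pt (c_rot tt Hc T_iso) // expR_pt; exact: pt_neq0.
have c0 : c 1 != 0.
  apply/eqP => c10; apply: (not_nilpotent tt Phi_nonvanishing T_iso n_gt0) => i t it.
  by rewrite (Phi_pow tt Hc it) (c_const t (hb_sub hB it)) c10 raddf0.
have [mu mu0 muN] := nth_root n c0.
have HmuN (i : chart D) t : dom i t -> Phi_mx i t ^+ n.+1 = (mu ^+ n.+1)%:M.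
  by move=> it; rewrite (Phi_pow tt Hc it) (c_const t (hb_sub hB it)) muN.
have [A LA] := lifts_exist tt S_iso mu0 HmuN.
have [b [V [cV pV VA bP]]] := A_global tt S_iso T_iso T_cont mu0 HmuN LA.
have [d Hd] := S_order tt S_iso mu0 LA cV VA.
have [s [s0 sN ss s2]] := sign_root R n d.
have [zeta zetaE] := cexp_surj mu0.
have SV t : Cstar t -> iter n.+1 (@S t) (V t) = s ^+ n.+1 *: V t.
  move=> t0; have [x -> _] := VA t t0.
  by rewrite (iterS_Z S_iso t0) Hd // sN !scalerA mulrC.
have nV t : Cstar t -> tt_eta (V t) (V t) = t ^+ b / n.+1%:R.
  by move=> t0; have [x -> <-] := VA t t0; rewrite (eta_scale tt _ _ _ _ t0) (LA t t0).2.
have hV (i : chart D) : mxholo (dom i) (fun t => crd i t (V t)).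
  have -> : dom i = Cstar `&` dom i.
    by apply/seteqP; split=> [t it|t []//]; split=> //; exact: (hb_sub hB it).
  have oC := @open_Cstar R.
  apply: (eigensection_holo tt S_iso mu0 HmuN oC (@subset_refl _ _) cV pV nV).
    by move=> t t0; rewrite mulf_neq0 ?invr_eq0 ?pnatr_eq0 // expf_neq0.
  apply: (holoM oC); last exact: holo_cst oC _.
  case: (b); first exact: holo_id oC.
  exact: holo_cst oC _.
pose e (j : 'I_n.+1) t := fr S s j (V t).
have l_le : (~~ d <= n)%N by case: d {Hd sN s2}.
have e_holo j i : mxholo (dom i) (fun t => crd i t (e j t)) by exact: fr_holo.
have e_ph j t : Cstar t -> ph (e j t) = mu *: e (ordS j) t.
  by move=> t0; rewrite /e (ph_fr tt S_iso t0 s j (pV t t0)) fr_mod.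
have e_eta i j t : Cstar t -> tt_eta (e i t) (e j t) = t ^+ b * toda_eta R n (~~ d) i j.
  move=> t0; rewrite /e (fr_eta tt S_iso t0 mu0 s0 i j (pV t t0) (SV t t0) (nV t t0)).
  rewrite s2 -exprD toda_eta_root /toda_eta.
  by rewrite mulr_natr mulrb.
have e_met (i j : 'I_n.+1) t : Cstar t -> i != j -> tt_met (e i t) (e j t) = 0.
  move=> t0 ij; exact: (fr_met tt S_iso t0 s0 (SV t t0) ss (ltn_ord i) (ltn_ord j) ij).
have e_radial j t u : Cstar t -> Cstar u -> normc t = normc u ->
    tt_met (e j t) (e j t) = tt_met (e j u) (e j u).
  move=> t0 u0 tu; have [x Vx xx] := VA t t0; have [z Vz zz] := VA u u0.
  rewrite /e Vx Vz !(fr_scale S_iso) // (met_scale tt t0) (met_scale tt u0).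
  rewrite (fr_met_radial tt S_iso T_iso T_cont mu0 LA s j t0 u0 tu); congr (_ * _).
  (* V and A differ by x with x^2 = t^b, so the metric only sees |x|^2 = |t|^b, which is radial. *)
  have nn (p : R[i]) : conjc p * p = (normc (p * p))%:C.
    by rewrite mulrC normcM -expr2; apply: eqC; rewrite ?normc_sqr // !reE /=; ring.
  by rewrite !nn xx zz; case: (b); rewrite ?expr1 ?tu.
exists (~~ d), (todaw e mu b), zeta, b; split.
- exact: l_le.
- exact: todaw_solution.
- exact: todaw_radial.
- exact: model_iso.
by move=> H; apply: bP; apply: H; exact: oner_neq0.
Qed.
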